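(* Let $\mathfrak G=(\mathfrak X,\mathfrak E)$ be a $(q+1)$-regular tree ($q\ge1$), $G=\mathrm{Aut}(\mathfrak G)$, $K$ the stabilizer in $G$ of a vertex $o$, and let $V=V_0\oplus V_1=\mathrm{Maps}(\iota^{-1}(o),\mathbb C)$ be the permutation representation of $K$ on functions on the edges starting in $o$. Then the operator valued Hecke algebra $\mathcal H(G,K;V)$, acting on $C(G\times_KV)\cong\mathrm{Maps}(\mathfrak E,\mathbb C)$, is generated by the edge Laplacian $\Delta^{\mathrm e}$ and the inversion operator $\Xi$ subject to the relations $$\Xi^2=\mathrm{Id},\qquad \Delta^{\mathrm e}\,\Xi\,\Delta^{\mathrm e}=q\,\Xi+(q-1)\Delta^{\mathrm e}.$$ That is, the algebra of operators on $\mathrm{Maps}(\mathfrak E,\mathbb C)$ by which $\mathcal H(G,K;V)$ acts (faithfully) is generated by $\Delta^{\mathrm e}$ and $\Xi$, and it is isomorphic to the unital associative $\mathbb C$-algebra presented by these two generators and two relations.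
   Context: Directed edges: $\mathfrak E\subseteq\mathfrak X^2$ consists of all ordered pairs of neighbors; for $\vec e=(a,b)$ put $\iota(\vec e)=a$, $\tau(\vec e)=b$, $\vec e^{\,\mathrm{op}}=(b,a)$. On $\mathrm{Maps}(\mathfrak E,\mathbb C)$: $\Delta^{\mathrm e}f(\vec e)=\sum_{\iota(\vec e\,')=\tau(\vec e),\ \vec e\,'\neq\vec e^{\,\mathrm{op}}}f(\vec e\,')$ and $\Xi f(\vec e)=f(\vec e^{\,\mathrm{op}})$. $G$ carries its usual totally disconnected locally compact topology (stabilizers of finite sets are open), it is unimodular and $K$ is compact open; $dh$ is a Haar measure on $G$, $dk$ the normalized Haar measure on $K$. For a finite-dimensional representation $(\pi,V)$ of $K$: $C(G\times_KV)=\{F\colon G\to V\mid F(gk)=\pi(k)^{-1}F(g)\ \forall g\in G,k\in K\}$. Let $C_c(G,\mathrm{End}(V))^{\mathrm{cj}_K}$ be the space of compactly supported continuous $\Phi\colon G\to\mathrm{End}(V)$ with $\Phi(kgk^{-1})=\pi(k)\Phi(g)\pi(k)^{-1}$, an algebra under $(\Phi_1*\Phi_2)(g)=\int_G\Phi_2(h)\circ\Phi_1(gh^{-1})\,dh$. It acts on $C(G\times_KV)$ by $(F*\Phi)(g)=\int_G\Phi(h)F(gh^{-1})\,dh$ (with $(F*\Phi_1)*\Phi_2=F*(\Phi_1*\Phi_2)$), and the kernel of this action is $U=\{\Phi\mid\int_K\pi(k)\Phi(gk)\,dk=0\ \forall g\}$. The operator valued Hecke algebra is $\mathcal H(G,K;V)=C_c(G,\mathrm{End}(V))^{\mathrm{cj}_K}/U$.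 $V_0\subset V$ is the subspace of constant functions and $V_1=\{f\in V\mid\sum_{\iota(\vec e)=o}f(\vec e)=0\}$. Fix an edge $\vec e_1$ with $\iota(\vec e_1)=o$; the identification $\Theta\colon C(G\times_KV)\to\mathrm{Maps}(\mathfrak E,\mathbb C)$ is $\Theta F(g\vec e_1)=F(g)(\vec e_1)$ for $g\in G$. *)

(* Defs.v *)
From HB Require Import structures.
From mathcomp Require Import all_boot all_order all_algebra.
From mathcomp Require Import all_classical all_reals all_analysis.
From mathcomp Require Import complex.
(* The notations of monalg are incompatible with those of MathComp-Analysis. *)
From mathcomp.multinomials Require Import -(notations) monalg.

Set Implicit Arguments.
Unset Strict Implicit.
Unset Printing Implicit Defensive.

Import Order.TTheory GRing.Theory Num.Theory.
Import numFieldNormedType.Exports.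

Local Open Scope classical_set_scope.
Local Open Scope ring_scope.

(* R[i], viewed as a numClosedFieldType so that the topology of the modulus is
   inferred. *)
Definition Cplx (R : realType) : numClosedFieldType := complex R.

Record sgraph := SGraph {
  vertex :> choiceType;
  adj : rel vertex;
  adj_sym : symmetric adj;
  adj_irr : irreflexive adj }.

Definition connected_graph (X : sgraph) :=
  forall x y : X, exists p : seq X, path (@adj X) x p /\ last x p = y.

Definition acyclic_graph (X : sgraph) :=
  forall c : seq X, (2 < size c)%N -> ~ ucycle (@adj X) c.

Definition regular_graph (k : nat) (X : sgraph) :=
  forall x : X, ([set y | adj x y] #= `I_k)%card.

Definition regular_tree (k : nat) (X : sgraph) :=
  [/\ connected_graph X, acyclic_graph X & regular_graph k X].

Record aut (X : sgraph) := Aut {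
  aut_fun :> X -> X;
  aut_inv : X -> X;
  aut_funK : cancel aut_fun aut_inv;
  aut_invK : cancel aut_inv aut_fun;
  aut_adj : forall x y, adj (aut_fun x) (aut_fun y) = adj x y }.

HB.instance Definition _ (X : sgraph) := gen_eqMixin (aut X).
HB.instance Definition _ (X : sgraph) := gen_choiceMixin (aut X).

Section AutGroup.
Variable X : sgraph.
Implicit Types f g h : aut X.

Lemma autP f g : f =1 g -> f = g.
Proof.
case: f g => [f f' fK f'K fA] [g g' gK g'K gA] /= /funext fg.
subst g; have /funext f'g' : f' =1 g' by move=> x; rewrite -{1}[x]g'K fK.
by subst g'; congr Aut; exact: Prop_irrelevance.
Qed.

Definition aut1 : aut X.
Proof. by exists id id. Defined.

Definition autM f g : aut X.
Proof.
exists (f \o g) (aut_inv g \o aut_inv f).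
- by move=> x /=; rewrite !aut_funK.
- by move=> x /=; rewrite !aut_invK.
- by move=> x y /=; rewrite !aut_adj.
Defined.

Definition autV f : aut X.
Proof.
exists (aut_inv f) f; [exact: aut_invK | exact: aut_funK |].
by move=> x y; rewrite -(aut_adj f) !aut_invK.
Defined.

Let autMA : associative autM.
Proof. by move=> f g h; apply/autP. Qed.
Let aut1M : left_id aut1 autM.
Proof. by move=> f; apply/autP. Qed.
Let autM1 : right_id aut1 autM.
Proof. by move=> f; apply/autP. Qed.
Let autVM : left_inverse aut1 autV autM.
Proof. by move=> f; apply/autP => x /=; rewrite aut_funK. Qed.
Let autMV : right_inverse aut1 autV autM.
Proof. by move=> f; apply/autP => x /=; rewrite aut_invK. Qed.

HB.instance Definition _ :=
  isGroup.Build (aut X) autMA aut1M autM1 autVM autMV.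
HB.instance Definition _ := isPointed.Build (aut X) aut1.

(* The cosets g Stab(S), S finite, form a base of the topology. *)
Definition aut_open : set_system (aut X) :=
  [set A | forall g, A g ->
    exists S : seq X, forall h, {in S, h =1 g} -> A h].

Let aut_openT : aut_open setT.
Proof. by move=> g _; exists [::]. Qed.
Let aut_openI : setI_closed aut_open.
Proof.
move=> A B oA oB g [/oA [S SA] /oB [T TB]]; exists (S ++ T) => h hg.
by split; [apply: SA | apply: TB] => x xS; apply: hg; rewrite mem_cat xS ?orbT.
Qed.
Let aut_open_bigU (I : Type) (F : I -> set (aut X)) :
  (forall i, aut_open (F i)) -> aut_open (\bigcup_i F i).
Proof. by move=> oF g [i _ /(oF i) [S SF]]; exists S => h /SF Fh; exists i. Qed.

HB.instance Definition _ :=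
  isOpenTopological.Build (aut X) aut_openT aut_openI aut_open_bigU.

End AutGroup.

HB.mixin Record isTopologicalGroup T & PointedTopological T & Group T := {
  mulg_continuous : continuous (fun u : T * T => (u.1 * u.2)%g);
  invg_continuous : continuous (fun u : T => (u^-1)%g) }.

#[short(type="topologicalGroupType")]
HB.structure Definition TopologicalGroup :=
  {T of PointedTopological T & Group T & isTopologicalGroup T}.

Section AutTopologicalGroup.
Variable X : sgraph.

Let coset_nbhs (g : aut X) (S : seq X) :
  nbhs g [set h : aut X | {in S, h =1 g}].
Proof.
exists [set h : aut X | {in S, h =1 g}]; split; [|by []|by []].
by move=> h hg; exists S => k kh x xS; rewrite kh// hg.
Qed.

Let autM_continuous : continuous (fun u : aut X * aut X => (u.1 * u.2)%g).
Proof.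
move=> [g h] A /= [B [oB Bgh BA]]; have [S SB] := oB _ Bgh.
exists ([set k : aut X | {in map h S, k =1 g}],
        [set k : aut X | {in S, k =1 h}]).
  by split; exact: coset_nbhs.
move=> [g' h'] /= [g'g h'h]; apply: BA; apply: SB => x xS /=.
by rewrite h'h// g'g// map_f.
Qed.

Let autV_continuous : continuous (fun u : aut X => (u^-1)%g).
Proof.
move=> g A /= [B [oB Bg BA]]; have [S SB] := oB _ Bg.
have := coset_nbhs g (map (aut_inv g) S); apply: filterS => h hg.
apply: BA; apply: SB => x xS /=; apply: (can_inj (aut_funK h)).
by rewrite /= aut_invK hg ?map_f// aut_invK.
Qed.

HB.instance Definition _ :=
  isTopologicalGroup.Build (aut X) autM_continuous autV_continuous.
End AutTopologicalGroup.

(* The vertex stabilizer, with the subspace topology. *)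
Record stab (X : sgraph) (o : X) := Stab {
  stab_val :> aut X;
  stabP : stab_val o == o }.

Section StabGroup.
Variables (X : sgraph) (o : X).

HB.instance Definition _ := [isSub for @stab_val X o].
HB.instance Definition _ := [Choice of stab o by <:].

Let stab_closed : group_closed (fun g : aut X => g o == o).
Proof.
split=> [|g h]; rewrite !unfold_in //= => /eqP go /eqP ho; apply/eqP.
by rewrite /= -{1}ho aut_funK.
Qed.
HB.instance Definition _ :=
  SubChoice_isSubGroup.Build (aut X) _ (stab o) stab_closed.
HB.instance Definition _ := isPointed.Build (stab o) 1%g.
HB.instance Definition _ :=
  Topological.copy (stab o) (initial_topology (@stab_val X o)).

Let stab_val_continuous : continuous (@stab_val X o).
Proof. exact: initial_continuous. Qed.

Let to_stab_continuous (T : topologicalType) (f : T -> stab o) :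
  continuous (fun t => stab_val (f t)) -> continuous f.
Proof.
move=> fc; apply/continuousP => _ [B oB <-].
by rewrite -comp_preimage; move/continuousP: fc; apply.
Qed.

Let stabM_continuous :
  continuous (fun u : stab o * stab o => (u.1 * u.2)%g).
Proof.
apply: to_stab_continuous => u A Au.
have [[B1 B2] /= [nB1 nB2] BA] :=
  mulg_continuous (stab_val u.1, stab_val u.2) A Au.
exists (stab_val (o := o) @^-1` B1, stab_val (o := o) @^-1` B2).
  by split; exact: stab_val_continuous.
by move=> v [v1 v2]; apply: (BA (stab_val v.1, stab_val v.2)).
Qed.

Let stabV_continuous : continuous (fun u : stab o => (u^-1)%g).
Proof.
apply: to_stab_continuous => u.
apply: (@continuous_comp _ _ _ (@stab_val X o) (fun g : aut X => (g^-1)%g)).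
- exact: stab_val_continuous.
- exact: invg_continuous.
Qed.

HB.instance Definition _ :=
  isTopologicalGroup.Build (stab o) stabM_continuous stabV_continuous.
End StabGroup.

Section Haar.
Variables (R : realType) (T : topologicalGroupType).

Definition borel := g_sigma_algebraType (@open T).

(* Left Haar measures.  No regularity is required: it is automatic on the
   second countable locally compact groups considered here. *)
Definition haar_measure (mu : {measure set borel -> \bar R}) :=
  [/\ forall (g : T) (A : set borel), measurable A ->
        mu [set (g * h)%g | h in A] = mu A,
      forall A : set T, compact A -> (mu A < +oo)%E &
      mu setT != 0%E].

Definition cintegral (mu : {measure set borel -> \bar R}) (f : T -> Cplx R) :
    Cplx R :=
  Complex (\int[mu]_x complex.Re (f x)) (\int[mu]_x complex.Im (f x)).

End Haar.

Record edge (X : sgraph) := Edge {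
  edge_val : X * X;
  edgeP : adj edge_val.1 edge_val.2 }.

HB.instance Definition _ (X : sgraph) := [isSub for @edge_val X].
HB.instance Definition _ (X : sgraph) := [Choice of edge X by <:].

Section Edges.
Variable X : sgraph.
Implicit Types (e : edge X) (g : aut X).

Definition src e : X := (edge_val e).1.
Definition tgt e : X := (edge_val e).2.

Let eop_subproof e : adj (tgt e, src e).1 (tgt e, src e).2.
Proof. by rewrite /= adj_sym; exact: edgeP. Qed.
Definition eop e : edge X := Edge (eop_subproof e).

Let eact_subproof g e : adj (g (src e), g (tgt e)).1 (g (src e), g (tgt e)).2.
Proof. by rewrite /= aut_adj; exact: edgeP. Qed.
Definition eact g e : edge X := Edge (eact_subproof g e).

End Edges.

Section EdgeOperators.
Variables (R : realType) (X : sgraph).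
Local Notation C := (Cplx R).

Definition edge_laplacian (f : edge X -> C) : edge X -> C := fun e =>
  \sum_(e' \in [set e' | src e' = tgt e /\ e' <> eop e]) f e'.

Definition edge_inversion (f : edge X -> C) : edge X -> C :=
  fun e => f (eop e).

End EdgeOperators.

Section PermutationRepresentation.
Variables (R : realType) (X : sgraph) (o : X).

Definition star := {e : edge X | src e == o}.

Let star_act_subproof (k : stab o) (e : star) : src (eact k (val e)) == o.
Proof. by rewrite /src /= (eqP (valP e)) stabP. Qed.
Definition star_act (k : stab o) (e : star) : star :=
  exist _ (eact k (val e)) (star_act_subproof k e).

Definition permV := star -> Cplx R.

Definition perm_rep (k : stab o) (v : permV) : permV :=
  fun e => v (star_act k^-1%g e).

Definition V0 : set permV := [set v | exists c, v = cst c].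
Definition V1 : set permV := [set v | \sum_(e \in [set: star]) v e = 0].

End PermutationRepresentation.

Section HeckeAlgebra.
Variables (R : realType) (X : sgraph) (o : X).
Local Notation C := (Cplx R).
Local Notation V := (permV R o).
Local Notation pi := (@perm_rep R X o).
Implicit Types (F : aut X -> V) (Phi : aut X -> V -> V).

Definition sections : set (aut X -> V) :=
  [set F | forall (g : aut X) (k : stab o),
    F (g * stab_val k)%g = pi k^-1%g (F g)].

(* End(V) is the set of linear maps among V -> V.  As V is finite dimensional,
   an End(V)-valued function is continuous iff its coefficients are, and it is
   integrated coefficientwise. *)
Definition Cc_cj : set (aut X -> V -> V) :=
  [set Phi | [/\ forall g, linear (Phi g),
     forall v e, continuous (fun g => Phi g v e : C),
     compact (closure [set g | Phi g <> cst 0]) &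
     forall (k : stab o) (g : aut X),
       Phi (stab_val k * g * (stab_val k)^-1)%g =
       pi k \o Phi g \o pi k^-1%g]].

Definition convolution (mu : {measure set (borel (aut X)) -> \bar R})
    (Phi1 Phi2 : aut X -> V -> V) : aut X -> V -> V :=
  fun g v e => cintegral mu (fun h => Phi2 h (Phi1 (g * h^-1)%g v) e).

Definition hecke_act (mu : {measure set (borel (aut X)) -> \bar R})
    F Phi : aut X -> V :=
  fun g e => cintegral mu (fun h => Phi h (F (g * h^-1)%g) e).

(* The ideal U: the Hecke algebra H(G, K; V) is Cc_cj modulo hecke_null. *)
Definition hecke_null (nu : {measure set (borel (stab o)) -> \bar R}) :
    set (aut X -> V -> V) :=
  [set Phi | Cc_cj Phi /\ forall g v e,
    cintegral nu (fun k => pi k (Phi (g * stab_val k)%g v) e) = 0].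

(* G acts transitively on the edges, so that g below satisfies g e1 = e, and the
   value does not depend on its choice. *)
Definition Theta (e1 : star o) F : edge X -> C :=
  fun e => F (xget 1%g [set g : aut X | eact g (val e1) = e]) e1.

Definition hecke_op (mu : {measure set (borel (aut X)) -> \bar R})
    (e1 : star o) Phi (f : edge X -> C) : edge X -> C :=
  Theta e1 (hecke_act mu ('pinv_(cst (cst 0)) sections (Theta e1) f) Phi).

End HeckeAlgebra.

Section OperatorAlgebras.
Variables (C : fieldType) (M : lmodType C).

Definition operator_subalgebra : set (set (M -> M)) :=
  [set B | [/\ B id, forall S T, B S -> B T -> B (S \o T),
     forall S T, B S -> B T -> B (S \+ T) &
     forall (c : C) S, B S -> B (c \*: S)]].

Definition operator_algebra_gen (G : set (M -> M)) : set (M -> M) :=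
  smallest operator_subalgebra G.

Definition algebra_action (A : lalgType C) (rho : A -> M -> M) :=
  [/\ rho 1 = id, forall a b, rho (a * b) = rho a \o rho b,
      forall a b, rho (a + b) = rho a \+ rho b,
      forall (c : C) a, rho (c *: a) = c \*: rho a &
      forall a, linear (rho a)].

End OperatorAlgebras.

Section TwoSidedIdeals.
Variables (C : fieldType) (A : lalgType C).

Definition two_sided_ideal : set (set A) :=
  [set J | [/\ J 0, forall a b, J a -> J b -> J (a - b) &
               forall a b, J b -> J (a * b) /\ J (b * a)]].

Definition ideal_gen (S : set A) : set A := smallest two_sided_ideal S.

Lemma ideal_gen_two_sided (S : set A) : two_sided_ideal (ideal_gen S).
Proof.
split=> [J [[]]|a b Ia Ib J JI|a b Ib]//.
  by case: (JI) => -[_ JB _] _; apply: JB; [exact: Ia | exact: Ib].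
by split=> J JI; case: (JI) => -[_ _ JM] _; have [] := JM a b (Ib _ JI).
Qed.

Definition in_ideal_gen (S : set A) : {pred A} := fun a => `[< ideal_gen S a >].

Let in_ideal_gen_zmod (S : set A) : zmod_closed (in_ideal_gen S).
Proof.
have [I0 IB _] := ideal_gen_two_sided S.
by split=> [|a b /asboolP Ia /asboolP Ib]; apply/asboolP => //; exact: IB.
Qed.
HB.instance Definition _ (S : set A) :=
  GRing.isZmodClosed.Build A (in_ideal_gen S) (in_ideal_gen_zmod S).

(* The quotient A / (S), for S generating a proper ideal. *)
Definition quot_alg (S : set A) of ~ ideal_gen S 1 : Type :=
  Quotient.quot (in_ideal_gen S).

End TwoSidedIdeals.

Section QuotientAlgebra.
Variables (C : fieldType) (A : lalgType C) (S : set A).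
Variable S_proper : ~ ideal_gen S 1.
Local Notation I := (ideal_gen S).
Local Notation Q := (quot_alg S_proper).

HB.instance Definition _ := GRing.Zmodule.on Q.

Definition quot_class (a : A) : Q :=
  (\pi_(Quotient.quot (in_ideal_gen S)) a)%qT.
Local Notation cls := quot_class.

Let rep (u : Q) : A := repr (u : Quotient.quot (in_ideal_gen S)).
Let repK u : cls (rep u) = u.
Proof. exact: reprK. Qed.

Lemma quot_classP a b : cls a = cls b <-> I (a - b).
Proof.
have e : (a - b \in in_ideal_gen S) = (cls a == cls b).
  exact: Quotient.idealrBE.
split=> [ab|Iab]; last by apply/eqP; rewrite -e; exact/asboolP.
by have /asboolP : a - b \in in_ideal_gen S by rewrite e ab.
Qed.

Let rep_cls a : I (rep (cls a) - a).
Proof. by apply/quot_classP; rewrite repK. Qed.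

Let one : Q := cls 1.
Let mul (u v : Q) : Q := cls (rep u * rep v).
Let scale (c : C) (u : Q) : Q := cls (c *: rep u).

Let clsD a b : cls (a + b) = cls a + cls b.
Proof. exact: Quotient.pi_add. Qed.

Let clsM a b : cls (a * b) = mul (cls a) (cls b).
Proof.
apply/esym/quot_classP; have [_ IB IM] := ideal_gen_two_sided S.
have -> : rep (cls a) * rep (cls b) - a * b =
    (rep (cls a) - a) * rep (cls b) - (- a) * (rep (cls b) - b).
  by rewrite mulrBl mulNr opprK mulrBr addrA subrK.
apply: IB; first exact: (IM _ _ (rep_cls a)).2.
exact: (IM _ _ (rep_cls b)).1.
Qed.

Let clsZ c a : cls (c *: a) = scale c (cls a).
Proof.
apply/esym/quot_classP; have [_ IB IM] := ideal_gen_two_sided S.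
rewrite -scalerBr -[X in _ *: X]mul1r scalerAl.
exact: (IM _ _ (rep_cls a)).1.
Qed.

Let mulA : associative mul.
Proof. by move=> u v w; rewrite -[u]repK -[v]repK -[w]repK -!clsM mulrA. Qed.
Let mul1u : left_id one mul.
Proof. by move=> u; rewrite -[u]repK -clsM mul1r. Qed.
Let mulu1 : right_id one mul.
Proof. by move=> u; rewrite -[u]repK -clsM mulr1. Qed.
Let mulDl : left_distributive mul +%R.
Proof.
move=> u v w; rewrite -[u]repK -[v]repK -[w]repK.
by rewrite -clsD -!clsM mulrDl clsD.
Qed.
Let mulDr : right_distributive mul +%R.
Proof.
move=> u v w; rewrite -[u]repK -[v]repK -[w]repK.
by rewrite -clsD -!clsM mulrDr clsD.
Qed.
Let one_neq0 : one != 0.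
Proof.
apply/eqP => e0; apply: S_proper; rewrite -[1]subr0; apply/quot_classP.
by rewrite -/one e0; apply/(addrI one); rewrite -clsD !addr0.
Qed.
HB.instance Definition _ :=
  GRing.Zmodule_isNzRing.Build Q mulA mul1u mulu1 mulDl mulDr one_neq0.

Let scaleA c c' u : scale c (scale c' u) = scale (c * c') u.
Proof. by rewrite -[u]repK -!clsZ scalerA. Qed.
Let scale1 : left_id 1 scale.
Proof. by move=> u; rewrite -[u]repK -clsZ scale1r. Qed.
Let scaleDr : right_distributive scale +%R.
Proof.
move=> c u v; rewrite -[u]repK -[v]repK.
by rewrite -clsD -!clsZ scalerDr clsD.
Qed.
Let scaleDl u : {morph scale^~ u : c c' / c + c'}.
Proof. by move=> c c' /=; rewrite -[u]repK -!clsZ scalerDl clsD. Qed.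
HB.instance Definition _ :=
  GRing.Zmodule_isLmodule.Build C Q scaleA scale1 scaleDr scaleDl.

Let scaleAl (c : C) (u v : Q) : c *: (u * v) = (c *: u) * v.
Proof.
rewrite -[u]repK -[v]repK -[RHS]/(mul (scale c _) _).
rewrite -[LHS]/(scale c (mul _ _)).
by rewrite -clsM -!clsZ -clsM scalerAl.
Qed.
HB.instance Definition _ := GRing.Lmodule_isLalgebra.Build C Q scaleAl.

End QuotientAlgebra.

Section EdgePresentation.
Variables (C : fieldType) (q : nat).

(* The free algebra on two generators is the algebra of the free monoid on
   bool. *)
Local Notation A := (malg (fmonom bool) C).

Definition free_gen (b : bool) : A := mkmalgU (fmu b) (1 : C).
Local Notation d := (free_gen true).
Local Notation x := (free_gen false).

Definition edge_relators : set A :=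
  [set x * x - 1; d * x * d - (q%:R *: x + (q%:R - 1) *: d)].

(* The character d |-> q, x |-> 1 kills the relators. *)
Let chi_monom (m : fmonom bool) : C :=
  \prod_(b <- fmonom_val m) (if b then q%:R else 1).
Let chi_monom_mmorphism : mmorphism chi_monom.
Proof.
split=> [m n|]; rewrite /chi_monom ?fm1 ?big_nil//.
by rewrite (fmM m n) big_cat.
Qed.
HB.instance Definition _ :=
  isMultiplicative.Build (fmonom bool) C chi_monom chi_monom_mmorphism.
Let chi : A -> C := mmap idfun chi_monom.
Let chi_gen b : chi (free_gen b) = if b then q%:R else 1.
Proof.
rewrite /chi /free_gen (mmapU (f := idfun) (h := chi_monom)) mul1r.
by rewrite /chi_monom (fmU b) big_seq1.
Qed.
Let character_ex : exists f : A -> C,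
  [/\ f 1 = 1, forall a b, f (a - b) = f a - f b,
      forall a b, f (a * b) = f a * f b, forall c a, f (c *: a) = c * f a &
      f x = 1 /\ f d = q%:R].
Proof.
exists chi; split; last by split; exact: chi_gen.
- exact: (mmap1 (f := idfun) (h := chi_monom)).
- exact: (mmapB (f := idfun) (h := chi_monom)).
- exact: (mmap_is_multiplicative (f := idfun) (h := chi_monom)).1.
- exact: (mmapZ (f := idfun) (h := chi_monom)).
Qed.

Lemma edge_relators_proper : ~ ideal_gen edge_relators 1.
Proof.
have [f [f1 fB fM fZ [fx fd]]] := character_ex.
have f0 : f 0 = 0 by rewrite -(subrr 0) fB subrr.
have fD a b : f (a + b) = f a + f b.
  by rewrite -{1}[b]opprK fB -[- b]sub0r fB f0 sub0r opprK.
have sI : ideal_gen edge_relators `<=` [set a | f a = 0].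
  apply: smallest_sub => [|a [->|->]].
  - split=> [//|a b a0 b0|a b b0].
      by apply: (etrans (fB a b)); rewrite a0 b0 subrr.
    split; [apply: (etrans (fM a b)) | apply: (etrans (fM b a))].
      by rewrite b0 mulr0.
    by rewrite b0 mul0r.
  - by apply: (etrans (fB _ _)); rewrite (fM x x) fx f1 mulr1 subrr.
  - apply: (etrans (fB _ _)).
    have -> : f (d * x * d) = q%:R * q%:R.
      by apply: (etrans (fM _ _)); congr (_ * _) => //;
        apply: (etrans (fM _ _)); rewrite fx fd mulr1.
    have -> : f (q%:R *: x + (q%:R - 1) *: d) = q%:R + (q%:R - 1) * q%:R.
      by apply: (etrans (fD _ _)); congr (_ + _); apply: (etrans (fZ _ _));
        rewrite ?fx ?fd ?mulr1.
    by rewrite mulrBl mul1r [_ + (_ - _)]addrC subrK subrr.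
by move/sI => e; have := oner_neq0 C; rewrite -f1 e eqxx.
Qed.

(* The algebra C<d, x> / (x^2 - 1, d x d - q x - (q - 1) d). *)
Definition edge_presented := quot_alg edge_relators_proper.
HB.instance Definition _ := GRing.Lalgebra.on edge_presented.

Definition edge_gen (b : bool) : edge_presented :=
  quot_class edge_relators_proper (free_gen b).

End EdgePresentation.

(* Main.v *)
Require Import Defs.
From HB Require Import structures.
From mathcomp Require Import all_boot all_order all_algebra.
From mathcomp Require Import all_classical all_reals all_analysis.
From mathcomp Require Import complex.
From mathcomp.multinomials Require Import -(notations) monalg.

Set Implicit Arguments.
Unset Strict Implicit.
Unset Printing Implicit Defensive.

Import Order.TTheory GRing.Theory Num.Theory.
Import numFieldNormedType.Exports.

Local Open Scope classical_set_scope.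
Local Open Scope ring_scope.

(* G acts transitively on the edges and even on the geodesic paths of a given
   length.  Each Phi acts on Maps(E, C) through a kernel,
   (T f)(g e) = \sum_b kernel(e, b) f(g b), as an operator of finite range that
   commutes with G.  Conversely every finite range kernel invariant under G
   comes from a locally constant Phi, and the kernel at (e, g^-1 x) is a multiple
   of \int_K pi(k) Phi(g k) dk applied to the indicator function of x, so that it
   vanishes exactly on U.
   An invariant kernel is a combination of indicators of orbits of pairs of edges.
   Such an orbit is given by the distance n of two edges and their orientations,
   and its indicator is the kernel of the word x^i d^n x^j.  The relations reduce
   all words to linear combinations of these normal forms, whose operators have
   disjoint supports and are thus linearly independent: the presented algebra is
   the algebra of all invariant finite range operators.
   Compactness in G means boundedness of an orbit of vertices, and uniqueness of
   the Haar measure follows by counting the orbits of K on finite sets of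
   vertices; unimodularity is obtained from the fact that neighboring stabilizers
   have equal mass. *)

(** * Walks and automorphisms of regular trees *)

(** The edge Laplacian never backtracks. On a tree its n-th power therefore sums over the ends of
    the non-backtracking walks of length n, each end being counted once, and a word x^i d^n x^j has
    exactly the indicator of one orbit as its kernel. No lower order terms have to be removed, and
    linear independence becomes disjointness of orbits. The analytic side rests on two facts about
    measures. Right invariance on G allows the substitutions in kernels and convolutions.
    Proportionality of the restriction to K with the measure on K turns the average that defines U
    into kernel entries. Both are instances of a single uniqueness statement for measures determined
    by their mass on K. *)

Section EdgeWalks.
Variable X : sgraph.
Implicit Types (e f : edge X) (p : seq (edge X)) (g : aut X).

Lemma edge_inj e f : src e = src f -> tgt e = tgt f -> e = f.
Proof. by move=> s t; apply: val_inj; apply: injective_projections. Qed.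

Lemma adj_edge e : adj (src e) (tgt e).
Proof. exact: edgeP. Qed.

Lemma edge_of (u v : X) : adj u v -> exists e, src e = u /\ tgt e = v.
Proof. by move=> uv; exists (@Edge X (u, v) uv). Qed.

Lemma eopK : involutive (@eop X).
Proof. by move=> e; apply: edge_inj. Qed.

(** A walk may leave an edge through either of its ends; [b] records which one. *)
Definition flip (b : bool) e := if b then e else eop e.

Lemma flipK b : involutive (flip b).
Proof. by case: b => // e; exact: eopK. Qed.

Lemma eop_flip b e : eop (flip b e) = flip (~~ b) e.
Proof. by case: b => //=; rewrite eopK. Qed.

Lemma flip_eop b e : flip b (eop e) = flip (~~ b) e.
Proof. by case: b => //=; rewrite eopK. Qed.

Lemma tgt_eop e : tgt (eop e) = src e. Proof. by []. Qed.
Lemma src_eop e : src (eop e) = tgt e. Proof. by []. Qed.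
Lemma src_eact g e : src (eact g e) = g (src e). Proof. by []. Qed.
Lemma tgt_eact g e : tgt (eact g e) = g (tgt e). Proof. by []. Qed.

Lemma eactM g h e : eact (g * h)%g e = eact g (eact h e).
Proof. exact: edge_inj. Qed.

Lemma eact1 e : eact 1%g e = e.
Proof. exact: edge_inj. Qed.

Lemma eactK g : cancel (eact g) (eact g^-1%g).
Proof. by move=> e; rewrite -eactM mulVg eact1. Qed.

Lemma eactVK g : cancel (eact g^-1%g) (eact g).
Proof. by move=> e; rewrite -eactM mulgV eact1. Qed.

Lemma eact_inj g : injective (eact g).
Proof. exact: can_inj (eactK g). Qed.

Lemma eact_eop g e : eact g (eop e) = eop (eact g e).
Proof. exact: edge_inj. Qed.

Lemma eact_flip g b e : eact g (flip b e) = flip b (eact g e).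
Proof. by case: b => //=; rewrite eact_eop. Qed.

(** The non-backtracking successor relation: its chains are the geodesics of the tree. *)
Definition nxt e f : bool := (src f == tgt e) && (f != eop e).

Lemma nxt_eop e f : nxt (eop f) (eop e) = nxt e f.
Proof.
by rewrite /nxt src_eop tgt_eop eopK [tgt e == _]eq_sym [eop e == _]eq_sym.
Qed.

Lemma nxt_eact g e f : nxt (eact g e) (eact g f) = nxt e f.
Proof.
rewrite /nxt -eact_eop (inj_eq (@eact_inj g)) src_eact tgt_eact.
by rewrite (inj_eq (can_inj (aut_funK g))).
Qed.

Lemma path_eact g e p : path nxt (eact g e) (map (eact g) p) = path nxt e p.
Proof. by elim: p e => //= f p IHp e; rewrite nxt_eact IHp. Qed.

Definition rev_walk e p := rev (map (@eop X) (belast e p)).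

Lemma rev_walkP e p : path nxt (eop (last e p)) (rev_walk e p) = path nxt e p.
Proof.
rewrite /rev_walk -belast_map -(last_map (@eop X)) rev_path.
elim: p e => //= f p IHp e; rewrite IHp; congr (_ && _); exact: nxt_eop.
Qed.

Lemma last_rev_walk e p : last (eop (last e p)) (rev_walk e p) = eop e.
Proof. by rewrite /rev_walk; case: p => //= f p; rewrite rev_cons last_rcons. Qed.

Lemma path_adj_tgt e p : path nxt e p -> path (@adj X) (tgt e) (map (@tgt X) p).
Proof.
elim: p e => //= f p IHp e /andP[/andP[/eqP se _] /IHp ->].
by rewrite andbT -se adj_edge.
Qed.

Hypothesis acyc : acyclic_graph X.

(** A first return to [src e] would close up a cycle. It has at least three vertices since [nxt]
    forbids turning back, against acyclicity. *)
Lemma walk_uniq e p : path nxt e p -> uniq (src e :: map (@tgt X) (e :: p)).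
Proof.
elim: p e => [|f p IHp] e.
  by move=> _; rewrite /= inE andbT; apply: contraFN (adj_irr (src e)) => /eqP {2}->; exact: adj_edge.
move=> pe; have /andP[/andP[/eqP sf nf] pf] : nxt e f && path nxt f p := pe.
have uf := IHp _ pf; rewrite sf in uf.
rewrite map_cons cons_uniq uf andbT inE negb_or; apply/andP; split.
  by apply: contraFN (adj_irr (src e)) => /eqP {2}->; exact: adj_edge.
apply/negP => sefp.
(* The walk is cut at the repeated vertex [src e]; [p1] collects the vertices strictly between
   [tgt e] and this return. *)
have [p1 [p2 def]] : exists p1 p2 : seq X, map (@tgt X) (f :: p) = rcons p1 (src e) ++ p2.
  by move: (map _ _) sefp => s /path.splitP [p1 p2]; exists p1, p2.
have p1s : (size p1).+1 = size (take (size p1).+1 (f :: p)).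
  have : size (map (@tgt X) (f :: p)) = size (rcons p1 (src e) ++ p2) by rewrite -def.
  rewrite size_map size_cat size_rcons => ss.
  by rewrite size_takel// ss leq_addr.
have p1E : rcons p1 (src e) = map (@tgt X) (take (size p1).+1 (f :: p)).
  by rewrite map_take def take_cat size_rcons ltnn subnn take0 cats0.
have pa : path (@adj X) (tgt e) (rcons p1 (src e)).
  rewrite p1E; apply: path_adj_tgt.
  by rewrite -{1}(cat_take_drop (size p1).+1 (f :: p)) cat_path in pe; case/andP: pe.
have u1 : uniq (tgt e :: rcons p1 (src e)).
  by move: uf; rewrite def -cat_cons cat_uniq => /andP[].
apply: (acyc (c := tgt e :: rcons p1 (src e))).
  (* An empty [p1] would make [f] the reverse of [e]. *)
  rewrite /= size_rcons !ltnS lt0n size_eq0; apply/negP => /eqP p10.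
  move: p1E; rewrite p10 /= take0 => -[stf].
  by move/negP: nf; apply; apply/eqP/edge_inj.
by apply/andP; split=> //=; rewrite rcons_path pa last_rcons adj_edge.
Qed.

Lemma walk_not_closed e p : path nxt e p -> tgt (last e p) <> src e.
Proof.
move=> /walk_uniq; rewrite cons_uniq => /andP[+ _] se => /negP; apply.
by rewrite -se map_f// mem_last.
Qed.

(** Two different walks to the same vertex glue to a closed non-backtracking walk, one of them being
    run backwards. They are glued at their start if they leave through different ends of [e], and
    otherwise at their end, once equal last edges are removed. *)
Lemma walk_unique b b' e p p' :
  path nxt (flip b e) p -> path nxt (flip b' e) p' ->
  tgt (last (flip b e) p) = tgt (last (flip b' e) p') -> b = b' /\ p = p'.
Proof.
have [<-{b'}|nb] := eqVneq b b'; last first.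
  move=> pp pp' tt; exfalso.
  have b'E : flip b' e = eop (flip b e).
    by rewrite eop_flip; congr flip; move: nb; case: (b); case: (b').
  have := @walk_not_closed (eop (last (flip b e) p)) (rev_walk (flip b e) p ++ p').
  rewrite cat_path rev_walkP pp last_rev_walk -b'E pp' => /(_ isT); apply.
  by rewrite last_cat last_rev_walk -b'E -tt.
move: (flip b e) => {}e.
elim/last_ind: p p' => [|p f IHp] p'; case/lastP: p' => [|p' f'] //.
- move=> _ /walk_uniq; rewrite last_rcons/= map_rcons => + tt.
  by rewrite mem_rcons inE tt eqxx /= andbF.
- move=> /walk_uniq + _; rewrite last_rcons/= map_rcons => + tt.
  by rewrite mem_rcons inE tt eqxx /= andbF.
rewrite !last_rcons => pp pp' tt.
move: (pp) (pp'); rewrite !rcons_path => /andP[ep nf] /andP[ep' nf'].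
have [ff'|ff'] := eqVneq f f'.
  rewrite -ff' in nf' *; split=> //; congr rcons; apply: (IHp p' _ _ _).2 => //.
  by move/andP: nf => [/eqP <- _]; move/andP: nf' => [/eqP <- _].
exfalso; have := @walk_not_closed e (rcons p f ++ eop f' :: rev_walk e (rcons p' f')).
rewrite cat_path pp last_rcons /= -{2}(last_rcons e p' f') rev_walkP pp' andbT.
have -> : nxt f (eop f').
  by rewrite /nxt src_eop tt eqxx /= (can_eq eopK) eq_sym.
move=> /(_ isT); apply; rewrite last_cat/=.
by rewrite -[in X in last X _](last_rcons e p' f') last_rev_walk.
Qed.

Hypothesis conn : connected_graph X.

(** A path of vertices lifts to a walk edge by edge. A step back along the last edge is absorbed by
    dropping that edge, or by reversing the start when the walk is trivial. *)
Lemma walk_to_edge e f :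
  exists b b' p, path nxt (flip b e) p /\ last (flip b e) p = flip b' f.
Proof.
have key v : exists b p, path nxt (flip b e) p /\ tgt (last (flip b e) p) = v.
  have [s [ps <-]] := conn (src e) v.
  elim/last_ind: s ps => [|s x IHs]; first by exists false, [::].
  rewrite rcons_path last_rcons => /andP[/IHs [b [p [pp tl]]]].
  move=> /edge_of [h [sh th]].
  have [he|he] := eqVneq h (eop (last (flip b e) p)); last first.
    exists b, (rcons p h); rewrite rcons_path last_rcons pp; split => //=.
    by rewrite /nxt sh tl eqxx he.
  case/lastP: p => [|p k] in pp tl he *.
    by exists (~~ b), [::]; split=> //=; rewrite -eop_flip -th he.
  exists b, p; move: pp; rewrite rcons_path => /andP[-> /andP[/eqP sk _]].
  by split=> //; rewrite -sk -th he last_rcons.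
have [b [p [pp tl]]] := key (src f).
have [fe|fe] := eqVneq f (eop (last (flip b e) p)).
  by exists b, false, p; rewrite fe /= eopK.
exists b, true, (rcons p f); rewrite rcons_path last_rcons pp; split => //=.
by rewrite /nxt tl eqxx fe.
Qed.
End EdgeWalks.
Arguments nxt {X}.

Section Regular.
Variables (X : sgraph) (q : nat).
Hypothesis reg : regular_graph q.+1 X.
Implicit Types (e f : edge X) (v : X).

Definition outs v : seq (edge X) := finmap.enum_fset (fset_set [set f | src f = v]).
Definition succs e : seq (edge X) := finmap.enum_fset (fset_set [set f | nxt e f]).

Lemma outs_card v : ([set f : edge X | src f = v] #= `I_q.+1)%card.
Proof.
apply: card_eq_trans (reg v); rewrite card_eq_sym.
have -> : [set y | adj v y] = (@tgt X) @` [set f | src f = v].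
  apply/seteqP; split=> [y /edge_of [f [sf tf]]|_ [f <- <-]] /=.
    by exists f.
  exact: adj_edge.
by apply: inj_card_eq => e f; rewrite !inE => <- se te; exact: edge_inj.
Qed.

Lemma outs_finite v : finite_set [set f : edge X | src f = v].
Proof. by apply/finite_setP; exists q.+1; exact: outs_card. Qed.

Lemma mem_outs v f : (f \in outs v) = (src f == v).
Proof.
rewrite in_fset_set ?inE; last exact: outs_finite.
by apply/idP/eqP; rewrite inE.
Qed.

Lemma outs_uniq v : uniq (outs v). Proof. exact: finmap.fset_uniq. Qed.

Lemma size_outs v : size (outs v) = q.+1.
Proof. exact: (card_fset_set (outs_card v)). Qed.

Lemma succs_finite e : finite_set [set f : edge X | nxt e f].
Proof.
by apply: sub_finite_set (outs_finite (tgt e)) => f /= /andP[/eqP].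
Qed.

Lemma mem_succs e f : (f \in succs e) = nxt e f.
Proof.
rewrite in_fset_set ?inE; last exact: succs_finite.
by apply/idP/idP; rewrite inE.
Qed.

Lemma succs_uniq e : uniq (succs e). Proof. exact: finmap.fset_uniq. Qed.

Lemma outs_succs e : perm_eq (outs (tgt e)) (eop e :: succs e).
Proof.
apply: uniq_perm; rewrite ?outs_uniq//=.
  by rewrite succs_uniq mem_succs /nxt eqxx andbF.
move=> f; rewrite mem_outs inE mem_succs /nxt.
by case: (eqVneq f (eop e)) => [->|_]; rewrite ?andbT// src_eop eqxx.
Qed.

Lemma size_succs e : size (succs e) = q.
Proof. by have /perm_size := outs_succs e; rewrite size_outs => -[]. Qed.

End Regular.

(* A family of bijections from the successors of e to those of e', together with
   the inverse family, unfolds along walks into a tree automorphism. *)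
Section WalkTransport.
Variables (X : sgraph).
Implicit Types (e f : edge X) (p : seq (edge X)).

Definition turning (t : edge X -> edge X -> edge X -> edge X) :=
  forall e e' f, nxt e f -> nxt e' (t e e' f).

Definition turn_inverse (t u : edge X -> edge X -> edge X -> edge X) :=
  forall e e' f, nxt e f -> u e' e (t e e' f) = f.

Fixpoint transport (t : edge X -> edge X -> edge X -> edge X) e e' p :=
  if p is f :: p' then t e e' f :: transport t f (t e e' f) p' else [::].

Lemma transport_path t e e' p : turning t ->
  path nxt e p -> path nxt e' (transport t e e' p).
Proof.
move=> tt; elim: p e e' => //= f p IHp e e' /andP[/tt -> pp]; exact: IHp.
Qed.

Lemma transportK t u e e' p : turn_inverse t u ->
  path nxt e p -> transport u e' e (transport t e e' p) = p.
Proof.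
by move=> tu; elim: p e e' => //= f p IHp e e' /andP[/tu -> /IHp ->].
Qed.

Lemma transport_rcons t e e' p f : transport t e e' (rcons p f) =
  rcons (transport t e e' p) (t (last e p) (last e' (transport t e e' p)) f).
Proof. by elim: p e e' => //= k p IHp e e'; rewrite IHp. Qed.

Hypotheses (conn : connected_graph X) (acyc : acyclic_graph X).


(** Every vertex is the end of exactly one walk that leaves [e] in one of its two orientations.
    These pairs are coordinates on the tree, so that a bijection of walks defines a bijection of
    vertices. *)
Definition walk_pos e v : bool * seq (edge X) :=
  xget (true, [::]) [set bp | path nxt (flip bp.1 e) bp.2 /\
                              tgt (last (flip bp.1 e) bp.2) = v].

Definition walk_map t e e' v : X :=
  let: (b, p) := walk_pos e v in
  tgt (last (flip b e') (transport t (flip b e) (flip b e') p)).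

Lemma walk_posP e b p : path nxt (flip b e) p ->
  walk_pos e (tgt (last (flip b e) p)) = (b, p).
Proof.
move=> pp; rewrite /walk_pos; case: xgetP => [[b' p'] _ /= [pp' tt]|/(_ (b, p))].
  by have [-> ->] := walk_unique acyc pp' pp tt.
by case.
Qed.

Lemma walk_pos_ex e v :
  exists b p, path nxt (flip b e) p /\ tgt (last (flip b e) p) = v.
Proof.
have [[|x s] [ps l]] := conn (src e) v; first by exists false, [::].
have [f tf] : exists f : edge X, tgt f = v.
  move: ps l; rewrite lastI rcons_path => /andP[_ /edge_of [f [_ tf]]].
  by rewrite last_rcons => <-; exists f.
have [b [[] [p [pp lp]]]] := walk_to_edge conn e f.
  by exists b, p; split=> //; rewrite lp.
case/lastP: p pp lp => [|p k] pp lp.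
  by exists (~~ b), [::]; split=> //=; rewrite -tf -eop_flip; move: lp => /= ->.
exists b, p; move: pp; rewrite rcons_path => /andP[-> /andP[/eqP sk _]]; split=> //.
by rewrite -sk -tf; move: lp; rewrite last_rcons => /= ->.
Qed.

Lemma walk_mapE t e e' b p : path nxt (flip b e) p ->
  walk_map t e e' (tgt (last (flip b e) p)) =
  tgt (last (flip b e') (transport t (flip b e) (flip b e') p)).
Proof. by move=> pp; rewrite /walk_map walk_posP. Qed.

Lemma walk_mapK t u e e' : turning t -> turn_inverse t u ->
  cancel (walk_map t e e') (walk_map u e' e).
Proof.
move=> tt tu v; have [b [p [pp <-]]] := walk_pos_ex e v.
by rewrite walk_mapE// walk_mapE ?transportK//; exact: transport_path.
Qed.

(** [walk_map] is defined through targets. The source of the last edge is the target of the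
    preceding edge, or the target of the reversed edge when the walk is empty. *)
Lemma walk_map_src t e e' b p : turning t -> path nxt (flip b e) p ->
  walk_map t e e' (src (last (flip b e) p)) =
  src (last (flip b e') (transport t (flip b e) (flip b e') p)).
Proof.
move=> tt; case/lastP: p => [|p k] pp /=.
  by rewrite -tgt_eop eop_flip -[in LHS]/(last (flip (~~ b) e) [::]) walk_mapE//= -eop_flip.
move: (pp); rewrite rcons_path => /andP[pp' /andP[/eqP sk _]].
rewrite last_rcons sk walk_mapE//.
have := transport_path (flip b e') tt pp.
rewrite transport_rcons rcons_path => /andP[_ /andP[/eqP <- _]].
by rewrite last_rcons.
Qed.

Lemma walk_map_adj t e e' x y : turning t -> adj x y ->
  adj (walk_map t e e' x) (walk_map t e e' y).
Proof.
move=> tt /edge_of [f [<- <-]].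
have [b [b' [p [pp lp]]]] := walk_to_edge conn e f.
have := adj_edge (last (flip b e') (transport t (flip b e) (flip b e') p)).
rewrite -walk_mapE// -walk_map_src// lp.
by case: b' {lp} => //=; rewrite adj_sym.
Qed.

Lemma turning_aut t u e e' : turning t -> turning u ->
  turn_inverse t u -> turn_inverse u t ->
  exists g : aut X, forall b p, path nxt (flip b e) p ->
    eact g (last (flip b e) p) =
    last (flip b e') (transport t (flip b e) (flip b e') p).
Proof.
move=> tt uu tu ut; pose phi := walk_map t e e'; pose psi := walk_map u e' e.
have phiK : cancel phi psi by exact: walk_mapK.
have psiK : cancel psi phi by exact: walk_mapK.
have phiA x y : adj (phi x) (phi y) = adj x y.
  apply/idP/idP; last exact: walk_map_adj.
  by move=> /(walk_map_adj e' e uu); rewrite -/psi !phiK.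
exists (Aut phiK psiK phiA) => b p pp; apply: edge_inj.
  by rewrite src_eact /= /phi walk_map_src.
by rewrite tgt_eact /= /phi walk_mapE.
Qed.
End WalkTransport.

(** * Transitivity on geodesics and the relative position of two edges *)

Section Homogeneity.
Variables (X : sgraph) (q : nat).
Hypothesis tree : regular_tree q.+1 X.
Implicit Types (e f : edge X) (p : seq (edge X)).

Definition seq_turn (T : eqType) (s s' : seq T) (x : T) : T := nth x s' (index x s).

Lemma seq_turn_in (T : eqType) (s s' : seq T) x : size s = size s' -> x \in s ->
  seq_turn s s' x \in s'.
Proof. by move=> ss xs; rewrite mem_nth// -ss index_mem. Qed.

Lemma seq_turnK (T : eqType) (s s' : seq T) x : size s = size s' -> uniq s' ->
  x \in s -> seq_turn s' s (seq_turn s s' x) = x.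
Proof.
move=> ss us xs; rewrite /seq_turn index_uniq// -?ss ?index_mem//.
by rewrite (set_nth_default x) ?index_mem// nth_index.
Qed.

(** With a distinguished element in front of each list, matching by position sends one distinguished
    element to the other. *)
Definition front (T : eqType) (x : T) (s : seq T) :=
  if x \in s then x :: rem x s else s.

Lemma perm_front (T : eqType) (x : T) s : perm_eq s (front x s).
Proof. by rewrite /front; case: ifP => // /perm_to_rem. Qed.

Lemma seq_turn_front (T : eqType) (s s' : seq T) x x' : x \in s -> x' \in s' ->
  seq_turn (front x s) (front x' s') x = x'.
Proof. by move=> xs xs'; rewrite /seq_turn /front xs xs' /= eqxx. Qed.


Lemma aut_path t e e' (g : aut X) p : path nxt e p ->
  (forall b p, path nxt (flip b e) p -> eact g (last (flip b e) p) =
    last (flip b e') (transport t (flip b e) (flip b e') p)) ->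
  map (eact g) p = transport t e e' p.
Proof.
move=> pp gE; elim/last_ind: p pp => [//|p f IHp] pp.
rewrite map_rcons transport_rcons IHp; last by move: pp; rewrite rcons_path => /andP[].
by congr rcons; have := gE true _ pp; rewrite /= transport_rcons !last_rcons.
Qed.

(** At each edge the successors are listed with the next edge of the given walk in front. Matching
    these lists by position is a bijection of successors that carries one walk to the other, and
    [turning_aut] unfolds it to an automorphism. *)
Lemma walk_transitive e e' p p' : path nxt e p -> path nxt e' p' ->
  size p = size p' -> exists g : aut X, eact g e = e' /\ map (eact g) p = p'.
Proof.
have [conn acyc reg] := tree.
(* The edge after [f] in [s]. Off the walk and at its last edge this is the default [f], which is no
   successor of itself, so that [front] then changes nothing. *)
pose nx (s : seq (edge X)) f := nth f s (index f s).+1.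
pose N s f := front (nx s f) (succs f).
pose T s s' f f' := seq_turn (N s f) (N s' f').
have sN s f : size (N s f) = q.
  by rewrite -(perm_size (perm_front _ _)) (size_succs reg).
have mN s f k : (k \in N s f) = nxt f k.
  by rewrite -(perm_mem (perm_front _ _)) (mem_succs reg).
have uN s f : uniq (N s f).
  by rewrite -(perm_uniq (perm_front _ _)) succs_uniq.
have TN s s' : turning (T s s').
  by move=> f f' k fk; rewrite -(mN s') seq_turn_in ?sN// mN.
have TK s s' : turn_inverse (T s s') (T s' s).
  by move=> f f' k fk; rewrite /T seq_turnK ?sN ?mN.
have suniq f r : path nxt f r -> uniq (f :: r).
  by move=> /(walk_uniq acyc); rewrite cons_uniq => /andP[_ /map_uniq].
move=> pp pp' ss.
pose s := e :: p; pose s' := e' :: p'.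
have [g gE] := turning_aut conn acyc e e' (TN s s') (TN s' s) (TK s s') (TK s' s).
exists g; split; first exact: (gE true [::]).
rewrite (aut_path pp gE).
have us : uniq s by exact: suniq.
have us' : uniq s' by exact: suniq.
(* The induction runs over the remaining walks, while [T] keeps the full lists; as these have no
   repetitions, [index] finds the current position. *)
have key : forall r r' x x' s1 s1', s = s1 ++ x :: r -> s' = s1' ++ x' :: r' ->
    path nxt x r -> path nxt x' r' -> size r = size r' -> transport (T s s') x x' r = r'.
  have nxE s0 s1 x y r : uniq s0 -> s0 = s1 ++ [:: x, y & r] -> nx s0 x = y.
    move=> u0 e0; rewrite /nx e0 index_cat /= eqxx addn0 ifF; last first.
      apply/negbTE; move: u0; rewrite e0 cat_uniq /= negb_or => /and3P[_ /andP[+ _] _].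
      by [].
    by rewrite nth_cat ltnNge leqnSn /= subSnn.
  elim=> [|y r IHr] [|y' r'] x x' s1 s1' //= es es' /andP[xy yr] /andP[xy' yr'] [sr].
  have ty : T s s' x x' y = y'.
    rewrite /T /N (nxE _ _ _ _ _ us es) (nxE _ _ _ _ _ us' es').
    by rewrite seq_turn_front ?(mem_succs reg).
  by rewrite ty (IHr r' y y' (rcons s1 x) (rcons s1' x')) // cat_rcons.
exact: (key p p' e e' [::] [::]).
Qed.

Lemma edge_transitive e e' : exists g : aut X, eact g e = e'.
Proof. by have [g [ge _]] := @walk_transitive e e' [::] [::] isT isT erefl; exists g. Qed.

Lemma vertex_edge (v : X) : exists e : edge X, src e = v.
Proof.
have [_ _ reg] := tree.
have : (0 < size (outs v))%N by rewrite (size_outs reg).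
case so : (outs v) => [//|e s] _; exists e; apply/eqP.
by rewrite -(mem_outs reg) so mem_head.
Qed.

Lemma vertex_transitive (x y : X) : exists g : aut X, g x = y.
Proof.
have [[e <-] [f <-]] := (vertex_edge x, vertex_edge y).
by have [g <-] := edge_transitive e f; exists g.
Qed.

Definition reach n e f := exists p, [/\ path nxt e p, size p = n & last e p = f].

Lemma reach0 e f : reach 0 e f <-> f = e.
Proof.
by split=> [[[|k p] [_ // _ <-]]|->]; last exists [::].
Qed.

Lemma reach_transitive n e f f' : reach n e f -> reach n e f' ->
  exists g : aut X, eact g e = e /\ eact g f = f'.
Proof.
move=> [p [pp sp <-]] [p' [pp' sp' <-]].
have [|g [ge gp]] := walk_transitive pp pp'; first by rewrite sp.
by exists g; split=> //; rewrite -gp -[in RHS]ge last_map.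
Qed.

Lemma reach_eact n (g : aut X) e f : reach n e f -> reach n (eact g e) (eact g f).
Proof.
move=> [p [pp <- <-]]; exists (map (eact g) p).
by rewrite path_eact size_map last_map.
Qed.

(** Reversing [f] reduces to c = true. Walks to the same orientation of [f] coincide. A walk to the
    opposite orientation would coincide with the first walk without its last step, and that step
    would turn back; only an empty walk escapes, which is the exceptional case of distance 0. *)
Lemma reach_unique b b' c c' m n e f :
  reach m (flip b e) (flip c f) -> reach n (flip b' e) (flip c' f) ->
  m = n /\ (b = b' /\ c = c' \/ m = 0%N /\ b != b' /\ c != c').
Proof.
have [_ acyc _] := tree.
wlog cT : b b' c c' m n f / c = true.
  move=> W; case: c => [|rbc rbc'].
    by move=> rbc rbc'; exact: (W b b' true c' m n f).
  have := W b b' true (~~ c') m n (eop f) erefl.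
  rewrite !flip_eop !negbK => /(_ rbc rbc')[-> [[-> c'E]|[-> [nb c'T]]]]; split=> //.
    by left; case: (c') c'E.
  by right; rewrite c'T.
rewrite {c}cT => -[p [pp sp lp]] [p' [pp' sp' lp']].
case: c' lp' => lp'.
  have [|bb' pE] := walk_unique acyc pp pp'; first by rewrite lp lp'.
  by rewrite -sp -sp' bb' pE; split=> //; left.
rewrite /= in lp lp'.
case/lastP: p pp sp lp => [|p k] pp sp lp.
  have pp2 : path nxt (flip (~~ b) e) [::] by [].
  have [|bb' pE] := walk_unique acyc pp2 pp'.
    by rewrite lp' tgt_eop -lp /= -eop_flip.
  rewrite -sp -sp' -pE; split=> //; right; split=> //; split=> //.
  by rewrite -bb'; case: (b).
exfalso; move: (pp); rewrite rcons_path last_rcons in lp * => /andP[pp0 nk].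
have [|bb' pE] := walk_unique acyc pp0 pp'.
  by rewrite lp' tgt_eop -lp; move/andP: nk => [/eqP ->].
move: nk; rewrite -bb' -pE in lp'; rewrite lp' lp /nxt eopK eqxx andbF.
by [].
Qed.

Lemma reach_ex e f : exists b c n, reach n (flip b e) (flip c f).
Proof.
have [conn _ _] := tree.
have [b [c [p [pp lp]]]] := walk_to_edge conn e f.
by exists b, c, (size p), p.
Qed.

Lemma reach_inhabited n e : (0 < q)%N -> exists f, reach n e f.
Proof.
have [_ _ reg] := tree.
move=> q0; elim: n => [|n [f [p [pp sp lp]]]]; first by exists e; apply/reach0.
have : (0 < size (succs f))%N by rewrite (size_succs reg).
case sf : (succs f) => [//|k s] _; exists k, (rcons p k).
by rewrite rcons_path pp lp size_rcons sp last_rcons -(mem_succs reg) sf mem_head.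
Qed.

End Homogeneity.

(** * Operators given by words in the generators *)

Section FreeAlgebra.
Variable C : fieldType.
Local Notation A := (malg (fmonom bool) C).

Definition monom (w : seq bool) : A := mkmalgU (FMonom w) (1 : C).

Lemma monom_nil : monom [::] = 1.
Proof. by rewrite /monom -fmoneE. Qed.

Lemma free_genE b : free_gen C b = monom [:: b].
Proof. by rewrite /free_gen /monom fmuE. Qed.

Lemma monom_cat u v : monom (u ++ v) = monom u * monom v.
Proof.
rewrite /monom -[FMonom (u ++ v)]/(FMonom (FMonom u ++ FMonom v)) -fmmulE.
by rewrite (malgM_def) fgmulUU mulr1.
Qed.

Lemma scale_monomE c w : c *: monom w = mkmalgU (FMonom w) c.
Proof.
apply/malgP => k; rewrite mcoeffZ (mcoeffU (FMonom w) 1) (mcoeffU (FMonom w) c).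
by rewrite mulrnAr mulr1.
Qed.

Lemma malg_ind (P : A -> Prop) :
  P 0 -> (forall c w a, P a -> P (c *: monom w + a)) -> forall a, P a.
Proof.
move=> P0 PD a; rewrite (monalgE a); elim/big_rec: _ => // m b _ Pb.
by rewrite -(fmK m) -scale_monomE; exact: PD.
Qed.

(** The interface [lalgType] used for the presentation moves scalars past the left factor only; this
    is the other side, for words. *)
Lemma monom_scalerAr w c a : monom w * (c *: a) = c *: (monom w * a).
Proof.
elim/malg_ind: a => [|k v a IHa]; first by rewrite scaler0 mulr0 scaler0.
have monomZ d : monom w * (d *: monom v) = d *: monom (w ++ v).
  rewrite !scale_monomE malgM_def fgmulUU mul1r.
  by rewrite -[FMonom (w ++ v)]/(FMonom (FMonom w ++ FMonom v)) -fmmulE.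
have -> : c *: (k *: monom v + a) = (c * k) *: monom v + c *: a.
  by rewrite (scalerDr c) scalerA.
rewrite (mulrDr (monom w) ((c * k) *: monom v)) IHa monomZ.
rewrite (mulrDr (monom w) (k *: monom v)) monomZ (scalerDr c).
by rewrite (scalerA c k (monom (w ++ v))).
Qed.

(** Scalar valued on purpose: operators are extended from words to the free algebra entry by entry,
    at a fixed function and a fixed edge. *)
Definition lin_ext (h : seq bool -> C) (a : A) : C :=
  mmap idfun (fun m : fmonom bool => h m) a.

Lemma lin_extD h a b : lin_ext h (a + b) = lin_ext h a + lin_ext h b.
Proof. exact: (mmapD (f := idfun)). Qed.

Lemma lin_ext0 h : lin_ext h 0 = 0.
Proof. exact: (mmap0 (f := idfun)). Qed.

Lemma lin_extZ h c a : lin_ext h (c *: a) = c * lin_ext h a.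
Proof.
rewrite /lin_ext (mmapEw (f := idfun) (msuppZ_le _ _)) mmapE big_distrr /=.
by apply/eq_bigr=> k _; rewrite mcoeffZ mulrA.
Qed.

Lemma lin_ext_monom h w : lin_ext h (monom w) = h w.
Proof. by rewrite /lin_ext (mmapU (f := idfun)) mul1r. Qed.

End FreeAlgebra.

Lemma fct_combE (R : realType) (T : Type) (c : Cplx R) (f g : T -> Cplx R) x :
  (c *: f + g) x = c * f x + g x.
Proof. by []. Qed.

Section EdgeWords.
Variables (R : realType) (X : sgraph) (q : nat).
Hypothesis tree : regular_tree q.+1 X.
Local Notation C := (Cplx R).
Local Notation M := (edge X -> C).
Local Notation D := (@edge_laplacian R X).
Local Notation Xi := (@edge_inversion R X).
Implicit Types (e f : edge X) (h : M) (w : seq bool).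

Let reg : regular_graph q.+1 X. Proof. by case: tree. Qed.

Lemma laplacianE h e : D h e = \sum_(f <- succs e) h f.
Proof.
rewrite /edge_laplacian (fsbig_fwiden (succs e)) ?succs_uniq//.
- by move=> f /= [sf /eqP nf]; rewrite (mem_succs reg) /nxt sf eqxx nf.
- move=> f /= [+ /not_andP]; rewrite (mem_succs reg) => /andP[/eqP sf /eqP nf].
  by case.
Qed.

Definition gen_op (b : bool) : M -> M := if b then D else Xi.
Definition word_op w : M -> M := foldr (fun b T => gen_op b \o T) id w.

Lemma gen_op_linear b c h h' : gen_op b (c *: h + h') = c *: gen_op b h + gen_op b h'.
Proof.
case: b => //; apply/funext => e; rewrite fct_combE /= !laplacianE.
rewrite mulr_sumr -big_split/=; exact: eq_bigr.
Qed.

Lemma word_op_linear w c h h' :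
  word_op w (c *: h + h') = c *: word_op w h + word_op w h'.
Proof. by elim: w => //= b w ->; rewrite gen_op_linear. Qed.

Lemma word_op_cat u v : word_op (u ++ v) = word_op u \o word_op v.
Proof. by apply/funext => h; elim: u => //= b u ->. Qed.

Lemma word_op0 w : word_op w 0 = 0.
Proof. by have := word_op_linear w (-1) 0 0; rewrite !scaleN1r !addNr. Qed.

Lemma inversionK h : Xi (Xi h) = h.
Proof. by apply/funext => e; rewrite /edge_inversion eopK. Qed.

(** For a successor [f] of [e], the edges leaving [tgt e] are [f] and the successors of its reverse,
    but also the reverse of [e] and the successors of [e]. Comparing the two sums of [h] evaluates
    Xi (D h) at [f]. Summation over the q successors of [e] produces the factor q, and the term - h
    f turns one q into q - 1. *)
Lemma laplacian_inversion h :
  D (Xi (D h)) = q%:R *: Xi h + (q%:R - 1) *: D h.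
Proof.
apply/funext => e; rewrite fct_combE laplacianE.
have key f : f \in succs e -> Xi (D h) f = h (eop e) + D h e - h f.
  rewrite (mem_succs reg) => /andP[/eqP sf nf].
  rewrite /edge_inversion !laplacianE.
  have pm : perm_eq (f :: succs (eop f)) (eop e :: succs e).
    have := outs_succs reg (eop f); rewrite eopK tgt_eop sf perm_sym => /perm_trans; apply.
    exact: (outs_succs reg).
  have : \sum_(k <- f :: succs (eop f)) h k = \sum_(k <- eop e :: succs e) h k.
    exact: perm_big.
  by rewrite !big_cons => <-; rewrite addrC addKr.
rewrite (eq_big_seq _ key) sumrB big_const_seq count_predT (size_succs reg).
rewrite iter_addr_0 -laplacianE -(mulr_natl (_ + _)) mulrDr -addrA; congr (_ + _).
by rewrite -[RHS]/((q%:R - 1) * D h e) mulrBl mul1r.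
Qed.

Fixpoint sphere n e : seq (edge X) :=
  if n is n'.+1 then flatten [seq sphere n' k | k <- succs e] else [:: e].

Lemma sphereP n e f : reflect (reach n e f) (f \in sphere n e).
Proof.
elim: n e => [|n IHn] e /=.
  by rewrite inE; apply: (iffP eqP) => [->|/reach0//]; exact/reach0.
apply: (iffP flatten_mapP) => [[k]|[[|k p] [//= /andP[ek kp] [sp] lp]]].
  rewrite (mem_succs reg) => ek /IHn[p [kp sp lp]].
  by exists (k :: p); rewrite /= ek kp sp.
by exists k; [rewrite (mem_succs reg)|apply/IHn; exists p].
Qed.

(** Walks are determined by their ends, so the spheres around different successors are disjoint.
    This is why the powers of the Laplacian have kernel entries 0 and 1 only. *)
Lemma sphere_uniq n e : uniq (sphere n e).
Proof.
have [_ acyc _] := tree.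
elim: n e => [//|n IHn] e /=.
have /allP : all (nxt e) (succs e) by apply/allP => k; rewrite (mem_succs reg).
elim: (succs e) (succs_uniq e) => //= k s IHs /andP[ks us] ns.
rewrite cat_uniq IHn IHs ?andbT//=; last by move=> f fs; apply: ns; rewrite inE fs orbT.
apply/hasPn => f /flatten_mapP[k' k's /sphereP[p [pp sp lp]]].
apply/negP => /sphereP[p' [pp' sp' lp']].
have ek : nxt e k by apply: ns; rewrite mem_head.
have ek' : nxt e k' by apply: ns; rewrite inE k's orbT.
have [||/=|_] := @walk_unique _ acyc true true e (k :: p') (k' :: p).
- by rewrite /= ek.
- by rewrite /= ek'.
- by rewrite lp lp'.
by move=> -[kk' _]; move: ks; rewrite kk' k's.
Qed.

Lemma laplacian_iterE n h e : word_op (nseq n true) h e = \sum_(f <- sphere n e) h f.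
Proof.
elim: n e => [|n IHn] e /=; first by rewrite big_seq1.
rewrite laplacianE big_flatten big_map; apply: eq_bigr => k _; exact: IHn.
Qed.

(* The triple (a, n, b) stands for the word x^(1-a) d^n x^(1-b). *)
Definition nword (t : bool * nat * bool) : seq bool :=
  nseq (~~ t.1.1) false ++ nseq t.1.2 true ++ nseq (~~ t.2) false.
(** At distance 0 the triples (a, 0, b) and (~~ a, 0, ~~ b) name the same set of edges; the one with
    a = true is kept. *)
Definition normal (t : bool * nat * bool) : bool := (t.1.2 == 0%N) ==> t.1.1.
(** By [orbit_eact] and [orbit_transitive] these are, when non-empty, the orbits of the stabilizer
    of [e] on the edges. *)
Definition orbit t e : seq (edge X) :=
  [seq flip t.2 f | f <- sphere t.1.2 (flip t.1.1 e)].

Lemma nword_opE t h e : word_op (nword t) h e = \sum_(f <- orbit t e) h f.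
Proof.
case: t => [[a n] b]; rewrite /nword/= !word_op_cat /= big_map.
have -> g : word_op (nseq (~~ a) false) g e = g (flip a e) by case: a.
rewrite laplacian_iterE; apply: eq_bigr => f _.
by case: b.
Qed.

Lemma orbitP t e f : reflect (reach t.1.2 (flip t.1.1 e) (flip t.2 f)) (f \in orbit t e).
Proof.
apply: (iffP mapP) => [[k /sphereP ek ->]|ef]; first by rewrite flipK.
by exists (flip t.2 f); [exact/sphereP|rewrite flipK].
Qed.

Lemma orbit_uniq t e : uniq (orbit t e).
Proof. by rewrite map_inj_uniq ?sphere_uniq//; exact: can_inj (flipK _). Qed.

Lemma orbit_eact t (g : aut X) e f : (eact g f \in orbit t (eact g e)) = (f \in orbit t e).
Proof.
apply/orbitP/orbitP; rewrite -!eact_flip; last exact: reach_eact.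
by move=> /(reach_eact g^-1%g); rewrite !eactK.
Qed.

Lemma orbit_ex e f : exists2 t, normal t & f \in orbit t e.
Proof.
have [b [c [[|n] bc]]] := reach_ex tree e f; last first.
  by exists (b, n.+1, c) => //; apply/orbitP.
case: b bc => bc; first by exists (true, 0%N, c) => //; apply/orbitP.
exists (true, 0%N, ~~ c) => //; apply/orbitP; apply/reach0.
by move/reach0: bc => /= /(congr1 (@eop X)); rewrite eop_flip eopK.
Qed.

Lemma orbit_fun t t' e f : normal t -> normal t' ->
  f \in orbit t e -> f \in orbit t' e -> t = t'.
Proof.
move=> nt nt' /orbitP et /orbitP et'.
have [] := reach_unique tree et et'.
rewrite /normal in nt nt'.
case: t t' nt nt' {et et'} => [[a n] b] [[a' n'] b'] /= nt nt' nn [[-> ->]|[n0 [aa' _]]].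
  by rewrite nn.
by move: nt nt' aa'; rewrite -nn n0 /= => -> ->.
Qed.

Lemma orbit_inhabited t e : (0 < q)%N -> exists f, f \in orbit t e.
Proof.
move=> q0; have [f ef] := reach_inhabited tree t.1.2 (flip t.1.1 e) q0.
by exists (flip t.2 f); apply/orbitP; rewrite flipK.
Qed.

Lemma orbit_transitive t e f f' : f \in orbit t e -> f' \in orbit t e ->
  exists g : aut X, eact g e = e /\ eact g f = f'.
Proof.
move=> /orbitP ef /orbitP ef'; have [g [ge gf]] := reach_transitive tree ef ef'.
exists g; split; first by apply: (can_inj (flipK t.1.1)); rewrite -eact_flip.
by apply: (can_inj (flipK t.2)); rewrite -eact_flip.
Qed.

Definition etype e f := xget (true, 0%N, true) [set t | normal t /\ f \in orbit t e].

Lemma etypeP e f : normal (etype e f) /\ f \in orbit (etype e f) e.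
Proof.
rewrite /etype; case: xgetP => [t _ //|]; have [t nt ft] := orbit_ex e f.
by move=> /(_ t) []; split.
Qed.

Lemma mem_orbit t e f : normal t -> (f \in orbit t e) = (etype e f == t).
Proof.
have [nt ft] := etypeP e f; move=> nt'.
by apply/idP/eqP => [ft'|<-//]; exact: orbit_fun ft ft'.
Qed.
End EdgeWords.

(** * Normal forms in the presented algebra and its faithful action *)

Section Presentation.
Variables (R : realType) (X : sgraph) (q : nat).
Hypotheses (tree : regular_tree q.+1 X) (q_gt0 : (0 < q)%N).
Local Notation C := (Cplx R).
Local Notation M := (edge X -> C).
Local Notation word_op := (@word_op R X).

(* A is the free algebra on x and d, with its basis of words: conversion on the
   concrete monoid algebra is intractable, hence the axiomatic interface. *)
Variables (A : lalgType C) (monom : seq bool -> A) (S : set A).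
Variable lin_ext : (seq bool -> C) -> A -> C.
Hypothesis monom_nil : monom [::] = 1.
Hypothesis monom_cat : forall u v, monom (u ++ v) = monom u * monom v.
Hypothesis monom_scalerAr : forall w c a,
  monom w * (c *: a) = c *: (monom w * a).
Hypothesis monom_ind : forall P : A -> Prop,
  P 0 -> (forall c w a, P a -> P (c *: monom w + a)) -> forall a, P a.
Hypothesis lin_extD : forall h a b, lin_ext h (a + b) = lin_ext h a + lin_ext h b.
Hypothesis lin_ext0 : forall h, lin_ext h 0 = 0.
Hypothesis lin_extZ : forall h c a, lin_ext h (c *: a) = c * lin_ext h a.
Hypothesis lin_ext_monom : forall h w, lin_ext h (monom w) = h w.
Local Notation x := (monom [:: false]).
Local Notation d := (monom [:: true]).
Hypothesis S_def : S = [set x * x - 1; d * x * d - (q%:R *: x + (q%:R - 1) *: d)].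
Hypothesis S_proper : ~ ideal_gen S 1.
Local Notation Q := (quot_alg S_proper).
Local Notation I := (ideal_gen S).
Local Notation cls := (quot_class S_proper).
Implicit Types (e f : edge X) (h : M) (u v : Q) (a b : A).

Definition free_op (a : A) : M -> M :=
  fun h e => lin_ext (fun w => word_op w h e) a.

Lemma free_opD a b : free_op (a + b) = free_op a \+ free_op b.
Proof. by apply/funext => h; apply/funext => e; rewrite /free_op lin_extD. Qed.

Lemma free_opZ c a : free_op (c *: a) = c \*: free_op a.
Proof. by apply/funext => h; apply/funext => e; rewrite /free_op lin_extZ. Qed.

Lemma free_op_monom w : free_op (monom w) = word_op w.
Proof. by apply/funext => h; apply/funext => e; rewrite /free_op lin_ext_monom. Qed.

Lemma free_op0 : free_op 0 = 0.
Proof. by apply/funext => h; apply/funext => e; rewrite /free_op lin_ext0. Qed.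

Lemma free_op_linear a c h h' :
  free_op a (c *: h + h') = c *: free_op a h + free_op a h'.
Proof.
elim/monom_ind: a => [|k w a IHa]; first by rewrite free_op0 scaler0 addr0.
rewrite free_opD free_opZ free_op_monom /= IHa (word_op_linear tree).
by rewrite !scalerDr !scalerA mulrC addrACA.
Qed.

Lemma word_free_op w a h : word_op w (free_op a h) = free_op (monom w * a) h.
Proof.
elim/monom_ind: a => [|k v a IHa]; first by rewrite mulr0 free_op0 (word_op0 R tree).
rewrite free_opD free_opZ free_op_monom /= (word_op_linear tree) IHa.
rewrite mulrDr free_opD monom_scalerAr -monom_cat free_opZ free_op_monom.
by rewrite word_op_cat.
Qed.

Lemma free_opM a b : free_op (a * b) = free_op a \o free_op b.
Proof.
apply/funext => h /=; elim/monom_ind: a => [|k w a IHa]; first by rewrite mul0r !free_op0.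
rewrite mulrDl !free_opD /= IHa -scalerAl !free_opZ free_op_monom /=.
by rewrite word_free_op.
Qed.

Lemma cls_repr u : cls (repr (u : Quotient.quot (in_ideal_gen _))) = u.
Proof. exact: reprK. Qed.

Lemma clsD a b : cls (a + b) = cls a + cls b.
Proof. exact: Quotient.pi_add. Qed.

Let rep u : A := repr (u : Quotient.quot (in_ideal_gen _)).

Lemma rep_cls a : I (rep (cls a) - a).
Proof. by apply/quot_classP; rewrite cls_repr. Qed.

Lemma clsM a b : cls (a * b) = cls a * cls b.
Proof.
apply/esym; rewrite -[LHS]/(cls (rep (cls a) * rep (cls b))); apply/quot_classP.
have [_ IB IM] := ideal_gen_two_sided S.
have -> : rep (cls a) * rep (cls b) - a * b =
    (rep (cls a) - a) * rep (cls b) - (- a) * (rep (cls b) - b).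
  by rewrite mulrBl mulNr opprK mulrBr addrA subrK.
apply: IB; first exact: (IM _ _ (rep_cls a)).2.
exact: (IM _ _ (rep_cls b)).1.
Qed.

Lemma clsZ (c : C) a : cls (c *: a) = c *: cls a.
Proof.
apply/esym; rewrite -[LHS]/(cls (c *: rep (cls a))); apply/quot_classP.
have [_ IB IM] := ideal_gen_two_sided S.
rewrite -scalerBr -[X in _ *: X]mul1r scalerAl.
exact: (IM _ _ (rep_cls a)).1.
Qed.

Lemma cls1 : cls 1 = 1. Proof. by []. Qed.

Lemma cls0 : cls 0 = 0.
Proof. by rewrite -(scale0r (0 : A)) clsZ scale0r. Qed.

Lemma free_op_ideal a : I a -> free_op a = 0.
Proof.
move: a; apply: smallest_sub => [|a].
  split=> [|a b a0 b0|a b b0].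
  - exact: free_op0.
  - rewrite /= -scaleN1r free_opD free_opZ a0 b0.
    by apply/funext => h /=; rewrite scaler0 addr0.
  - split; rewrite /= free_opM b0; apply/funext => h //=.
    by have := free_op_linear a (-1) 0 0; rewrite !scaleN1r !addNr.
rewrite S_def; case=> ->; rewrite /= -[- _]scaleN1r free_opD free_opZ !free_opM !free_op_monom.
- rewrite -monom_nil free_op_monom; apply/funext => h /=.
  by rewrite inversionK scaleN1r subrr.
- rewrite free_opD !free_opZ !free_op_monom; apply/funext => h /=.
  by rewrite (laplacian_inversion tree) scaleN1r subrr.
Qed.

(** Defined through a chosen representative; [rho_cls] shows independence of the choice. *)
Definition edge_rho u : M -> M := free_op (rep u).

Lemma rho_cls a : edge_rho (cls a) = free_op a.
Proof.
have := free_op_ideal (rep_cls a).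
rewrite -[- a]scaleN1r free_opD free_opZ => ra; apply/funext => h.
have /eqP := congr1 (fun T : M -> M => T h) ra.
by rewrite /= scaleN1r subr_eq0 => /eqP.
Qed.

Lemma edge_rho_action : algebra_action edge_rho.
Proof.
split.
- by rewrite -cls1 rho_cls -monom_nil free_op_monom.
- move=> u v; rewrite -[u]cls_repr -[v]cls_repr -clsM !rho_cls.
  exact: free_opM.
- by move=> u v; rewrite -[u]cls_repr -[v]cls_repr -clsD !rho_cls free_opD.
- by move=> c u; rewrite -[u]cls_repr -clsZ !rho_cls free_opZ.
- by move=> u c h h'; rewrite /edge_rho free_op_linear.
Qed.

(** A triple may occur several times in the list; [sum_collect] merges its coefficients when
    independence is at stake. *)
Definition normal_span u := exists s : seq (C * (bool * nat * bool)),
  all normal (map snd s) /\ u = \sum_(x <- s) x.1 *: cls (monom (nword x.2)).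

Lemma normal_span0 : normal_span 0.
Proof. by exists [::]; rewrite big_nil. Qed.

Lemma normal_spanD u v : normal_span u -> normal_span v -> normal_span (u + v).
Proof.
move=> [s [ns ->]] [s' [ns' ->]]; exists (s ++ s').
by rewrite map_cat all_cat ns ns' big_cat.
Qed.

Lemma normal_spanZ c u : normal_span u -> normal_span (c *: u).
Proof.
move=> [s [ns ->]]; exists [seq (c * x.1, x.2) | x <- s].
rewrite -map_comp; split=> //; rewrite big_map scaler_sumr.
by apply: eq_bigr => x _; rewrite scalerA.
Qed.

(** The triples that are not normal give only the words x and x x. The first also comes from a
    normal triple, the second equals 1. *)
Lemma normal_span_nword t : normal_span (cls (monom (nword t))).
Proof.
wlog nt : t / normal t => [W|].
  have [nt|] := boolP (normal t); first exact: W.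
  case: t => [[[] n] b]; first by rewrite /normal/= implybT.
  rewrite /normal/= implybF negbK => /eqP ->.
  have := W (true, 0%N, ~~ b) isT; case: b => //=.
  rewrite /nword/=.
  have -> : cls (monom [:: false; false]) = cls (monom [::]); last by [].
  rewrite monom_nil -[[:: _; _]]/([:: false] ++ [:: false]) monom_cat.
  apply/quot_classP; apply: sub_gen_smallest; rewrite S_def; left => //.
by exists [:: (1, t)]; rewrite /= nt big_seq1 scale1r.
Qed.

Lemma cls_xx (u v : seq bool) : cls (monom (u ++ [:: false, false & v])) = cls (monom (u ++ v)).
Proof.
rewrite !monom_cat !clsM; congr (_ * _).
rewrite -[[:: _, _ & _]]/([:: false] ++ [:: false] ++ v) !monom_cat mulrA clsM.
rewrite -[RHS]mul1r -cls1; congr (_ * _); apply/quot_classP.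
by apply: sub_gen_smallest; rewrite S_def; left.
Qed.

Lemma cls_dxd (v : seq bool) : cls (monom [:: true, false, true & v]) =
  q%:R *: cls (monom (false :: v)) + (q%:R - 1) *: cls (monom (true :: v)).
Proof.
rewrite -[[:: _, _, _ & _]]/([:: true] ++ [:: false] ++ [:: true] ++ v).
rewrite -[false :: v]/([:: false] ++ v) -[true :: v]/([:: true] ++ v).
rewrite !monom_cat !mulrA clsM [in RHS]clsM [cls (_ [:: true] * _)]clsM.
rewrite !scalerAl -mulrDl -!clsZ -clsD; congr (_ * _); apply/quot_classP.
by apply: sub_gen_smallest; rewrite S_def; right.
Qed.

(** The span contains 1, so stability under left multiplication by the generators makes it the whole
    algebra. The second relation is called for only by d times x d^(n+1); the other products are
    words of the form [nword t] or shrink to one by x x = 1. *)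
Lemma normal_span_gen (b : bool) u : normal_span u ->
  normal_span (cls (monom [:: b]) * u).
Proof.
move=> [s [_ ->]]; rewrite mulr_sumr.
elim/big_rec: _ => [|[c t] v _ vs]; first exact: normal_span0.
apply: normal_spanD vs; rewrite -clsZ -clsM monom_scalerAr clsZ -monom_cat /=.
apply: normal_spanZ; case: t => [[a n] b'] {c}.
case: b; case: a; rewrite /nword/=.
- exact: (normal_span_nword (true, n.+1, b')).
- case: n => [|n] /=.
    case: b' => /=; first exact: (normal_span_nword (true, 1%N, false)).
    by rewrite (cls_xx [:: true] [::]); exact: (normal_span_nword (true, 1%N, true)).
  rewrite cls_dxd; apply: normal_spanD; apply: normal_spanZ.
    exact: (normal_span_nword (false, n, b')).
  exact: (normal_span_nword (true, n.+1, b')).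
- exact: (normal_span_nword (false, n, b')).
- by rewrite (cls_xx [::]); exact: (normal_span_nword (true, n, b')).
Qed.

Lemma normal_spanT u : normal_span u.
Proof.
rewrite -[u]cls_repr; elim/monom_ind: (repr _) => [|c w a IHa].
  by rewrite cls0; exact: normal_span0.
rewrite clsD clsZ; apply: normal_spanD IHa; apply: normal_spanZ.
elim: w => [|b w IHw]; first exact: (normal_span_nword (true, 0%N, true)).
by rewrite -[b :: w]/([:: b] ++ w) monom_cat clsM; exact: normal_span_gen.
Qed.

Lemma sum_collect (V : lmodType C) (T : eqType) (s : seq (C * T)) (F : T -> V) :
  \sum_(x <- s) x.1 *: F x.2 =
  \sum_(t <- undup (map snd s)) (\sum_(x <- s | x.2 == t) x.1) *: F t.
Proof.
under [RHS]eq_bigr => t _.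
  rewrite scaler_suml big_mkcond/=; over.
rewrite exchange_big /=; apply: eq_big_seq => x xs.
rewrite (bigD1_seq x.2) ?undup_uniq ?mem_undup ?map_f//= eqxx big1 ?addr0// => t nt.
by rewrite eq_sym (negbTE nt).
Qed.

Lemma edge_rhoD u v : edge_rho (u + v) = edge_rho u \+ edge_rho v.
Proof. by have [_ _ -> _ _] := edge_rho_action. Qed.

Lemma edge_rhoZ c u : edge_rho (c *: u) = c \*: edge_rho u.
Proof. by have [_ _ _ -> _] := edge_rho_action. Qed.

Lemma edge_rho0 : edge_rho 0 = 0.
Proof. by rewrite -cls0 rho_cls free_op0. Qed.

Lemma edge_rho_sum (T : Type) (s : seq T) (c : T -> C) (t : T -> bool * nat * bool) h e :
  edge_rho (\sum_(x <- s) c x *: cls (monom (nword (t x)))) h e =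
  \sum_(x <- s) c x * \sum_(f <- orbit (t x) e) h f.
Proof.
elim: s => [|x s IHs]; first by rewrite !big_nil edge_rho0.
by rewrite !big_cons edge_rhoD /= -IHs edge_rhoZ rho_cls free_op_monom -(nword_opE tree).
Qed.

(** For [f] in the orbit of [t], the kernel entry (e, f) of a combination of normal words is the
    total coefficient of [t], since the orbits are disjoint. Positivity of q provides such an
    [f]. *)
Lemma edge_rho_inj (e : edge X) : injective edge_rho.
Proof.
move=> u v /= uv; apply/eqP; rewrite -subr_eq0; apply/eqP.
have : edge_rho (u - v) = 0.
  rewrite -[- v]scaleN1r edge_rhoD edge_rhoZ uv; apply/funext => h.
  by rewrite /= scaleN1r subrr.
have [s [ns ->]] := normal_spanT (u - v).
move: (u - v) => _ {u v uv} r0.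
rewrite (sum_collect s (fun t => cls (monom (nword t)))).
rewrite big_seq big1// => t; rewrite mem_undup => ts.
have nt : normal t by exact: (allP ns).
suff -> : \sum_(x <- s | x.2 == t) x.1 = 0 by rewrite scale0r.

have [f ft] := orbit_inhabited tree t e q_gt0.
(* Evaluating on the indicator of [f] isolates the entry (e, f). *)
have := congr1 (fun T : M -> M => T (fun k => (k == f)%:R) e) r0.
rewrite edge_rho_sum => r1; apply: etrans r1.
rewrite big_mkcond/=; apply: eq_big_seq => x xs.
have nx : normal x.2 by apply: (allP ns); rewrite map_f.
rewrite (mem_orbit tree e f nt) in ft; rewrite -(eqP ft) eq_sym.
rewrite -(mem_orbit tree e f nx).
case: ifP => fx; last first.
  rewrite big_seq big1 ?mulr0// => k kx; case: eqP => // kf.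
  by rewrite kf fx in kx.
rewrite (bigD1_seq f) ?(orbit_uniq tree)//= eqxx big1 ?addr0 ?mulr1// => k kf.
by rewrite (negbTE kf).
Qed.

(** [c] is the row of the kernel at [e1], and translation gives the other rows. Being constant on
    the orbits of the stabilizer of [e1], the row is a combination of their indicators, with its
    values at representatives [F t] as coefficients. *)
Lemma equivariant_rho (T : M -> M) (e1 : edge X) (c : edge X -> C) (L : seq (edge X)) :
  uniq L -> (forall f, f \notin L -> c f = 0) ->
  (forall (g : aut X) f, eact g e1 = e1 -> c (eact g f) = c f) ->
  (forall (g : aut X) h, T h (eact g e1) = \sum_(f <- L) c f * h (eact g f)) ->
  exists u, T = edge_rho u.
Proof.
move=> uL cL cG TE.
pose s := undup (map (etype e1) L).
have sn t : t \in s -> normal t.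
  by rewrite mem_undup => /mapP[f _ ->]; have [] := etypeP tree e1 f.
have /choice [F FP] : forall t, exists f, f \in orbit t e1.
  by move=> t; exact: (orbit_inhabited tree t e1 q_gt0).
exists (\sum_(t <- s) c (F t) *: cls (monom (nword t))).
apply/funext => h; apply/funext => e.
have [g <-] := edge_transitive tree e1 e.
rewrite TE edge_rho_sum.
transitivity (\sum_(t <- s) \sum_(f <- L | etype e1 f == t) c f * h (eact g f)).
  under [RHS]eq_bigr => t _ do rewrite big_mkcond/=.
  rewrite exchange_big /=; apply: eq_big_seq => f fL.
  rewrite (bigD1_seq (etype e1 f)) ?undup_uniq ?mem_undup ?map_f//= eqxx.
  by rewrite big1 ?addr0// => t nt; rewrite eq_sym (negbTE nt).
apply: eq_big_seq => t ts; rewrite mulr_sumr.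
have -> : \sum_(f <- orbit t (eact g e1)) c (F t) * h f =
          \sum_(f <- orbit t e1) c (F t) * h (eact g f).
  rewrite -[RHS](big_map (eact g) predT (fun f => c (F t) * h f)).
  apply: perm_big; apply: uniq_perm; rewrite ?(orbit_uniq tree)//.
    by rewrite map_inj_uniq ?(orbit_uniq tree)//; exact: eact_inj.
  move=> f; rewrite -{1}(eactVK g f) (orbit_eact tree).
  by rewrite -{2}(eactVK g f) mem_map//; exact: eact_inj.
have -> : \sum_(f <- orbit t e1) c (F t) * h (eact g f) =
          \sum_(f <- orbit t e1) c f * h (eact g f).
  apply: eq_big_seq => f ft; congr (_ * _).
  by have [k [ke <-]] := orbit_transitive tree ft (FP t); exact: cG.
(* The orbit need not lie in [L]; its edges outside [L] contribute 0. *)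
rewrite -big_filter [RHS](bigID (mem L))/= [X in _ = _ + X]big1 ?addr0; last first.
  by move=> f /cL ->; rewrite mul0r.
rewrite -[RHS]big_filter; apply: perm_big; apply: uniq_perm.
- exact: filter_uniq.
- by rewrite filter_uniq// (orbit_uniq tree).
by move=> f; rewrite !mem_filter (mem_orbit tree _ _ (sn _ ts)) andbC.
Qed.

Lemma edge_rho_range :
  range edge_rho = operator_algebra_gen [set @edge_laplacian R X; @edge_inversion R X].
Proof.
have [r1 rM rD rZ _] := edge_rho_action.
apply/seteqP; split.
  move=> _ [u _ <-] B [[B1 BM BD BZ] BG].
  have Bw w : B (word_op w).
    elim: w => //= b w Bw; apply: BM Bw; apply: BG; case: b; by [left|right].
  rewrite -[u]cls_repr rho_cls.
  elim/monom_ind: (repr _) => [|c w a IHa].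
    have := BZ 0 _ B1; congr B; apply/funext => h.
    by rewrite /= scale0r free_op0.
  rewrite free_opD free_opZ; apply: BD IHa; apply: BZ.
  by rewrite free_op_monom.
apply: smallest_sub.
  split.
  - by exists 1; rewrite ?r1.
  - by move=> _ _ [u _ <-] [v _ <-]; exists (u * v); rewrite ?rM.
  - by move=> _ _ [u _ <-] [v _ <-]; exists (u + v); rewrite ?rD.
  - by move=> c _ [u _ <-]; exists (c *: u); rewrite ?rZ.
move=> _ [->|->]; first by exists (cls d); rewrite ?rho_cls ?free_op_monom.
by exists (cls x); rewrite ?rho_cls ?free_op_monom.
Qed.

(** The last clause recognizes operators by one row of their kernel, so that the Hecke side never
    has to deal with normal forms. *)
Lemma presentation (e1 : edge X) : exists rho : Q -> M -> M,
  [/\ algebra_action rho, injective rho,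
      rho (cls d) = @edge_laplacian R X, rho (cls x) = @edge_inversion R X &
      range rho = operator_algebra_gen [set @edge_laplacian R X; @edge_inversion R X] /\
  forall (T : M -> M) (c : edge X -> C) (L : seq (edge X)),
    uniq L -> (forall f, f \notin L -> c f = 0) ->
    (forall (g : aut X) f, eact g e1 = e1 -> c (eact g f) = c f) ->
    (forall (g : aut X) h, T h (eact g e1) = \sum_(f <- L) c f * h (eact g f)) ->
    range rho T].
Proof.
exists edge_rho; split.
- exact: edge_rho_action.
- exact: edge_rho_inj.
- by rewrite rho_cls free_op_monom.
- by rewrite rho_cls free_op_monom.
split; first exact: edge_rho_range.
by move=> T c L uL cL cG TE; have [u ->] := equivariant_rho uL cL cG TE; exists u.
Qed.
End Presentation.

Lemma edge_presentation (R : realType) (X : sgraph) (q : nat) (e1 : edge X) :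
  regular_tree q.+1 X -> (0 < q)%N ->
  exists rho : edge_presented (Cplx R) q -> (edge X -> Cplx R) -> edge X -> Cplx R,
  [/\ algebra_action rho, injective rho,
      rho (edge_gen _ q true) = @edge_laplacian R X,
      rho (edge_gen _ q false) = @edge_inversion R X &
      range rho = operator_algebra_gen [set @edge_laplacian R X; @edge_inversion R X] /\
  forall (T : (edge X -> Cplx R) -> edge X -> Cplx R) (c : edge X -> Cplx R)
      (L : seq (edge X)),
    uniq L -> (forall f, f \notin L -> c f = 0) ->
    (forall (g : aut X) f, eact g e1 = e1 -> c (eact g f) = c f) ->
    (forall (g : aut X) h, T h (eact g e1) = \sum_(f <- L) c f * h (eact g f)) ->
    range rho T].
Proof.
move=> tree q0; pose C := Cplx R.
have S_def : @edge_relators C q =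
    [set monom C [:: false] * monom C [:: false] - 1;
     monom C [:: true] * monom C [:: false] * monom C [:: true] -
     (q%:R *: monom C [:: false] + (q%:R - 1) *: monom C [:: true])].
  by rewrite -!free_genE.
have := presentation tree q0 (monom_nil C) (@monom_cat C) (@monom_scalerAr C)
  (@malg_ind C) (@lin_extD C) (@lin_ext0 C) (@lin_extZ C) (@lin_ext_monom C)
  S_def (@edge_relators_proper C q) e1.
by rewrite /edge_gen !free_genE.
Qed.


From mathcomp Require Import finmap measurable_realfun.

(** * Topology of the automorphism group *)

Section AutTopology.
Variable X : sgraph.
Hypotheses (conn : connected_graph X).
Hypothesis locfin : forall x : X, finite_set [set y | adj x y].
Implicit Types (x y : X) (g h : aut X) (A B : set (aut X)) (D : set X).

Definition cyl x y : set (aut X) := [set h | h x = y].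

Lemma aut_nbhs g A : nbhs g A <-> exists S : seq X, forall h, {in S, h =1 g} -> A h.
Proof.
split=> [[B [oB Bg BA]]|[S SA]].
  by have [S SB] := oB _ Bg; exists S => h /SB /BA.
exists [set h : aut X | {in S, h =1 g}]; split=> //.
by move=> h hg; exists S => k kh x xS; rewrite kh// hg.
Qed.

Lemma open_autP A :
  open A <-> forall g, A g -> exists S : seq X, forall h, {in S, h =1 g} -> A h.
Proof. by []. Qed.

Lemma cyl_open x y : open (cyl x y).
Proof. by move=> g <-; exists [:: x] => h; apply; rewrite inE. Qed.

Lemma open_sub_cyl D x : open [set g : aut X | D (g x)].
Proof. by move=> g /= Dg; exists [:: x] => h /= ->; rewrite ?inE. Qed.

Lemma closed_sub_cyl D x : closed [set g : aut X | D (g x)].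
Proof.
by rewrite -openC; exact: (@open_sub_cyl (~` D) x).
Qed.

Fixpoint walks n x : set X :=
  if n is n'.+1 then \bigcup_(z in [set z | adj x z]) walks n' z else [set x].

Lemma walks_finite n x : finite_set (walks n x).
Proof. by elim: n x => [|n IHn] x /=; [exact: finite_set1|exact: bigcup_finite]. Qed.

Lemma walks_ex x y : exists n, walks n x y.
Proof.
have [p [pp <-]] := conn x y; exists (size p).
by elim: p x pp => //= z p IHp x /andP[xz /IHp]; exists z.
Qed.

Lemma walks_aut g n x y : walks n x y -> walks n (g x) (g y).
Proof.
elim: n x => [|n IHn] x /=; first by move->.
by move=> [z /= xz zy]; exists (g z); [rewrite /= aut_adj|exact: IHn].
Qed.

(** Relative compactness in disguise, by [compact_closureE]; the choice of the vertex is immaterial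
    by [bounded_move]. *)
Definition bounded_at x A := finite_set [set g x | g in A].

Lemma bounded_atS x A B : A `<=` B -> bounded_at x B -> bounded_at x A.
Proof. by move=> AB; apply: sub_finite_set => _ [g Ag <-]; exists g => //; exact: AB. Qed.

(** Automorphisms preserve walks, so [g y] stays a fixed number of steps away from [g x], and
    spheres of walks are finite. *)
Lemma bounded_move x y A : bounded_at x A -> bounded_at y A.
Proof.
move=> bA; have [n xy] := walks_ex x y.
apply: (@sub_finite_set _ _ (\bigcup_(z in [set g x | g in A]) walks n z)).
  by move=> _ [g Ag <-]; exists (g x); [exists g|exact: walks_aut].
by apply: bigcup_finite => // z _; exact: walks_finite.
Qed.

(** The inverse of [g] carries a walk from [g x] to [x] to a walk from [x] to the preimage of [x],
    and only finitely many starting points [g x] occur. *)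
Lemma bounded_inv x A : bounded_at x A -> finite_set [set (g^-1)%g x | g in A].
Proof.
move=> bA; have /choice [n nP] : forall y, exists n, walks n y x.
  by move=> y; exact: walks_ex.
apply: (@sub_finite_set _ _ (\bigcup_(z in [set g x | g in A]) walks (n z) x)).
  move=> _ [g Ag <-]; exists (g x); first by exists g.
  by have := walks_aut (g^-1)%g (nP (g x)); rewrite /= aut_funK.
by apply: bigcup_finite => // z _; exact: walks_finite.
Qed.

Lemma ultra_finite (T I : choiceType) (F : set_system T) (D : set I) (f : T -> I) :
  UltraFilter F -> finite_set D -> F (f @^-1` D) -> exists2 i, D i & F (f @^-1` [set i]).
Proof.
move=> UF fD FD; apply: contrapT => nF.
have : F (\bigcap_(i in [set` fset_set D]) ~` (f @^-1` [set i])).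
  apply: filter_bigI => i; rewrite in_fset_set// => /set_mem Di.
  by have [Fi|//] := in_ultra_setVsetC (f @^-1` [set i]) UF; case: nF; exists i.
move=> /(filterI FD) /filter_ex [t [/= Dt]] /(_ (f t)); apply=> //.
by rewrite /= in_fset_set//; exact: mem_set.
Qed.

(** An ultrafilter decides the value of [g y] for each vertex [y], as only finitely many values
    occur, and likewise for the inverse of [g]. Following the inverses too makes the pointwise limit
    invertible. *)
Lemma compact_sub_cyl x D : finite_set D -> compact [set g : aut X | D (g x)].
Proof.
move=> fD; rewrite compact_ultra => F UF FA.
set A := [set g : aut X | D (g x)] in FA.
have bA : bounded_at x A by apply: sub_finite_set fD => _ [g Ag <-].
have /choice [s sP] : forall y, exists z, F [set g : aut X | g y = z].
  move=> y; have [|z _ Fz] := @ultra_finite (aut X) X F _ (fun g => g y) UF (bounded_move y bA).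
    by apply: filterS FA => g Ag; exists g.
  by exists z.
have /choice [t tP] : forall y, exists z, F [set g : aut X | (g^-1)%g y = z].
  move=> y; have [|z _ Fz] := @ultra_finite (aut X) X F _ (fun g => (g^-1)%g y) UF
      (bounded_inv (bounded_move y bA)).
    by apply: filterS FA => g Ag; exists g.
  by exists z.
have FI P Q : F P -> F Q -> exists g, P g /\ Q g.
  by move=> FP FQ; have [g [Pg Qg]] := filter_ex (filterI FP FQ); exists g.
have sK : cancel s t.
  move=> y; have [g [/= gy <-]] := FI _ _ (sP y) (tP (s y)).
  by rewrite -gy aut_funK.
have tK : cancel t s.
  move=> y; have [g [/= gy <-]] := FI _ _ (tP y) (sP (t y)).
  by rewrite -gy aut_invK.
have sA y z : adj (s y) (s z) = adj y z.
  by have [g [/= <- <-]] := FI _ _ (sP y) (sP z); rewrite aut_adj.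
exists (Aut sK tK sA); split.
  by have [g [/= + <-]] := FI _ _ FA (sP x).
move=> B /aut_nbhs [S SB].
have : F [set h : aut X | {in S, h =1 s}].
  elim: S {SB} => [|y S IHS]; first by apply: filterS filterT.
  apply: filterS (filterI (sP y) IHS) => h [/= hy hS] z.
  by rewrite inE => /predU1P[->|/hS].
by apply: filterS => h /= hs; exact: SB.
Qed.

Lemma compact_bounded x A : compact A -> bounded_at x A.
Proof.
rewrite compact_cover => /(_ X setT (cyl x)) [|g _|D _ AD].
- by move=> y _; exact: cyl_open.
- by exists (g x).
apply: (@sub_finite_set _ _ [set` D]); last exact: finite_fset.
by move=> _ [g /AD [y yD gy] <-]; rewrite gy.
Qed.

Lemma compact_closureE x A : compact (closure A) <-> bounded_at x A.
Proof.
split=> [/(compact_bounded x)|bA]; first by apply: bounded_atS; exact: subset_closure.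
apply: (@subclosed_compact _ (closure A) [set g : aut X | [set g x | g in A] (g x)]).
- exact: closed_closure.
- exact: compact_sub_cyl.
rewrite [X in _ `<=` X](closure_id _).1; last exact: (@closed_sub_cyl [set g x | g in A] x).
by apply: closure_subset => g Ag; exists g.
Qed.

Lemma bounded_mul (A B : set (aut X)) x :
  bounded_at x A -> bounded_at x B -> bounded_at x [set (g * h)%g | g in A & h in B].
Proof.
move=> bA bB; apply: (@sub_finite_set _ _
  (\bigcup_(y in [set h x | h in B]) [set g y | g in A])).
  by move=> _ [_ [g Ag [h Bh <-]] <-]; exists (h x); [exists h|exists g].
by apply: bigcup_finite => // y _; exact: (bounded_move y bA).
Qed.

Lemma bounded_invset x A : bounded_at x A -> bounded_at x [set (g^-1)%g | g in A].
Proof.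
move=> /bounded_inv; apply: sub_finite_set => _ [_ [g Ag <-] <-].
by exists g.
Qed.

Lemma countable_vertices : countable [set: X].
Proof.
have [[x]|nX] := pselect (inhabited X); last first.
  apply: finite_set_countable; apply: (@sub_finite_set _ _ set0) => // x _.
  by case: nX.
have -> : [set: X] = \bigcup_n walks n x.
  by apply/seteqP; split=> // y _; have [n] := walks_ex x y; exists n.
by apply: bigcup_countable => // n _; exact/finite_set_countable/walks_finite.
Qed.

Definition seq_cyl (st : seq X * seq X) : set (aut X) := [set h : aut X | map h st.1 = st.2].

Lemma seq_cyl_open st : open (seq_cyl st).
Proof.
move=> g /= gs; exists st.1 => h hg; rewrite /seq_cyl/= -gs.
by apply/eq_in_map.
Qed.

Lemma countable_seq_vertices : countable [set: seq X * seq X].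
Proof.
have /countable_injP [f] := countable_vertices.
move=> /in2TT finj.
apply/countable_injP; exists (fun st => @choice.pickle (seq nat * seq nat)%type (map f st.1, map f st.2)).
move=> [s t] [s' t'] _ _ /(pcan_inj (@choice.pickleK _)) [] /(inj_map finj) -> /(inj_map finj) ->.
by [].
Qed.
End AutTopology.

(** * Haar measures *)

Lemma pushforward_measure d d' (T1 : measurableType d) (T2 : measurableType d')
    (R : realType) (m : {measure set T1 -> \bar R}) (f : T1 -> T2) :
    measurable_fun setT f ->
  exists m' : {measure set T2 -> \bar R}, forall A, m' A = m (f @^-1` A).
Proof.
move=> mf; eexists (pushforward m f) => //.
Unshelve. exact: mf.
Qed.

Section AutBorel.
Variables (R : realType) (X : sgraph).
Hypotheses (conn : connected_graph X).
Hypothesis locfin : forall x : X, finite_set [set y | adj x y].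
Local Notation G := (borel (aut X)).
Implicit Types (x y : X) (g h : aut X) (A B : set (aut X)) (m : {measure set G -> \bar R}).

Lemma borel_open A : open A -> measurable (A : set G).
Proof. by move=> oA; exact: sub_sigma_algebra. Qed.

Lemma measurable_cyl x y : measurable (cyl x y : set G).
Proof. by apply: borel_open; exact: (@cyl_open X x y). Qed.

Lemma measurable_seq_cyl st : measurable (seq_cyl st : set G).
Proof. by apply: borel_open; exact: (@seq_cyl_open X st). Qed.

Lemma borel_measurable_fun d (T : measurableType d) (f : T -> G) :
  (forall A, open A -> measurable (f @^-1` A)) -> measurable_fun setT f.
Proof.
move=> fo; apply: (@measurability _ _ _ _ setT f (@open (aut X))) => //.
by move=> _ [B oB <-]; rewrite setTI; exact: fo.
Qed.

Lemma mulgl_open g A : open A -> open [set h | A (g * h)%g].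
Proof.
move=> /open_autP oA; apply/open_autP => h /oA[S SA]; exists S => k kh; apply: SA => x xS /=.
by rewrite kh.
Qed.

Lemma mulgr_open g A : open A -> open [set h | A (h * g)%g].
Proof.
move=> /open_autP oA; apply/open_autP => h /oA[S SA]; exists (map g S) => k kh; apply: SA => x xS /=.
by rewrite kh// map_f.
Qed.

Lemma invg_open A : open A -> open [set h : aut X | A (h^-1)%g].
Proof.
move=> /open_autP oA; apply/open_autP => h /oA[S SA]; exists (map (aut_inv h) S) => k kh; apply: SA => x xS /=.
by apply: (can_inj (aut_funK k)); rewrite aut_invK kh ?map_f// aut_invK.
Qed.

Lemma measurable_mulgl g : measurable_fun [set: G] (fun h : G => (g * h)%g : G).
Proof. by apply: borel_measurable_fun => A oA; apply: borel_open; exact: mulgl_open. Qed.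

Lemma measurable_mulgr g : measurable_fun [set: G] (fun h : G => (h * g)%g : G).
Proof. by apply: borel_measurable_fun => A oA; apply: borel_open; exact: mulgr_open. Qed.

Lemma measurable_mulgr_pre g A : measurable (A : set G) ->
  measurable ([set h | A (h * g)%g] : set G).
Proof. by move=> mA; rewrite -[X in measurable X]setTI; exact: measurable_mulgr. Qed.

(** All lists start with [o], so that a non-empty cylinder lies in one coset of the stabilizer of
    [o], which has finite measure in the applications. Lists of unequal lengths give the empty set,
    which is wanted for closure under intersection. *)
Definition cyl_system (o : X) : set (set G) :=
  [set A | exists st : seq X * seq X, A = seq_cyl (o :: st.1, st.2)].

Lemma seq_cyl0 s : seq_cyl (s, [::]) = if s is [::] then setT else set0 :> set (aut X).
Proof. by case: s => [|x s]; apply/seteqP; split. Qed.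

Lemma cyl_systemI o : setI_closed (cyl_system o).
Proof.
move=> _ _ [[s t] ->] [[s' t'] ->].
have [st|st] := eqVneq (size t) (size s).+1; last first.
  exists (s, t); apply/seteqP; split=> [h []//|h /= hs].
  by move: st; have := congr1 size hs; rewrite /= size_map => ->; rewrite eqxx.
exists (s ++ o :: s', t ++ t'); apply/seteqP; split=> h; rewrite /seq_cyl/= map_cat/=.
  by move=> [<- <-].
move=> /eqP; rewrite -cat_cons eqseq_cat/= ?size_map ?st//.
by move=> /andP[/eqP <- /eqP <-].
Qed.

(** There are only countably many cylinders, because there are countably many vertices; an open set
    is the union of those that it contains. *)
Lemma borel_cyl o : @measurable _ G = <<s cyl_system o >>.
Proof.
apply/seteqP; split; last first.
  apply: smallest_sub; first exact: sigma_algebra_measurable.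
  by move=> _ [st ->]; apply: borel_open; exact: (@seq_cyl_open X).
apply: smallest_sub; first exact: smallest_sigma_algebra.
move=> A /open_autP oA; pose T := g_sigma_algebraType (cyl_system o).
pose F (st : seq X * seq X) : set T :=
  if pselect (seq_cyl (o :: st.1, st.2) `<=` A) then seq_cyl (o :: st.1, st.2) else set0.
have -> : A = \bigcup_st F st.
  apply/seteqP; split=> [g /oA[S SA]|g [st _]]; last first.
    by rewrite /F; case: pselect => // sub /sub.
  exists (S, map g (o :: S)) => //; rewrite /F; case: pselect => // -[] h /= [_ /eq_in_map hg].
  exact: SA.
apply: (@countable_bigcupT_measurable _ T) => [|st]; first exact: countable_seq_vertices.
rewrite /F; case: pselect => sub /=; last exact: measurable0.
by apply: sub_sigma_algebra; exists st.
Qed.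

Lemma map_autV (h0 h : aut X) (s : seq X) :
  (map (h0^-1 * h)%g s == s) = (map h s == map h0 s).
Proof.
by elim: s => //= x s IHs; rewrite !eqseq_cons IHs (can2_eq (aut_invK h0) (aut_funK h0)).
Qed.

(* P will be either the vertex stabilizer of o or the whole group. *)
Definition invariant_under o (P : set (aut X)) m :=
  [/\ forall k : aut X, k o = o -> P k,
      forall h0, P h0 ->
        forall A, measurable (A : set G) -> m [set h | A (h0^-1 * h)%g] = m A &
      forall h0, ~ P h0 -> m (cyl o (h0 o)) = 0%E].

(** The left hand set is the translate by [h0] of the pointwise stabilizer of [o :: s]. *)
Lemma seq_cyl_measure o P m (h0 : aut X) s : invariant_under o P m -> P h0 ->
  m (seq_cyl (o :: s, map h0 (o :: s))) = m (seq_cyl (o :: s, o :: s)).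
Proof.
move=> [_ mI _] /mI {}mI.
rewrite -[RHS]mI; last exact: measurable_seq_cyl.
have E h : map (h0^-1 * h)%g (o :: s) = o :: s <-> map h (o :: s) = map h0 (o :: s).
  by split=> /eqP; [rewrite map_autV|rewrite -map_autV] => /eqP.
by congr (m _); apply/predeqP => h; apply: iff_sym; exact: E.
Qed.

Definition stab_images o s : set (seq X) :=
  [set map k s | k in [set k : aut X | k o = o]].

Lemma stab_images_finite o s : finite_set (stab_images o s).
Proof.
elim: s => [|x s IHs].
  by apply: (@sub_finite_set _ _ [set [::]]) => // _ [k _ <-].
have bx : finite_set [set k x | k in [set k : aut X | k o = o]].
  apply: (@bounded_move _ conn locfin o).
  by apply: (@sub_finite_set _ _ [set o]) => // _ [k /= ko <-].
apply: (sub_finite_set _ (finite_image (fun u => u.1 :: u.2) (finite_setX bx IHs))).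
by move=> _ [k ko <-]; exists (k x, map k s) => //; split; exists k.
Qed.

(** The stabilizer of [o] splits into cosets of the pointwise stabilizer of [o :: s], one for each
    image of the list. Their number does not depend on [m]. *)
Lemma stab_measureE o P m s : invariant_under o P m ->
  m (cyl o o) = (\sum_(t \in stab_images o (o :: s)) m (seq_cyl (o :: s, o :: s)))%E.
Proof.
move=> qm.
have -> : cyl o o = \bigcup_(t in stab_images o (o :: s)) seq_cyl (o :: s, t).
  apply/seteqP; split=> [k ko|h [_ [k ko <-]] []]; last by rewrite /cyl/= ko.
  by exists (map k (o :: s)) => //; exists k.
rewrite measure_fin_bigcup.
- apply: eq_fsbigr => _ /set_mem [k ko <-].
  by apply: (seq_cyl_measure s qm); case: qm => KP _ _; exact: KP.
- exact: stab_images_finite.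
- by move=> t t' _ _ [h [ht ht']]; exact: etrans (esym ht) ht'.
- by move=> t _; apply: borel_open; exact: (@seq_cyl_open X).
Qed.

(** The mass of a pointwise stabilizer is the mass at [o] divided by an index common to both
    measures. Translation by [P] settles the other cylinders, apart from null sets, and the
    cylinders form a generating system closed under intersection. *)
Lemma invariant_measure_unique o P m1 m2 :
  invariant_under o P m1 -> invariant_under o P m2 ->
  m1 (cyl o o) = m2 (cyl o o) -> (m1 (cyl o o) < +oo)%E ->
  forall A, measurable (A : set G) -> m1 A = m2 A.
Proof.
move=> q1 q2 mo moo.
have cylE x y : cyl x y = seq_cyl ([:: x], [:: y]).
  by apply/seteqP; split=> h; rewrite /cyl /seq_cyl/=; [move=> ->|case].
have Ufin m s : (m (cyl o o) < +oo)%E -> m (seq_cyl (o :: s, o :: s)) \is a fin_num.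
  move=> mfin; rewrite ge0_fin_numE//; apply: le_lt_trans mfin.
  apply: le_measure; last by move=> h [].
  - by apply: mem_set; exact: measurable_seq_cyl.
  - by apply: mem_set; exact: measurable_cyl.
have eqU s : m1 (seq_cyl (o :: s, o :: s)) = m2 (seq_cyl (o :: s, o :: s)).
  have f1 := Ufin m1 s moo.
  have f2 : m2 (seq_cyl (o :: s, o :: s)) \is a fin_num by apply: Ufin; rewrite -?mo.
  move: mo; rewrite (stab_measureE s q1) (stab_measureE s q2).
  rewrite -(fineK f1) -(fineK f2).
  rewrite !fsbig_finite; try exact: stab_images_finite.
  rewrite !sumEFin => -[]; rewrite !big_const_seq !count_predT !iter_addr_0.
  have : (0 < size (fset_set (stab_images o (o :: s))))%N.
    have : (o :: s) \in fset_set (stab_images o (o :: s)).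
      rewrite in_fset_set; last exact: stab_images_finite.
      by apply/mem_set; exists 1%g => //; rewrite /= map_id.
    by case: (fset_set _) => -[].
  by case: (size _) => // n _ /eqP; rewrite eqr_pMn2r// => /eqP ->.
have eqC s t : m1 (seq_cyl (o :: s, t)) = m2 (seq_cyl (o :: s, t)).
  have [[h0 <-]|nt] := pselect (exists h0 : aut X, map h0 (o :: s) = t); last first.
    have -> : seq_cyl (o :: s, t) = set0; last by rewrite !measure0.
    by apply/seteqP; split=> // h ht; apply: nt; exists h.
  have [Ph|nPh] := pselect (P h0).
    by rewrite (seq_cyl_measure s q1 Ph) (seq_cyl_measure s q2 Ph).
  have z m : invariant_under o P m -> m (seq_cyl (o :: s, map h0 (o :: s))) = 0%E.
    move=> [_ _ /(_ _ nPh) m0]; apply: (@subset_measure0 _ _ _ m _ (cyl o (h0 o))) => //.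
    - exact: measurable_seq_cyl.
    - exact: measurable_cyl.
    - by move=> h [].
  by rewrite !z.
have /countable_injP [f] := countable_vertices conn locfin.
move=> /in2TT finj.
(* A countable cover by members of the system with finite measure: through the injection [f], each
   number stands for at most one vertex to which [o] is moved. *)
pose g n : set G := [set h : aut X | f (h o) = n].
have gE n : exists t, g n = seq_cyl ([:: o], t).
  have [[y yn]|ny] := pselect (exists y, f y = n).
    exists [:: y]; rewrite -cylE; apply/seteqP; split=> h /=; last by rewrite /g/= => ->.
    by rewrite /g/= -yn => /finj.
  exists [::]; rewrite seq_cyl0; apply/seteqP; split=> // h hn; apply: ny.
  by exists (h o).
apply: (measure_unique (cyl_system o) g (borel_cyl o) (@cyl_systemI o)).
- by move=> n; have [t ->] := gE n; exists ([::], t).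
- by apply/seteqP; split=> // h _; exists (f (h o)).
- by move=> _ [[s t] ->]; exact: eqC.
move=> n; have [[h0 h0n]|nh] := pselect (exists h : aut X, f (h o) = n); last first.
  have -> : g n = set0 by apply/seteqP; split=> // h hn; apply: nh; exists h.
  by rewrite measure0.
have -> : g n = seq_cyl ([:: o], map h0 [:: o]).
  by rewrite /= -cylE; apply/seteqP; split=> h; rewrite /g /= -h0n; [move=> /finj|move=> ->].
have [Ph|nPh] := pselect (P h0).
  by rewrite (seq_cyl_measure [::] q1 Ph) -cylE.
by case: q1 => _ _ /(_ _ nPh); rewrite /= -cylE => ->.
Qed.
End AutBorel.

(** * Unimodularity *)

Section HaarTree.
Variables (R : realType) (X : sgraph) (q : nat).
Hypothesis tree : regular_tree q.+1 X.
Variable mu : {measure set (borel (aut X)) -> \bar R}.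
Hypothesis haar : haar_measure mu.
Local Notation G := (borel (aut X)).
Implicit Types (x y o : X) (g h : aut X) (A B : set (aut X)).

Lemma tree_conn : connected_graph X. Proof. by case: tree. Qed.

Lemma tree_locfin x : finite_set [set y | adj x y].
Proof. by have [_ _ reg] := tree; apply/finite_setP; exists q.+1. Qed.

Let conn := tree_conn.
Let locfin := tree_locfin.

Lemma haar_mulgl h0 A : measurable (A : set G) -> mu [set h | A (h0^-1 * h)%g] = mu A.
Proof.
have [hl _ _] := haar; move=> mA; rewrite -[RHS](hl h0 _ mA); congr (mu _).
apply/seteqP; split=> [h /= Ah|_ [h Ah <-] /=]; last by rewrite mulKg.
by exists (h0^-1 * h)%g => //; rewrite mulVKg.
Qed.

Lemma haar_invariant o : invariant_under o setT mu.
Proof. by split=> // [h0 _ A mA|h0 []//]; exact: haar_mulgl. Qed.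

Lemma haar_stab_lty x : (mu (cyl x x) < +oo)%E.
Proof.
have [_ hc _] := haar; apply: hc.
by apply: (@compact_sub_cyl _ conn locfin x [set x]); exact: finite_set1.
Qed.

(** Otherwise [mu] would agree with the zero measure on the stabilizer and, by uniqueness,
    everywhere. *)
Lemma haar_stab_neq0 x : mu (cyl x x) != 0%E.
Proof.
have [_ _ hT] := haar; apply: contra_neq hT => m0.
have -> : mu setT = (mzero : {measure set G -> \bar R}) setT; last by [].
have i0 : invariant_under x setT (mzero : {measure set G -> \bar R}).
  by split=> // h0 [].
apply: (invariant_measure_unique conn locfin (haar_invariant x) i0) => //.
exact: haar_stab_lty.
Qed.

Lemma haar_cyl x y : mu (cyl x y) = mu (cyl x x).
Proof.
have [g <-] := vertex_transitive tree x y.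
rewrite -(haar_mulgl g (measurable_cyl x x)); congr (mu _).
apply/seteqP; split=> h; rewrite /cyl/=; first by move=> ->; rewrite aut_funK.
by move=> e; rewrite -{2}e aut_invK.
Qed.

(** The stabilizer of [x] moves [y] to every neighbor of [x], and the elements moving it to a given
    one form a translate of the stabilizer of both vertices. The resulting value is symmetric in [x]
    and [y], as all vertices have the same degree. *)
Lemma haar_stab_adj x y : adj x y ->
  mu (cyl x x) = (\sum_(f <- outs x) mu (cyl x x `&` cyl y y))%E.
Proof.
have [_ _ reg] := tree.
move=> /edge_of [e [ex ey]].
have E : cyl x x = \bigcup_(f in [set f | src f = x]) (cyl x x `&` cyl y (tgt f)).
  apply/seteqP; split=> [h hx|h [f _ []//]].
  exists (eact h e); first by rewrite /= src_eact ex.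
  by split=> //; rewrite /cyl/= tgt_eact ey.
rewrite [X in mu X = _]E measure_fin_bigcup.
- rewrite fsbig_finite; last exact: (outs_finite reg).
  rewrite [LHS]big_seq [RHS]big_seq; apply: eq_bigr => f.
  rewrite (mem_outs reg) => /eqP fx.
  have [g ge] := edge_transitive tree e f.
  have gx : g x = x by rewrite -{1}ex -src_eact ge.
  have gy : g y = tgt f by rewrite -{1}ey -tgt_eact ge.
  have mI : measurable (cyl x x `&` cyl y y : set G).
    by apply: measurableI; exact: measurable_cyl.
  rewrite -[RHS](haar_mulgl g mI).
  congr (mu _); rewrite -gy; apply/seteqP; split=> h; rewrite /cyl/= => -[hx hy].
    by rewrite hx hy -{1}gx !aut_funK.
  by rewrite -{2}gx -{2}hx -{2}hy !aut_invK.
- exact: (outs_finite reg).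
- move=> f f' /= fx f'x [h [[_ hf] [_ hf']]]; apply: edge_inj; first by rewrite fx.
  by rewrite -hf -hf'.
- by move=> f _; apply: measurableI; exact: measurable_cyl.
Qed.

Lemma haar_stab_const x y : mu (cyl x x) = mu (cyl y y).
Proof.
have [_ _ reg] := tree.
have [p [pp <-]] := conn x y; elim: p x pp => //= z p IHp x /andP[xz /IHp <-].
rewrite (haar_stab_adj xz); have := xz; rewrite adj_sym => /haar_stab_adj ->.
rewrite setIC !big_const_seq !count_predT !(size_outs reg).
by [].
Qed.

(** The right translate of [mu] by [g] is still left invariant. It gives the stabilizer of [x] the
    mass of [cyl (g x) x], a translate of the stabilizer of [g x], and this mass is the same by
    [haar_stab_const]; uniqueness applies. *)
Lemma haar_mulgr x g A : measurable (A : set G) -> mu [set h | A (h * g)%g] = mu A.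
Proof.
move=> mA; have [m mE] := pushforward_measure mu (measurable_mulgr g).
have mi : invariant_under x setT m.
  split=> // [h0 _ B mB|h0 []//]; rewrite !mE -(haar_mulgl h0 (measurable_mulgr_pre g mB)).
  by congr (mu _); apply/predeqP => h /=; rewrite mulgA.
have mK : m (cyl x x) = mu (cyl x x).
  rewrite mE -[_ @^-1` _]/(cyl (g x) x) haar_cyl; exact: haar_stab_const.
rewrite -[LHS]mE; apply: (invariant_measure_unique conn locfin mi (haar_invariant x)) => //.
by rewrite mK haar_stab_lty.
Qed.

End HaarTree.

(** * Comparison of the Haar measures on the group and on the vertex stabilizer *)

Section HaarStab.
Variables (R : realType) (X : sgraph) (q : nat) (o : X).
Hypothesis tree : regular_tree q.+1 X.
Variable mu : {measure set (borel (aut X)) -> \bar R}.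
Variable nu : {measure set (borel (stab o)) -> \bar R}.
Hypotheses (haar : haar_measure mu) (haarK : haar_measure nu) (nu1 : nu setT = 1%E).
Local Notation G := (borel (aut X)).

Lemma measurable_stab_val :
  measurable_fun setT (@stab_val X o : borel (stab o) -> G).
Proof.
apply: borel_measurable_fun => A oA; apply: sub_sigma_algebra.
by have /continuousP := @initial_continuous _ _ (@stab_val X o); exact.
Qed.

(** The restriction of [mu] and the scaled image of [nu] are both invariant under the stabilizer of
    [o] and vanish off it, so uniqueness applies with this stabilizer as [P]. The normalization of
    [nu] fixes the factor. *)
Lemma haar_stab (A : set (aut X)) : measurable (A : set G) -> A `<=` cyl o o ->
  mu A = ((fine (mu (cyl o o)))%:E * nu (@stab_val X o @^-1` A))%E.
Proof.
move=> mA AK.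
have fK : mu (cyl o o) \is a fin_num by rewrite ge0_fin_numE// (haar_stab_lty tree haar).
have r0 : 0 <= fine (mu (cyl o o)) by exact: fine_ge0.
have [m1 m1E] := pushforward_measure nu measurable_stab_val.
pose m2 : {measure set G -> \bar R} := mscale (NngNum r0) m1.
pose m3 : {measure set G -> \bar R} := mrestr mu (measurable_cyl o o).
have -> : mu A = m3 A by rewrite /m3/= /mrestr setIidl.
have -> : ((fine (mu (cyl o o)))%:E * nu (@stab_val X o @^-1` A))%E = m2 A.
  by rewrite /m2/= /mscale/= m1E.
have i3 : invariant_under o [set h : aut X | h o = o] m3.
  split=> //.
  - move=> h0 /= h0o B mB; rewrite /m3/= /mrestr.
    have mI : measurable (B `&` cyl o o : set G).
      by apply: measurableI => //; exact: measurable_cyl.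
    rewrite -[RHS](haar_mulgl haar h0 mI).
    congr (mu _); apply/seteqP; split=> h [/= Bh ho]; split=> //.
      by rewrite /cyl/= ho -{1}h0o aut_funK.
    by have := congr1 h0 ho; rewrite /= aut_invK h0o.
  - move=> h0 nh0; rewrite /m3/= /mrestr.
    have -> : cyl o (h0 o) `&` cyl o o = set0; last exact: measure0.
    by apply/seteqP; split=> // h []; rewrite /cyl/= => -> /nh0.
have i2 : invariant_under o [set h : aut X | h o = o] m2.
  split=> //.
  - move=> h0 /= h0o B mB; rewrite /m2/= /mscale/=; congr (_ * _)%E; rewrite !m1E.
    have [hl _ _] := haarK.
    have h0P : h0 o == o by apply/eqP.
    pose k0 := Stab h0P.
    rewrite -[RHS](hl k0).
      congr (nu _); apply/seteqP; split=> [k /= Bk|_ [k Bk <-] /=].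
        by exists (k0^-1 * k)%g => //; rewrite mulVKg.
      by rewrite /= mulKg.
    by rewrite -[X in measurable X]setTI; exact: measurable_stab_val.
  - move=> h0 nh0; rewrite /m2/= /mscale/= m1E.
    have -> : @stab_val X o @^-1` cyl o (h0 o) = set0; last by rewrite measure0 mule0.
    by apply/seteqP; split=> // k; rewrite /cyl/= (eqP (stabP k)) => /esym/nh0.
apply: (invariant_measure_unique (tree_conn tree) (tree_locfin tree) i3 i2) => //.
  rewrite /m2/= /m3/= /mscale/= /mrestr setIid m1E.
  have -> : @stab_val X o @^-1` cyl o o = setT.
    by apply/seteqP; split=> // k _; exact/eqP/stabP.
  by rewrite nu1 mule1 fineK.
by rewrite /m3/= /mrestr setIid (haar_stab_lty tree haar).
Qed.
End HaarStab.

(** * Integrals of compactly supported functions *)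

Section ComplexIntegral.
Variables (R : realType) (T : topologicalGroupType).
Variable mu : {measure set (borel T) -> \bar R}.
Local Notation C := (Cplx R).
Implicit Types f g : T -> C.

Definition cintegrable f :=
  mu.-integrable [set: borel T] (fun x => (complex.Re (f x))%:E) /\
  mu.-integrable [set: borel T] (fun x => (complex.Im (f x))%:E).

Lemma complex_ReD (z w : C) : complex.Re (z + w) = complex.Re z + complex.Re w.
Proof. by case: z w => [a b] [c d]. Qed.

Lemma complex_ImD (z w : C) : complex.Im (z + w) = complex.Im z + complex.Im w.
Proof. by case: z w => [a b] [c d]. Qed.

Lemma cintegrable0 : cintegrable (fun=> 0).
Proof. split; exact: (integrable0 mu setT). Qed.

Lemma cintegrableD f g : cintegrable f -> cintegrable g ->
  cintegrable (fun x => f x + g x).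
Proof.
move=> [fr fi] [gr gi]; split.
- apply: (eq_integrable measurableT _ _ _ (integrableD measurableT fr gr)) => x _ /=.
  by rewrite complex_ReD.
- apply: (eq_integrable measurableT _ _ _ (integrableD measurableT fi gi)) => x _ /=.
  by rewrite complex_ImD.
Qed.

Lemma complex_ReM (z w : C) :
  complex.Re (z * w) = complex.Re z * complex.Re w - complex.Im z * complex.Im w.
Proof. by case: z w => [a b] [c d]. Qed.

Lemma complex_ImM (z w : C) :
  complex.Im (z * w) = complex.Re z * complex.Im w + complex.Im z * complex.Re w.
Proof. by case: z w => [a b] [c d]. Qed.

Let integrableZr r (u : T -> R) : mu.-integrable [set: borel T] (fun x => (u x)%:E) ->
  mu.-integrable [set: borel T] (fun x => (r * u x)%:E).
Proof. by move=> iu; exact: (integrableZl measurableT r iu). Qed.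

Lemma cintegrableZ c f : cintegrable f -> cintegrable (fun x => c * f x).
Proof.
move=> [fr fi]; split.
- apply: (eq_integrable measurableT _ _ _ (integrableB measurableT
    (integrableZr (complex.Re c) fr) (integrableZr (complex.Im c) fi))) => x _ /=.
  by rewrite complex_ReM.
- apply: (eq_integrable measurableT _ _ _ (integrableD measurableT
    (integrableZr (complex.Re c) fi) (integrableZr (complex.Im c) fr))) => x _ /=.
  by rewrite complex_ImM.
Qed.

Lemma cintegralD f g : cintegrable f -> cintegrable g ->
  cintegral mu (fun x => f x + g x) = cintegral mu f + cintegral mu g.
Proof.
move=> [fr fi] [gr gi]; rewrite /cintegral.
under eq_Rintegral do rewrite complex_ReD.
rewrite RintegralD//; under [X in Complex _ X]eq_Rintegral do rewrite complex_ImD.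
by rewrite RintegralD.
Qed.

Lemma cintegralZ c f : cintegrable f ->
  cintegral mu (fun x => c * f x) = c * cintegral mu f.
Proof.
move=> [fr fi]; rewrite /cintegral.
under eq_Rintegral do rewrite complex_ReM.
under [X in Complex _ X]eq_Rintegral do rewrite complex_ImM.
rewrite RintegralB//; [|exact: integrableZr|exact: integrableZr].
rewrite RintegralD//; [|exact: integrableZr|exact: integrableZr].
by rewrite !RintegralZl//; case: c.
Qed.

Lemma cintegral0 : cintegral mu (fun=> 0) = 0.
Proof. by rewrite /cintegral /= !Rintegral_cst// mul0r. Qed.

Lemma eq_cintegral f g : f =1 g -> cintegral mu f = cintegral mu g.
Proof. by move=> /funext ->. Qed.

Lemma cintegrable_sum (I : Type) (s : seq I) (F : I -> T -> C) :
  (forall i, cintegrable (F i)) -> cintegrable (fun x => \sum_(i <- s) F i x).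
Proof.
move=> iF; elim: s => [|i s IHs].
  by under eq_fun do rewrite big_nil; exact: cintegrable0.
by under eq_fun do rewrite big_cons; exact: cintegrableD.
Qed.

Lemma cintegral_sum (I : Type) (s : seq I) (F : I -> T -> C) :
  (forall i, cintegrable (F i)) ->
  cintegral mu (fun x => \sum_(i <- s) F i x) = \sum_(i <- s) cintegral mu (F i).
Proof.
move=> iF; elim: s => [|i s IHs].
  by under eq_fun do rewrite big_nil; rewrite big_nil cintegral0.
under eq_fun do rewrite big_cons.
by rewrite big_cons cintegralD ?IHs//; exact: cintegrable_sum.
Qed.

End ComplexIntegral.

Section AutIntegral.
Variables (R : realType) (X : sgraph) (q : nat) (o : X).
Hypothesis tree : regular_tree q.+1 X.
Variable mu : {measure set (borel (aut X)) -> \bar R}.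
Hypothesis haar : haar_measure mu.
Local Notation G := (borel (aut X)).
Local Notation C := (Cplx R).
Implicit Types (f : aut X -> C) (u : aut X -> R) (g h : aut X).

Definition rcont u := forall g (e : R), 0 < e ->
  exists S : seq X, forall h, {in S, h =1 g} -> `|u g - u h| < e.

Lemma cplx_real_lt (z : C) (e : R) : `|z| < e%:C%C ->
  `|complex.Re z| < e /\ `|complex.Im z| < e.
Proof.
rewrite normc_def ltcR => ze; split; apply: le_lt_trans ze; rewrite -sqrtr_sqr.
  by rewrite ler_wsqrtr// lerDl sqr_ge0.
by rewrite ler_wsqrtr// lerDr sqr_ge0.
Qed.

Lemma cplx_norm_le (z : C) : `|z| <= (`|complex.Re z| + `|complex.Im z|)%:C%C.
Proof.
rewrite normc_def lecR -[leRHS]ger0_norm ?addr_ge0//.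
rewrite -(sqrtr_sqr (`|complex.Re z| + `|complex.Im z|)) ler_wsqrtr//.
by rewrite sqrrD !real_normK ?num_real// lerD2r lerDl mulrn_wge0// mulr_ge0.
Qed.

Lemma continuous_rcont f : continuous f <->
  rcont (fun g => complex.Re (f g)) /\ rcont (fun g => complex.Im (f g)).
Proof.
split=> [cf|[cr ci] g]; last first.
  apply/(@cvgrPdist_lt _ _ _ (nbhs g) (nbhs_filter g) f (f g)) => /= e e0.
  have eR : e = (complex.Re e)%:C%C by move: e0; case: e => a b; rewrite ltcE/= => /andP[/eqP ->].
  have e2 : 0 < complex.Re e / 2 by rewrite divr_gt0// -ltcR -eR.
  have [S1 h1] := cr g _ e2; have [S2 h2] := ci g _ e2.
  apply/aut_nbhs; exists (S1 ++ S2) => h hS; apply: le_lt_trans (cplx_norm_le _) _.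
  rewrite eR ltcR [complex.Re e]splitr.
  have /h1 : {in S1, h =1 g} by move=> x xS; apply: hS; rewrite mem_cat xS.
  have /h2 : {in S2, h =1 g} by move=> x xS; apply: hS; rewrite mem_cat xS orbT.
  by case: (f g) (f h) => [a b] [c d] /= ? ?; apply: ltrD.
have key g (e : R) : 0 < e -> exists S : seq X, forall h, {in S, h =1 g} ->
    `|f g - f h| < e%:C%C.
  move=> e0.
  have /(@cvgrPdist_lt _ _ _ (nbhs g) (nbhs_filter g) f (f g))/(_ e%:C%C) := cf g.
  by rewrite ltcR => /(_ e0) /aut_nbhs.
split=> g e e0; have [S Sh] := key g e e0; exists S => h /Sh /cplx_real_lt[].
  by case: (f g) (f h) => [a b] [c d].
by case: (f g) (f h) => [a b] [c d].
Qed.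

Lemma rcont_open_gt u (r : R) : rcont u -> open [set g | r < u g].
Proof.
move=> cu; apply/open_autP => g /= ru.
have [|S Sh] := cu g (u g - r); first by rewrite subr_gt0.
by exists S => h /Sh; rewrite ltr_distlC => /andP[+ _]; rewrite subKr.
Qed.

Lemma rcont_measurable u : rcont u -> measurable_fun [set: G] (u : G -> R).
Proof.
move=> cu; apply: (measurability _ (RGenOInfty.measurableE R)).
move=> _ [_ [r ->] <-]; rewrite setTI; apply: borel_open.
have -> : (u @^-1` `]r, +oo[) = [set g | r < u g]; last exact: rcont_open_gt.
by apply/seteqP; split=> g /=; rewrite in_itv/= andbT.
Qed.

Lemma rcont_bounded u : rcont u -> bounded_at o [set g | u g != 0] ->
  exists M : R, forall g, `|u g| <= M.
Proof.
move=> cu /(compact_closureE (tree_conn tree) (tree_locfin tree)).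
rewrite compact_cover => /(_ nat setT (fun n => [set g | `|u g| < n%:R])) [|g _|D _ AD].
- move=> n _; apply/open_autP => g /= ru.
  have [|S Sh] := cu g (n%:R - `|u g|); first by rewrite subr_gt0.
  exists S => h /Sh; rewrite ltrBrDl; apply: le_lt_trans.
  by rewrite -[X in `|X| <= _](subKr (u g)) (le_trans (ler_normB _ _)).
- by exists (Num.truncn `|u g|).+1 => //=; rewrite truncnS_gt.
(* The sum over the finite subcover dominates each of its bounds. *)
exists (\sum_(n <- D) n%:R) => g.
have [->|ug] := eqVneq (u g) 0; first by rewrite normr0 sumr_ge0.
have Ag : closure [set g | u g != 0] g by apply: subset_closure.
have [n nD /= /ltW] := AD g Ag; move=> /le_trans; apply.
by rewrite (big_fsetD1 n)//= lerDl sumr_ge0.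
Qed.

Definition cc f := continuous f /\ bounded_at o [set g | f g != 0].

Lemma measurable_bounded_at (D : set X) : measurable ([set g | D (g o)] : set G).
Proof. by apply: borel_open; exact: (@open_sub_cyl X D o). Qed.

Lemma bounded_measure_lty (D : set X) : finite_set D ->
  (mu [set g | D (g o)] < +oo)%E.
Proof.
move=> fD; have [_ hc _] := haar; apply: hc.
exact: (compact_sub_cyl (tree_conn tree) (tree_locfin tree)).
Qed.

Lemma bounded_integrable (u : G -> R) (M : R) (A : set (aut X)) :
  measurable_fun [set: G] u -> (forall g, `|u g| <= M) ->
  bounded_at o A -> (forall g, u g != 0 -> A g) ->
  mu.-integrable [set: G] (fun g => (u g)%:E).
Proof.
move=> mu_ uM bA uA; pose D : set G := [set g | [set g o | g in A] (g o)].
have mD : measurable D by exact: measurable_bounded_at.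
have -> : (fun g => (u g)%:E) = (fun g => (u g)%:E) \_ D.
  apply/funext => g; rewrite /patch; case: ifPn => // /negP gD.
  have [->//|ug] := eqVneq (u g) 0.
  by exfalso; apply: gD; apply/mem_set; exists g => //; exact: uA.
rewrite -integrable_mkcond//.
apply: measurable_bounded_integrable => //.
- exact: bounded_measure_lty.
- exact: measurable_funS mu_.
- exists M; split; first exact: num_real.
  by move=> M' MM' g _ /=; apply: le_trans (uM g) (ltW MM').
Qed.

Lemma cc_cintegrable f : cc f -> cintegrable mu f.
Proof.
move=> [/continuous_rcont[cr ci] bf].
have ReA g : complex.Re (f g) != 0 -> f g != 0 by apply: contra_neq => ->.
have ImA g : complex.Im (f g) != 0 -> f g != 0 by apply: contra_neq => ->.
split.
- have [|M MP] := rcont_bounded cr; first by apply: bounded_atS bf => g /ReA.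
  exact: (bounded_integrable (rcont_measurable cr) MP bf).
- have [|M MP] := rcont_bounded ci; first by apply: bounded_atS bf => g /ImA.
  exact: (bounded_integrable (rcont_measurable ci) MP bf).
Qed.

End AutIntegral.

Section CompactlySupported.
Variables (R : realType) (X : sgraph) (q : nat) (o : X).
Hypothesis tree : regular_tree q.+1 X.
Local Notation C := (Cplx R).
Local Notation cc := (@cc R X o).
Implicit Types (f : aut X -> C) (u : aut X -> R) (g h : aut X).

Let conn := tree_conn tree.
Let locfin := tree_locfin tree.

Definition rcc u := rcont u /\ bounded_at o [set g | u g != 0].

Lemma cc_rcc f : cc f <->
  rcc (fun g => complex.Re (f g)) /\ rcc (fun g => complex.Im (f g)).
Proof.
split=> [[/continuous_rcont[cr ci] bf]|[[cr br] [ci bi]]].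
  split; split=> //; apply: bounded_atS bf => g /=; by apply: contra_neq => ->.
split; first exact/continuous_rcont.
apply: (@bounded_atS _ o _ ([set g | complex.Re (f g) != 0] `|` [set g | complex.Im (f g) != 0])).
  move=> g /= f0; have [r0|] := eqVneq (complex.Re (f g)) 0; last by left.
  right; apply: contra_neq f0 => i0.
  by move: r0 i0; case: (f g) => a b /= -> ->.
apply: (@sub_finite_set _ _ ([set g o | g in [set g | complex.Re (f g) != 0]] `|`
    [set g o | g in [set g | complex.Im (f g) != 0]])); last by rewrite finite_setU.
by move=> _ [g [] gf <-]; [left|right]; exists g.
Qed.

Lemma loc_const_continuous f :
  (forall g, exists S : seq X, forall h, {in S, h =1 g} -> f h = f g) -> continuous f.
Proof.
move=> fl; apply/continuous_rcont; split=> g e e0; have [S Sf] := fl g;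
  by exists S => h /Sf ->; rewrite subrr normr0.
Qed.

Lemma cc_sub f1 f2 f : cc f1 -> cc f2 -> continuous f ->
  (forall g, f g != 0 -> f1 g != 0 \/ f2 g != 0) -> cc f.
Proof.
move=> [_ b1] [_ b2] cf f12; split=> //.
apply: (@sub_finite_set _ _ ([set g o | g in [set g | f1 g != 0]] `|`
    [set g o | g in [set g | f2 g != 0]])); last by rewrite finite_setU.
by move=> _ [g /f12[] gf <-]; [left|right]; exists g.
Qed.

Lemma cc0 : cc (fun=> 0).
Proof.
split; first by apply: loc_const_continuous => g; exists [::].
by apply: (@sub_finite_set _ _ set0) => // y [g]; rewrite /= eqxx.
Qed.

Lemma ccD f1 f2 : cc f1 -> cc f2 -> cc (fun g => f1 g + f2 g).
Proof.
move=> cc1 cc2; apply: (cc_sub cc1 cc2).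
  have [[c1 _] [c2 _]] := (cc1, cc2).
  move=> g.
  exact: (continuousD (c1 g) (c2 g)).
move=> g; have [->|] := eqVneq (f1 g) 0; last by left.
by rewrite add0r; right.
Qed.

Lemma ccM f1 f : cc f1 -> continuous f -> cc (fun g => f1 g * f g).
Proof.
move=> cc1 cf; apply: (cc_sub cc1 cc0).
  by have [c1 _] := cc1; move=> g; exact: (continuousM (c1 g) (cf g)).
by move=> g; rewrite mulf_eq0 negb_or => /andP[]; left.
Qed.

Lemma ccZ c f : cc f -> cc (fun g => c * f g).
Proof.
move=> ccf; under eq_fun do rewrite mulrC.
by apply: ccM => //; apply: loc_const_continuous => g; exists [::].
Qed.

Lemma cc_sum (I : Type) (s : seq I) (F : I -> aut X -> C) :
  (forall i, cc (F i)) -> cc (fun g => \sum_(i <- s) F i g).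
Proof.
move=> cF; elim: s => [|i s IHs].
  by under eq_fun do rewrite big_nil; exact: cc0.
by under eq_fun do rewrite big_cons; exact: ccD.
Qed.

Lemma continuous_mulgr f k : continuous f -> continuous (fun h => f (h * k)%g).
Proof.
move=> /continuousP cf; apply/continuousP => A oA.
by apply: (@mulgr_open X k (f @^-1` A)); exact: cf.
Qed.

Lemma continuous_mulgl f k : continuous f -> continuous (fun h => f (k * h)%g).
Proof.
move=> /continuousP cf; apply/continuousP => A oA.
by apply: (@mulgl_open X k (f @^-1` A)); exact: cf.
Qed.

Lemma continuous_invg f : continuous f -> continuous (fun h => f (h^-1)%g).
Proof.
move=> /continuousP cf; apply/continuousP => A oA.
by apply: (@invg_open X (f @^-1` A)); exact: cf.
Qed.

Lemma cc_mulgr f k : cc f -> cc (fun h => f (h * k)%g).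
Proof.
move=> [cf bf]; split; first exact: continuous_mulgr.
apply: (@bounded_move _ conn locfin (k o)).
apply: sub_finite_set bf => _ [h fh <-]; exists (h * k)%g => //.
Qed.

Lemma cc_mulgl f k : cc f -> cc (fun h => f (k * h)%g).
Proof.
move=> [cf bf]; split; first exact: continuous_mulgl.
apply: (sub_finite_set _ (finite_image (aut_inv k) bf)) => _ [h fh <-].
by exists (k (h o)); rewrite ?aut_funK//; exists (k * h)%g.
Qed.

Lemma cc_bounded f : cc f -> exists2 M : R, 0 <= M & forall g, `|f g| <= M%:C%C.
Proof.
move=> /cc_rcc[[cr br] [ci bi]].
have [M1 h1] := rcont_bounded tree cr br; have [M2 h2] := rcont_bounded tree ci bi.
exists (M1 + M2).
  by apply: addr_ge0; [apply: le_trans (h1 1%g)|apply: le_trans (h2 1%g)].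
move=> g; apply: le_trans (cplx_norm_le _) _; rewrite lecR; exact: lerD.
Qed.

(** On the closure of the support finitely many neighborhoods suffice: if [y] agrees with [g] on
    [s g] and [k] fixes the images of [s g] under [g], then k y agrees with [g] there as well. If
    only k y lies in the support, the inverse of [k] exchanges the roles. *)
Lemma rcc_uniform u (e : R) : rcc u -> 0 < e -> exists S : seq X,
  forall k g : aut X, {in S, k =1 (1%g : aut X)} -> `|u g - u (k * g)%g| < e.
Proof.
move=> [cu bu] e0; have e2 : 0 < e / 2 by rewrite divr_gt0.
have /choice [s sP] : forall g, exists S : seq X, forall h, {in S, h =1 g} ->
    `|u g - u h| < e / 2 by move=> g; exact: cu.
move: bu => /(compact_closureE conn locfin).
set A := closure _; rewrite compact_cover => /(_ (aut X) setT
  (fun g => [set h : aut X | {in s g, h =1 g}])) [|g _|D _ AD].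
- move=> g _; apply/open_autP => h /= hg; exists (s g) => k kh x xs.
  by rewrite kh// hg.
- by exists g.
exists (flatten [seq map g (s g) | g <- D]).
have half (k y : aut X) : {in flatten [seq map g (s g) | g <- D], k =1 (1%g : aut X)} ->
    A y -> `|u y - u (k * y)%g| < e.
  move=> kS /AD [g gD /= yg].
  have ky : {in s g, (k * y)%g =1 g}.
    move=> x xs /=; rewrite yg//; apply: kS; apply/flatten_mapP.
    by exists g => //; exact: map_f.
  rewrite [e]splitr; apply: le_lt_trans (ler_distD (u g) _ _) _.
  by rewrite ltrD//; [rewrite distrC; exact: sP|exact: sP].
move=> k g kS.
have inA y : u y != 0 -> A y by move=> uy; apply: subset_closure.
have [ug|/inA Ag] := eqVneq (u g) 0; last exact: half.
have [uk|/inA Ak] := eqVneq (u (k * g)%g) 0; first by rewrite ug uk subrr normr0.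
rewrite distrC; have := half (k^-1)%g (k * g)%g; rewrite mulKg; apply=> //.
by move=> x xS; apply: (can_inj (aut_funK k)); rewrite /= aut_invK (kS x xS).
Qed.

End CompactlySupported.

Lemma integral_mscale d (T : measurableType d) (R : realType)
    (m : {measure set T -> \bar R}) (D : set T) (k : {nonneg R}) (f : T -> \bar R) :
    measurable D -> m.-integrable D f ->
  (\int[mscale k m]_(x in D) f x = k%:num%:E * \int[m]_(x in D) f x)%E.
Proof.
move=> mD intf; have mf : measurable_fun D f by case/integrableP: intf.
have E (m' : {measure set T -> \bar R}) : (\int[m']_(x in D) f x =
  \int[m']_(x in D) f^\+ x - \int[m']_(x in D) f^\- x)%E by exact: integralE.
have mp := measurable_funepos mf; have mn := measurable_funeneg mf.
rewrite (E m) (E (mscale k m)) (ge0_integral_mscale _ mD k mp)//.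
rewrite (ge0_integral_mscale _ mD k mn)// [RHS]muleBr//.
by rewrite fin_num_adde_defl// fin_numN integrable_neg_fin_num.
Qed.

Section HaarIntegral.
Variables (R : realType) (X : sgraph) (q : nat) (o : X).
Hypothesis tree : regular_tree q.+1 X.
Variable mu : {measure set (borel (aut X)) -> \bar R}.
Hypothesis haar : haar_measure mu.
Local Notation G := (borel (aut X)).
Local Notation C := (Cplx R).
Local Notation cc := (@cc R X o).
Local Notation rcc := (@rcc R X o).
Implicit Types (f : aut X -> C) (u : aut X -> R) (g h : aut X).

Let conn := tree_conn tree.
Let locfin := tree_locfin tree.

Lemma rcc_integrable u : rcc u -> mu.-integrable [set: G] (fun g => (u g)%:E).
Proof.
move=> [cu bu]; have [M MP] := rcont_bounded tree cu bu.
exact: (bounded_integrable tree haar (rcont_measurable cu) MP bu).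
Qed.

Lemma Rintegral_preserving (phi : G -> G) (u : G -> R) :
  measurable_fun setT phi ->
  (forall A, measurable A -> mu (phi @^-1` A) = mu A) ->
  measurable_fun setT u ->
  mu.-integrable setT (fun h => (u (phi h))%:E) ->
  \int[mu]_h u (phi h) = \int[mu]_h u h.
Proof.
move=> mphi phiP mu_ iu; congr fine.
have mE : measurable_fun setT (EFin \o u) by exact/measurable_EFinP.
rewrite -[LHS](integral_pushforward (D := setT) mphi mE iu measurableT).
by apply: eq_measure_integral => A mA _; exact: phiP.
Qed.

Lemma cintegral_preserving (phi : aut X -> aut X) f :
  measurable_fun setT (phi : G -> G) ->
  (forall A, measurable (A : set G) -> mu [set h | A (phi h)] = mu A) ->
  cc f -> cc (fun h => f (phi h)) ->
  cintegral mu (fun h => f (phi h)) = cintegral mu f.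
Proof.
move=> mphi phiP /cc_rcc[[cr br] [ci bi]] /cc_rcc[rr ri].
by congr Complex; apply: (@Rintegral_preserving phi) => //;
  try exact: rcont_measurable; exact: rcc_integrable.
Qed.

Lemma cintegral_mulgr f k : cc f -> cintegral mu (fun h => f (h * k)%g) = cintegral mu f.
Proof.
move=> cf; apply: (@cintegral_preserving (fun h => h * k)%g) => //.
- exact: measurable_mulgr.
- by move=> A mA; exact: (haar_mulgr tree haar o).
- exact: (cc_mulgr tree).
Qed.

Lemma cintegral_mulgl f k : cc f -> cintegral mu (fun h => f (k * h)%g) = cintegral mu f.
Proof.
move=> cf; apply: (@cintegral_preserving (fun h => k * h)%g) => //.
- exact: measurable_mulgl.
- by move=> A mA; rewrite -{1}(invgK k) (haar_mulgl haar (k^-1)%g mA).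
- exact: cc_mulgl.
Qed.

Definition haar_mass : R := fine (mu (cyl o o)).

Lemma haar_mass_gt0 : 0 < haar_mass.
Proof.
apply: fine_gt0; rewrite (haar_stab_lty tree haar) andbT.
by rewrite lt0e (haar_stab_neq0 tree haar) measure_ge0.
Qed.

Lemma cintegral_cyl_indic x : cintegral mu (fun h => (h x == o)%:R) = (haar_mass)%:C%C.
Proof.
have ReE : (fun h : G => complex.Re ((h x == o)%:R : C)) = (cst 1 : G -> R) \_ (cyl x o : set G).
  apply/funext => h; rewrite /patch; case: ifPn => [/set_mem ->|/negP hx].
    by rewrite eqxx.
  by case: eqP => // ho; case: hx; exact: mem_set.
have ImE : (fun h : G => complex.Im ((h x == o)%:R : C)) = cst 0.
  by apply/funext => h; case: (h x == o).
rewrite /cintegral ReE ImE -Rintegral_mkcond !Rintegral_cst//; last exact: measurable_cyl.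
by rewrite mul0r mul1r (haar_cyl tree haar) (haar_stab_const tree haar x o).
Qed.

(** The factor 2 comes from estimating real and imaginary parts separately. *)
Lemma cintegral_le f (e : R) (D : set X) : cc f -> (forall h, `|f h| <= e%:C%C) ->
  finite_set D -> (forall h, f h != 0 -> D (h o)) ->
  `|cintegral mu f| <= (e * fine (mu [set h | D (h o)]) *+ 2)%:C%C.
Proof.
move=> ccf fe fD fDo; set B : set G := [set h | D (h o)].
have mB : measurable B by exact: measurable_bounded_at.
have Boo : (mu B < +oo)%E by exact: (bounded_measure_lty o tree haar fD).
have [/continuous_rcont [cr ci] _] := ccf.
have part u : rcont u -> (forall h, `|u h| <= e) -> (forall h, u h != 0 -> f h != 0) ->
    `|\int[mu]_h u h| <= e * fine (mu B).
  move=> cu ue uf.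
  have uB : (fun h : G => u h) = u \_ B.
    apply/funext => h; rewrite /patch; case: ifPn => // /negP hB.
    by have [//|/uf/fDo Dh] := eqVneq (u h) 0; case: hB; exact: mem_set.
  have bi (v : G -> R) : measurable_fun setT v -> (forall h, `|v h| <= e) ->
      mu.-integrable B (EFin \o v).
    move=> mv ve; apply: measurable_bounded_integrable => //.
      exact: measurable_funS mv.
    exists e; split; first exact: num_real.
    by move=> M' MM' k _ /=; apply: le_trans (ve k) (ltW MM').
  have mu_ := rcont_measurable cu.
  rewrite {1}uB -Rintegral_mkcond; apply: le_trans (le_normr_Rintegral mB (bi _ mu_ ue)) _.
  rewrite -Rintegral_cst//; apply: le_Rintegral => //.
  - by apply: (bi (fun h => `|u h|)) => [|h]; [exact: measurableT_comp|rewrite normr_id].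
  - apply: (bi (fun=> e)) => // h; rewrite ger0_norm//.
    by apply: le_trans (ue h).
have Re_le h : `|complex.Re (f h)| <= e by rewrite -lecR (le_trans (normc_ge_Re _)).
have Im_le h : `|complex.Im (f h)| <= e.
  rewrite -lecR; apply: le_trans (fe h); rewrite normc_def lecR -sqrtr_sqr ler_wsqrtr//.
  by rewrite lerDr sqr_ge0.
apply: le_trans (cplx_norm_le _) _; rewrite lecR mulr2n; apply: lerD; apply: part => //.
- by move=> h; apply: contra_neq => ->.
- by move=> h; apply: contra_neq => ->.
Qed.

Lemma cplx_continuous f :
  (forall g (e : R), 0 < e -> exists S : seq X, forall h, {in S, h =1 g} ->
    `|f g - f h| < e%:C%C) -> continuous f.
Proof.
move=> fc; apply/continuous_rcont; split=> g e e0; have [S Sf] := fc g e e0;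
  exists S => h /Sf/cplx_real_lt[]; case: (f g) (f h) => [a b] [c d] //=.
Qed.

Lemma cc_uniform f (e : R) : cc f -> 0 < e -> exists S : seq X,
  forall k g : aut X, {in S, k =1 (1%g : aut X)} -> `|f g - f (k * g)%g| < e%:C%C.
Proof.
move=> /cc_rcc[fr fi] e0; have e2 : 0 < e / 2 by rewrite divr_gt0.
have [S1 h1] := rcc_uniform tree fr e2; have [S2 h2] := rcc_uniform tree fi e2.
exists (S1 ++ S2) => k g kS; apply: le_lt_trans (cplx_norm_le _) _.
rewrite ltcR [e]splitr.
have /(h1 k g) : {in S1, k =1 (1%g : aut X)} by move=> x xS; apply: kS; rewrite mem_cat xS.
have /(h2 k g) : {in S2, k =1 (1%g : aut X)} by move=> x xS; apply: kS; rewrite mem_cat xS orbT.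
by case: (f g) (f (k * g)%g) => [a b] [c d] /= ? ?; apply: ltrD.
Qed.

Definition scalar_conv (a b : aut X -> C) g : C :=
  cintegral mu (fun h => a h * b (g * h^-1)%g).

Lemma continuous_divg f g : continuous f -> continuous (fun h => f (g * h^-1)%g).
Proof.
move=> cf; apply: (@continuous_invg R X (fun h => f (g * h)%g)).
exact: (@continuous_mulgl R X f g cf).
Qed.

Lemma cc_conv_integrand a b g : cc a -> cc b -> cc (fun h => a h * b (g * h^-1)%g).
Proof.
move=> cca [cb _]; have := @continuous_divg b g cb.
exact: (@ccM R X o a (fun h => b (g * h^-1)%g) cca).
Qed.

(** Continuity is uniform continuity of [b], since g' h^-1 is the left translate of g h^-1 by g'
    g^-1; the support lies in the product of the supports. *)
Lemma cc_scalar_conv a b : cc a -> cc b -> cc (scalar_conv a b).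
Proof.
move=> cca ccb; split; last first.
  have [[_ ba] [_ bb]] := (cca, ccb).
  apply: bounded_atS (bounded_mul conn locfin bb ba) => g cg.
  apply: contrapT => ng; case/eqP: cg; rewrite /scalar_conv -[RHS](cintegral0 mu).
  apply: eq_cintegral => h; have [->|ah] := eqVneq (a h) 0; first by rewrite mul0r.
  have [->|bh] := eqVneq (b (g * h^-1)%g) 0; first by rewrite mulr0.
  by case: ng; exists (g * h^-1)%g => //; exists h => //; rewrite mulgVK.
have [cb _] := ccb.
apply: cplx_continuous => g e e0.
have [M M0 aM] := cc_bounded tree cca.
pose D : set X := [set h o | h in [set h | a h != 0]].
have fD : finite_set D by case: cca.
pose V := fine (mu [set h | D (h o)]).
have V0 : 0 <= V by exact: fine_ge0.
(* Keeps the bound 2 M e' V from [cintegral_le] below [e]; the summand 1 makes the denominator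
   positive. *)
pose e' := e / (M * V *+ 2 + 1).
have pos : 0 < M * V *+ 2 + 1 by rewrite ltr_wpDl// mulrn_wge0// mulr_ge0.
have e'0 : 0 < e' by rewrite divr_gt0.
have [S Su] := cc_uniform ccb e'0.
(* If g' agrees with g on these vertices, then g' g^-1 fixes [S] pointwise. *)
exists (map (aut_inv g) S) => g' gg'.
have diff : scalar_conv a b g - scalar_conv a b g' =
    cintegral mu (fun h => a h * (b (g * h^-1)%g - b (g' * h^-1)%g)).
  have ig := cc_cintegrable tree haar (cc_conv_integrand g cca ccb).
  have ig' := cc_cintegrable tree haar (cc_conv_integrand g' cca ccb).
  rewrite -mulN1r -cintegralZ// -cintegralD//; last exact: cintegrableZ.
  by apply: eq_cintegral => h; rewrite mulrBr mulN1r.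
rewrite diff; apply: (@le_lt_trans _ _ (M * e' * V *+ 2)%:C%C).
  apply: (cintegral_le _ _ fD).
  - apply: (@ccM R X o a (fun h => b (g * h^-1)%g - b (g' * h^-1)%g) cca) => h.
    exact: (@continuousB _ _ _ (fun h => b (g * h^-1)%g) (fun h => b (g' * h^-1)%g) h
      (@continuous_divg b g cb h) (@continuous_divg b g' cb h)).
  - move=> h; rewrite normrM rmorphM; apply: ler_pM => //; apply: ltW.
    have := Su (g' * g^-1)%g (g * h^-1)%g; rewrite mulgA mulgVK; apply.
    by move=> x xS /=; rewrite gg' ?aut_invK//; exact: map_f.
  - by move=> h; rewrite mulf_eq0 negb_or => /andP[ah _]; exists h.
rewrite ltcR -mulrA mulrCA -mulrnAr mulrC mulrA ltr_pdivrMr//.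
by rewrite mulrC ltr_pM2l// ltrDl.
Qed.

Variable nu : {measure set (borel (stab o)) -> \bar R}.
Hypotheses (haarK : haar_measure nu) (nu1 : nu setT = 1%E).

Lemma Rintegral_stab u : rcont u -> (forall g, u g != 0 -> g o = o) ->
  \int[mu]_h u h = haar_mass * \int[nu]_k u (stab_val k).
Proof.
move=> cu u0.
have bu : bounded_at o [set g | u g != 0].
  by apply: (@sub_finite_set _ _ [set o]) => // _ [g /u0 go <-].
have [M MP] := rcont_bounded tree cu bu.
have mval := @measurable_stab_val X o.
have uK : (fun h : G => u h) = u \_ (cyl o o).
  apply/funext => g; rewrite /patch; case: ifPn => // /negP gK.
  have [//|/u0 go] := eqVneq (u g) 0.
  by case: gK; apply/mem_set.
have iuk : nu.-integrable setT (fun k => (u (stab_val k))%:E).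
  apply: measurable_bounded_integrable => //.
  - by rewrite nu1 ltry.
  - exact: (measurableT_comp (rcont_measurable cu) mval).
  - exists M; split; first exact: num_real.
    by move=> M' MM' k _ /=; apply: le_trans (MP _) (ltW MM').
rewrite {1}uK -Rintegral_mkcond /Rintegral.
have r0 : 0 <= haar_mass by exact/ltW/haar_mass_gt0.
have [m1 m1E] := pushforward_measure nu mval.
pose m2 : {measure set G -> \bar R} := mscale (NngNum r0) m1.
rewrite (eq_measure_integral m2); last first.
  move=> A mA AK; rewrite (haar_stab tree haar haarK nu1 mA AK).
  by rewrite /m2/= /mscale/= m1E.
have mE : measurable_fun [set: G] (EFin \o u).
  by apply/measurable_EFinP; exact: (rcont_measurable cu).
have valK : @stab_val X o @^-1` cyl o o = setT.
  by apply/seteqP; split=> // k _; exact/eqP/stabP.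
have iuk' : nu.-integrable (@stab_val X o @^-1` cyl o o) ((EFin \o u) \o @stab_val X o).
  by rewrite valK.
have mK := measurable_cyl o o.
have iu1 : (\int[m1]_(x in cyl o o) (u x)%:E = \int[nu]_k (u (stab_val k))%:E)%E.
  rewrite -[in RHS]valK -[RHS](integral_pushforward (D := cyl o o) mval mE iuk' mK).
  by apply: eq_measure_integral => A mA _; rewrite m1E.
have im1 : m1.-integrable (cyl o o) (fun x => (u x)%:E).
  apply/integrableP; split; first exact: measurable_funS mE.
  have /integrableP [_] := integrable_pushforward mval mE iuk' mK.
  congr (_ < _)%E; apply: eq_measure_integral => A mA _; by rewrite m1E.
rewrite integral_mscale// iu1 fineM//.
exact: integrable_fin_num.
Qed.

Lemma cintegral_stab f : continuous f -> (forall g, f g != 0 -> g o = o) ->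
  cintegral mu f = (haar_mass)%:C%C * cintegral nu (fun k => f (stab_val k)).
Proof.
move=> /continuous_rcont[cr ci] f0; rewrite /cintegral.
rewrite (Rintegral_stab cr) ?(Rintegral_stab ci); first last.
- by move=> g gi; apply: f0; apply: contra_neq gi => ->.
- by move=> g gi; apply: f0; apply: contra_neq gi => ->.
by rewrite /GRing.mul/= !mul0r subr0 addr0.
Qed.
End HaarIntegral.

Section SigmaFiniteCopy.
Variables (d : measure_display) (T : measurableType d) (R : realType).
Variables (mu : {measure set T -> \bar R}) (sf : sigma_finite setT mu).

(** The same measure under a name that depends on the finiteness proof, so that the structure
    required by Fubini can be attached to it. *)
Definition sf_copy of sigma_finite setT mu : set T -> \bar R := mu.
HB.instance Definition _ := measure_function.Measure.copy (sf_copy sf) mu.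
HB.instance Definition _ :=
  @Measure_isSigmaFinite.Build d T R (sf_copy sf) sf.
End SigmaFiniteCopy.

(** * Fubini's theorem for convolutions *)

Section HaarFubini.
Variables (R : realType) (X : sgraph) (q : nat) (o : X).
Hypothesis tree : regular_tree q.+1 X.
Variable mu : {measure set (borel (aut X)) -> \bar R}.
Hypothesis haar : haar_measure mu.
Local Notation G := (borel (aut X)).
Local Notation C := (Cplx R).
Local Notation cc := (@cc R X o).
Implicit Types (f : aut X -> C) (g h : aut X) (A B : set (aut X)).

Let conn := tree_conn tree.
Let locfin := tree_locfin tree.

Lemma haar_sigma_finite : sigma_finite [set: G] mu.
Proof.
have /countable_injP [f] := countable_vertices conn locfin.
move=> /in2TT finj; exists (fun n => [set h : aut X | [set y | f y = n] (h o)]).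
  by apply/seteqP; split=> // h _; exists (f (h o)).
move=> n; split; first exact: (@measurable_bounded_at X o [set y | f y = n]).
apply: (@bounded_measure_lty _ _ _ o tree _ haar [set y | f y = n]).
have [[y yn]|ny] := pselect (exists y, f y = n).
  by apply: (@sub_finite_set _ _ [set y]) => // z /=; rewrite -yn => /finj.
by apply: (@sub_finite_set _ _ set0) => // z zn; apply: ny; exists z.
Qed.

Lemma Rintegral_fubini (u : G * G -> R) (M : R) A B :
  measurable_fun setT u -> (forall p, `|u p| <= M) ->
  bounded_at o A -> bounded_at o B ->
  (forall p, u p != 0 -> A p.1 /\ B p.2) ->
  \int[mu]_h \int[mu]_k u (h, k) = \int[mu]_k \int[mu]_h u (h, k).
Proof.
move=> mu_ uM bA bB uAB.
pose m : {sigma_finite_measure set G -> \bar R} := sf_copy haar_sigma_finite.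
pose DA : set G := [set h | [set h o | h in A] (h o)].
pose DB : set G := [set h | [set h o | h in B] (h o)].
have mDA : measurable DA by exact: (@measurable_bounded_at X o).
have mDB : measurable DB by exact: (@measurable_bounded_at X o).
have iu : (m \x m)%E.-integrable setT (EFin \o u).
  have -> : EFin \o u = (EFin \o u) \_ (DA `*` DB).
    apply/funext => p; rewrite /patch; case: ifPn => // /negP pD /=.
    have [->//|/uAB[Ap Bp]] := eqVneq (u p) 0.
    by case: pD; apply/mem_set; split; [exists p.1|exists p.2].
  have mD : measurable (DA `*` DB) by exact: measurableX.
  rewrite -integrable_mkcond//; apply: measurable_bounded_integrable => //.
  - have := product_measure1E m m mDA mDB; rewrite /= => ->; apply: lte_mul_pinfty => //.
    + by rewrite ge0_fin_numE//; exact: (bounded_measure_lty o tree haar).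
    + exact: (bounded_measure_lty o tree haar).
  - exact: measurable_funS mu_.
  - exists M; split; first exact: num_real.
    by move=> M' MM' g _ /=; apply: le_trans (uM g) (ltW MM').
have fin1 (h : G) : (\int[mu]_k (u (h, k))%:E \is a fin_num)%E.
  apply: integrable_fin_num => //.
  apply: (bounded_integrable (u := fun k => u (h, k)) (M := M) tree haar _ _ bB) => //.
    exact: (measurableT_comp mu_ (pair1_measurable h)).
  by move=> k /uAB[].
have fin2 (k : G) : (\int[mu]_h (u (h, k))%:E \is a fin_num)%E.
  apply: integrable_fin_num => //.
  apply: (bounded_integrable (u := fun h => u (h, k)) (M := M) tree haar _ _ bA) => //.
    exact: (measurableT_comp mu_ (pair2_measurable k)).
  by move=> h /uAB[].
congr fine.
under eq_integral do rewrite fineK//.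
under [RHS]eq_integral do rewrite fineK//.
exact: (Fubini iu).
Qed.

Definition cmeasurable d (T : measurableType d) (F : T -> C) :=
  measurable_fun setT (fun x => complex.Re (F x)) /\
  measurable_fun setT (fun x => complex.Im (F x)).

Lemma cmeasurableM d (T : measurableType d) (F1 F2 : T -> C) :
  cmeasurable F1 -> cmeasurable F2 -> cmeasurable (fun x => F1 x * F2 x).
Proof.
move=> [r1 i1] [r2 i2]; split.
  under eq_fun do rewrite complex_ReM.
  by apply: measurable_funB; apply: measurable_funM.
under eq_fun do rewrite complex_ImM.
by apply: measurable_funD; apply: measurable_funM.
Qed.

Lemma continuous_cmeasurable d (T : measurableType d) f (phi : T -> G) :
  continuous f -> measurable_fun setT phi -> cmeasurable (fun x => f (phi x)).
Proof.
move=> /continuous_rcont[cr ci] mphi; split.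
- exact: (measurableT_comp (rcont_measurable cr) mphi).
- exact: (measurableT_comp (rcont_measurable ci) mphi).
Qed.

Lemma cintegral_fubini (F : aut X * aut X -> C) (M : R) A B :
  cmeasurable (F : G * G -> C) -> (forall p, `|F p| <= M%:C%C) ->
  bounded_at o A -> bounded_at o B ->
  (forall p, F p != 0 -> A p.1 /\ B p.2) ->
  cintegral mu (fun h => cintegral mu (fun k => F (h, k))) =
  cintegral mu (fun k => cintegral mu (fun h => F (h, k))).
Proof.
move=> [mr mi] FM bA bB FAB.
have ReF p : `|complex.Re (F p)| <= M by rewrite -lecR (le_trans (normc_ge_Re _)).
have ImF p : `|complex.Im (F p)| <= M.
  rewrite -lecR; apply: le_trans (FM p).
  by rewrite normc_def lecR -sqrtr_sqr ler_wsqrtr// lerDr sqr_ge0.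
have Re0 p : complex.Re (F p) != 0 -> A p.1 /\ B p.2.
  by move=> p0; apply: FAB; apply: contra_neq p0 => ->.
have Im0 p : complex.Im (F p) != 0 -> A p.1 /\ B p.2.
  by move=> p0; apply: FAB; apply: contra_neq p0 => ->.
exact: (congr2 (@Complex R) (Rintegral_fubini mr ReF bA bB Re0)
  (Rintegral_fubini mi ImF bA bB Im0)).
Qed.

(** Continuity concerns the Borel sets of the product, whereas Fubini uses the product
    sigma-algebra. Cylinders are handled directly: h k^-1 maps [x] to [y] if and only if, for one of
    the countably many vertices z, h maps z to [y] and k maps z to [x]. *)
Lemma measurable_divg : measurable_fun [set: G * G] (fun p : G * G => (p.1 * p.2^-1)%g : G).
Proof.
apply: (@measurability _ _ _ _ setT _ (cyl_system o) (borel_cyl conn locfin o)).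
have mcyl x y : measurable [set p : G * G | (p.1 * p.2^-1)%g x = y].
  have -> : [set p : G * G | (p.1 * p.2^-1)%g x = y] =
      \bigcup_z ((cyl z y : set G) `*` (cyl z x : set G)).
    apply/seteqP; split=> [[h k] /= hk|[h k] [z _ [/= hz kz]]].
      by exists ((k^-1)%g x) => //; split=> //=; rewrite /cyl/= aut_invK.
    by rewrite -kz /= aut_funK.
  apply: countable_bigcupT_measurable; first exact: countable_vertices.
  by move=> z; apply: measurableX; exact: measurable_cyl.
move=> _ [_ [[s t] ->] <-]; rewrite setTI /=.
elim: (o :: s) t => [|x r IHr] [|y t].
- have -> : (fun p : G * G => (p.1 * p.2^-1)%g) @^-1` seq_cyl ([::], [::]) = setT.
    by apply/seteqP; split.
  exact: measurableT.
- have -> : (fun p : G * G => (p.1 * p.2^-1)%g) @^-1` seq_cyl ([::], y :: t) = set0.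
    by apply/seteqP; split.
  exact: measurable0.
- have -> : (fun p : G * G => (p.1 * p.2^-1)%g) @^-1` seq_cyl (x :: r, [::]) = set0.
    by apply/seteqP; split.
  exact: measurable0.
have -> : (fun p : G * G => (p.1 * p.2^-1)%g) @^-1` seq_cyl (x :: r, y :: t) =
   [set p : G * G | (p.1 * p.2^-1)%g x = y] `&`
   (fun p : G * G => (p.1 * p.2^-1)%g) @^-1` seq_cyl (r, t).
  by apply/seteqP; split=> [p [? ?]|p [/= px pr]]; [split|rewrite /seq_cyl/= px; congr cons].
by apply: measurableI.
Qed.

(** After exchanging the integrals, h k is substituted for h in the inner one, by right
    invariance. *)
Lemma conv_fubini a b c : cc a -> cc b -> cc c ->
  cintegral mu (fun h => scalar_conv mu a b h * c h) =
  cintegral mu (fun k => a k * cintegral mu (fun h => b h * c (h * k)%g)).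
Proof.
move=> cca ccb ccc.
have [Ma Ma0 aM] := cc_bounded tree cca.
have [Mb Mb0 bM] := cc_bounded tree ccb.
have [Mc Mc0 cM] := cc_bounded tree ccc.
have [[ca ba] [cb bb] [conc bc]] := And3 cca ccb ccc.
pose F (p : aut X * aut X) : C := a p.2 * b (p.1 * p.2^-1)%g * c p.1.
transitivity (cintegral mu (fun h => cintegral mu (fun k => F (h, k)))).
  apply: eq_cintegral => h; rewrite mulrC -cintegralZ.
    by apply: eq_cintegral => k; rewrite /F /= mulrC.
  exact: (cc_cintegrable tree haar (cc_conv_integrand _ cca ccb)).
rewrite (@cintegral_fubini F (Ma * Mb * Mc) _ _ _ _ bc ba).
- apply: eq_cintegral => k.
  have ccbc : cc (fun h => b (h * k^-1)%g * c h).
    exact: (@ccM R X o (fun h => b (h * k^-1)%g) c (cc_mulgr tree k^-1%g ccb) conc).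
  transitivity (a k * cintegral mu (fun h => b (h * k^-1)%g * c h)).
    rewrite -cintegralZ; last exact: (cc_cintegrable tree haar ccbc).
    by apply: eq_cintegral => h; rewrite /F/= mulrA.
  congr (_ * _); rewrite -(cintegral_mulgr tree haar k ccbc).
  by apply: eq_cintegral => h; rewrite mulgK.
- apply: cmeasurableM; first apply: cmeasurableM.
  + exact: (continuous_cmeasurable ca measurable_snd).
  + exact: (continuous_cmeasurable cb measurable_divg).
  + exact: (continuous_cmeasurable conc measurable_fst).
- by move=> p; rewrite /F !normrM !rmorphM !ler_pM// mulr_ge0.
- move=> p; rewrite /F !mulf_eq0 !negb_or => /andP[/andP[ap _] cp]; by split.
Qed.
End HaarFubini.

(** * Kernels of Hecke operators *)

Lemma fsbig_list (M : zmodType) (I : choiceType) (r : seq I) (F : I -> M) :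
  uniq r -> (forall i, i \notin r -> F i = 0) ->
  \sum_(i \in [set: I]) F i = \sum_(i <- r) F i.
Proof.
move=> ur F0; have -> : [set: I] = [set` (predT : {pred I})] by apply/seteqP; split.
by rewrite -(@bigfs _ _ _ _ r predT) => // i _ /F0.
Qed.

Section HeckeOperators.
Variables (R : realType) (X : sgraph) (q : nat) (o : X) (e1 : star o).
Hypothesis tree : regular_tree q.+1 X.
Variable mu : {measure set (borel (aut X)) -> \bar R}.
Hypothesis haar : haar_measure mu.
Local Notation C := (Cplx R).
Local Notation V := (permV R o).
Local Notation pi := (@perm_rep R X o).
Local Notation cc := (@cc R X o).
Local Notation Cc_cj := (@Cc_cj R X o).
Implicit Types (F : aut X -> V) (Phi : aut X -> V -> V) (v w : V).
Implicit Types (x y e : star o) (f : edge X -> C) (g h : aut X) (k : stab o).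

Let conn := tree_conn tree.
Let locfin := tree_locfin tree.

Lemma src_star e : src (val e) = o.
Proof. exact/eqP/(valP e). Qed.

Lemma star_of (f : edge X) : src f = o -> exists e, val e = f.
Proof. by move=> /eqP so; exists (exist _ f so). Qed.

Lemma star_finite : finite_set [set: star o].
Proof.
have [_ _ reg] := tree.
have -> : [set: star o] = (val : star o -> edge X) @^-1` [set f : edge X | src f = o].
  by apply/seteqP; split=> // e _; exact: src_star.
apply: finite_preimage => [x y _ _|]; first exact: val_inj.
exact: (outs_finite reg).
Qed.

Definition stars : seq (star o) := finmap.enum_fset (fset_set [set: star o]).

Lemma mem_stars e : e \in stars.
Proof. by rewrite in_fset_set; [exact: in_setT|exact: star_finite]. Qed.

Lemma stars_uniq : uniq stars. Proof. exact: finmap.fset_uniq. Qed.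

Lemma perm_repE k v e : pi k v e = v (star_act k^-1%g e). Proof. by []. Qed.

Lemma val_star_act k e : val (star_act k e) = eact k (val e). Proof. by []. Qed.

Lemma star_actK k : cancel (star_act k) (star_act k^-1%g).
Proof. by move=> e; apply: val_inj; exact: eactK. Qed.

(** The basis vector at [f], or 0 if [f] does not start in [o]. Admitting all edges gives a meaning
    to [mark (eact h f)] for every [h]. *)
Definition mark (f : edge X) : V := fun x => (val x == f)%:R.

Lemma pi_mark k (f : edge X) : pi k (mark f) = mark (eact k f).
Proof.
apply/funext => x; rewrite perm_repE /mark; congr (_%:R).
by rewrite -(inj_eq (@eact_inj _ k)) val_star_act; congr (nat_of_bool (_ == _)); exact: eactVK.
Qed.

Lemma mark_sum (c : star o -> C) : c = \sum_(x <- stars) c x *: mark (val x).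
Proof.
apply/funext => y; rewrite fct_sumE (bigD1_seq y) ?mem_stars ?stars_uniq//=.
rewrite big1 => [|x xy].
  by rewrite addr0 -[RHS]/(c y * mark (val y) y) /mark eqxx mulr1.
by rewrite -[LHS]/(c x * mark (val x) y) /mark (inj_eq val_inj) eq_sym (negbTE xy) mulr0.
Qed.

Lemma linear_sum_at (T : V -> V) (I : Type) (s : seq I) (c : I -> C) (u : I -> V) e :
  linear T -> T (\sum_(i <- s) c i *: u i) e = \sum_(i <- s) c i * T (u i) e.
Proof.
move=> lT; have T0 : T 0 = 0.
  by have := lT (-1) 0 0; rewrite !scaleN1r !addNr.
elim: s => [|i s IHs]; first by rewrite !big_nil T0.
by rewrite !big_cons lT -IHs.
Qed.

(* A section F is the function on edges f with F g e = f (g e). *)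
Lemma sectionsP F : sections F <->
  exists f : edge X -> C, F = fun g e => f (eact g (val e)).
Proof.
split=> [FS|[f ->] g k]; last first.
  by apply/funext => e; rewrite perm_repE invgK val_star_act eactM.
have key g g' e e' : eact g (val e) = eact g' (val e') -> F g e = F g' e'.
  move=> ge; have kP : (g^-1 * g')%g o == o.
    have : (g^-1 * g')%g (src (val e')) = src (val e).
      by rewrite -src_eact eactM -ge eactK.
    by rewrite !src_star => ->.
  have -> : g' = (g * stab_val (Stab kP))%g by rewrite /= mulVKg.
  rewrite FS perm_repE invgK; congr (F g _); apply: val_inj.
  by rewrite val_star_act /= eactM -ge eactK.
exists (fun a => F (xget 1%g [set g : aut X | eact g (val e1) = a]) e1).
apply/funext => g; apply/funext => e; apply: key.
case: xgetP => [h _ /= -> //|].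
have [h he] := edge_transitive tree (val e1) (eact g (val e)).
by move=> /(_ h).
Qed.

Lemma ThetaE f : Theta e1 (fun g e => f (eact g (val e))) = f.
Proof.
apply/funext => e; rewrite /Theta; case: xgetP => [h _ /= -> //|].
have [h he] := edge_transitive tree (val e1) e.
by move=> /(_ h).
Qed.

(** The inverse of [Theta e1], by [pinv_Theta]. *)
Definition lift_edge f : aut X -> V := fun g e => f (eact g (val e)).

Lemma lift_sections f : sections (lift_edge f).
Proof. by apply/sectionsP; exists f. Qed.

Lemma sections_lift F : sections F -> F = lift_edge (Theta e1 F).
Proof. by move=> /sectionsP[f ->]; rewrite ThetaE. Qed.

Lemma Theta_bij : set_bij (@sections R X o) setT (Theta e1).
Proof.
split=> // [F F' /set_mem FS /set_mem FS' FF'|f _].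
  by rewrite (sections_lift FS) (sections_lift FS') FF'.
by exists (lift_edge f); [exact: lift_sections|exact: ThetaE].
Qed.

Lemma pinv_Theta f : 'pinv_(cst (cst 0)) (@sections R X o) (Theta e1) f = lift_edge f.
Proof.
have [_ _ surj] := Theta_bij.
have pf : sections ('pinv_(cst (cst 0)) (@sections R X o) (Theta e1) f).
  by apply: (surjpinv_image_sub (dflt := cst (cst 0)) surj); exists f.
by rewrite {1}(sections_lift pf) (surjpK _ surj)//; exact: in_setT.
Qed.

Lemma hecke_opE Phi f : hecke_op mu e1 Phi f = Theta e1 (hecke_act mu (lift_edge f) Phi).
Proof. by rewrite /hecke_op pinv_Theta. Qed.

Definition supp Phi : set (aut X) := [set h | Phi h <> cst 0].

Lemma Cc_cj_bounded Phi : Cc_cj Phi -> bounded_at o (supp Phi).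
Proof. by move=> [_ _ /(compact_closureE conn locfin o)]. Qed.

Lemma Cc_cj_cc Phi v e : Cc_cj Phi -> cc (fun h => Phi h v e).
Proof.
move=> PhiC; split; first by case: PhiC.
apply: bounded_atS (Cc_cj_bounded PhiC) => h /= hv Ph.
by move: hv; rewrite Ph eqxx.
Qed.

Lemma cc_mark_indic x (f : edge X) : cc (fun h => (val x == eact h f)%:R).
Proof.
split.
  apply: loc_const_continuous => g; exists [:: src f; tgt f] => h hg; congr (_%:R).
  congr (nat_of_bool (_ == _)); apply: edge_inj.
    by rewrite !src_eact; apply: hg; rewrite mem_head.
  by rewrite !tgt_eact; apply: hg; rewrite !inE eqxx orbT.
apply: (@bounded_move _ conn locfin (src f)).
apply: (@sub_finite_set _ _ [set o]) => // _ [h hx <-] /=.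
have [/eqP xf|/negbTE nx] := boolP (val x == eact h f).
  by rewrite -src_eact -xf src_star.
by move: hx; rewrite /= nx eqxx.
Qed.

Lemma Cc_cj_mark Phi (f : edge X) e : Cc_cj Phi -> cc (fun h => Phi h (mark (eact h f)) e).
Proof.
move=> PhiC; have -> : (fun h => Phi h (mark (eact h f)) e) =
    (fun h => \sum_(x <- stars) (val x == eact h f)%:R * Phi h (mark (val x)) e).
  apply/funext => h; rewrite {1}(mark_sum (mark (eact h f))).
  by rewrite linear_sum_at//; case: PhiC.
apply: cc_sum => x; apply: ccM (cc_mark_indic x f) _.
by have [] := Cc_cj_cc (mark (val x)) e PhiC.
Qed.

(** With b = h^-1 x for x in the star, the section of f at g h^-1 is the sum over the edges b of f
    (g b) times [mark (eact h b)]. Applying Phi h and integrating leaves these coefficients, which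
    no longer involve g. *)
Definition hecke_kernel Phi e (f : edge X) : C :=
  cintegral mu (fun h => Phi h (mark (eact h f)) e).

Lemma edges_from_finite (D : set X) : finite_set D -> finite_set [set f : edge X | D (src f)].
Proof.
have [_ _ reg] := tree; move=> fD.
apply: (@sub_finite_set _ _ (\bigcup_(v in D) [set f : edge X | src f = v])).
  by move=> f Df; exists (src f).
by apply: bigcup_finite => // v _; exact: (outs_finite reg).
Qed.

Lemma edges_in_finite (D : set X) (A : set (aut X)) :
  finite_set D -> bounded_at o A ->
  finite_set [set f : edge X | exists2 h, A h & D (h (src f))].
Proof.
move=> fD bA; apply: (@sub_finite_set _ _
    [set f : edge X | (\bigcup_(x in D) [set (h^-1)%g x | h in A]) (src f)]).
  by move=> f [h Ah Df]; exists (h (src f)) => //; exists h; rewrite //= aut_funK.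
apply: edges_from_finite; apply: bigcup_finite => // x _.
exact: (bounded_inv conn locfin (bounded_move conn locfin x bA)).
Qed.

Lemma edge_list (A : set (edge X)) : finite_set A ->
  exists2 L : seq (edge X), uniq L & forall b, A b -> b \in L.
Proof.
move=> fA; exists (finmap.enum_fset (fset_set A)); first exact: finmap.fset_uniq.
by move=> f Af; rewrite in_fset_set//; exact: mem_set.
Qed.

Lemma mark_eq0 (f : edge X) : src f <> o -> mark f = 0.
Proof.
move=> nf; apply/funext => x; rewrite /mark; case: eqP => // xf.
by case: nf; rewrite -xf src_star.
Qed.

Lemma linear0_at (T : V -> V) : linear T -> T 0 = 0.
Proof. by move=> lT; have := lT (-1) 0 0; rewrite !scaleN1r !addNr. Qed.

Lemma hecke_integrandE Phi f g h e (L : seq (edge X)) : linear (Phi h) -> uniq L ->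
  (forall b, supp Phi h -> h (src b) = o -> b \in L) ->
  Phi h (lift_edge f (g * h^-1)%g) e =
  \sum_(f' <- L) f (eact g f') * Phi h (mark (eact h f')) e.
Proof.
move=> lP uL LP; have [Ph|Ph] := pselect (Phi h = cst 0).
  by rewrite Ph big1// => f' _; rewrite mulr0.
rewrite -linear_sum_at//; congr (Phi h _ e); apply/funext => x; rewrite fct_sumE.
rewrite (bigD1_seq (eact h^-1%g (val x)))//=; last first.
  by apply: LP => //; rewrite src_eact /= aut_invK src_star.
rewrite big1 => [|f' nf'].
  rewrite addr0 -[RHS]/(f _ * mark _ x) /mark eactVK eqxx mulr1.
  by rewrite /lift_edge eactM.
rewrite -[LHS]/(f _ * mark _ x) /mark; case: eqP => [xf|_]; last by rewrite mulr0.
by move: nf'; rewrite xf eactK eqxx.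
Qed.

Lemma cc_hecke_integrand Phi f g e : Cc_cj Phi ->
  cc (fun h => Phi h (lift_edge f (g * h^-1)%g) e).
Proof.
move=> PhiC; have [lP _ _ _] := PhiC.
have [L uL LP] := edge_list (edges_in_finite (finite_set1 o) (Cc_cj_bounded PhiC)).
under eq_fun => h.
  rewrite (@hecke_integrandE _ _ _ _ _ L)//; last by move=> f' Ph hf; apply: LP; exists h.
  over.
by apply: cc_sum => f'; apply: ccZ; exact: Cc_cj_mark.
Qed.

(** One finite list serves all rows: the edges that some element of the support of [Phi] moves into
    the star of [o]. *)
Lemma hecke_kernel_support Phi : Cc_cj Phi -> exists L : seq (edge X),
  [/\ uniq L, forall e b, b \notin L -> hecke_kernel Phi e b = 0 &
      forall f g e, hecke_act mu (lift_edge f) Phi g e =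
        \sum_(f' <- L) f (eact g f') * hecke_kernel Phi e f'].
Proof.
move=> PhiC; have [lP _ _ _] := PhiC.
have [L uL LP] := edge_list (edges_in_finite (finite_set1 o) (Cc_cj_bounded PhiC)).
exists L; split=> // [e f' nL|f g e].
  rewrite /hecke_kernel -[RHS](cintegral0 mu); apply: eq_cintegral => h.
  have [Ph|Ph] := pselect (Phi h = cst 0); first by rewrite Ph.
  have [hf|hf] := pselect (h (src f') = o).
    by case/negP: nL; apply: LP; exists h.
  by rewrite mark_eq0 ?linear0_at.
rewrite /hecke_act (@eq_cintegral _ _ mu _ (fun h =>
    \sum_(f' <- L) f (eact g f') * Phi h (mark (eact h f')) e)); last first.
  by move=> h; apply: hecke_integrandE => // f' Ph hf; apply: LP; exists h.
rewrite cintegral_sum => [|f']; last first.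
  by apply: cintegrableZ; apply: (cc_cintegrable tree haar); exact: Cc_cj_mark.
apply: eq_bigr => f' _; rewrite cintegralZ//.
by apply: (cc_cintegrable tree haar); exact: Cc_cj_mark.
Qed.

Lemma hecke_actE Phi f g e : Cc_cj Phi ->
  hecke_act mu (lift_edge f) Phi g e =
  \sum_(f' \in [set: edge X]) f (eact g f') * hecke_kernel Phi e f'.
Proof.
move=> /hecke_kernel_support[L [uL L0 ->]]; rewrite (fsbig_list uL)// => f' /L0 ->.
by rewrite mulr0.
Qed.

Lemma cintegral_conj (f : aut X -> C) g : cc f ->
  cintegral mu (fun h => f (g * h * g^-1)%g) = cintegral mu f.
Proof.
move=> ccf; rewrite -[RHS](cintegral_mulgl tree haar g ccf).
rewrite -(cintegral_mulgr tree haar g^-1%g (cc_mulgl g ccf)).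
by apply: eq_cintegral => h; rewrite mulgA.
Qed.

(** Substituting k^-1 h k for h, the equivariance of [Phi] under conjugation moves k out of the
    integral. *)
Lemma hecke_act_sections F Phi : sections F -> Cc_cj Phi -> sections (hecke_act mu F Phi).
Proof.
move=> FS PhiC g k; apply/funext => e; rewrite perm_repE invgK.
rewrite (sections_lift FS); set f := Theta e1 F.
have ccI := cc_hecke_integrand f (g * stab_val k)%g e PhiC.
rewrite /hecke_act -(cintegral_conj (stab_val k)^-1%g ccI).
apply: eq_cintegral => h; rewrite invgK.
have [_ _ _ /(_ k^-1%g h)] := PhiC.
rewrite -[stab_val k^-1%g]/((stab_val k)^-1)%g invgK => ->.
rewrite /= perm_repE invgK; congr (Phi h _ _); apply/funext => x.
rewrite perm_repE /lift_edge val_star_act; congr f.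
by rewrite -eactM !invgM !invgK !mulgA !mulgK.
Qed.

End HeckeOperators.

(** * Convolution and composition of operators *)

Section HeckeAlgebra.
Variables (R : realType) (X : sgraph) (q : nat) (o : X) (e1 : star o).
Hypothesis tree : regular_tree q.+1 X.
Variable mu : {measure set (borel (aut X)) -> \bar R}.
Hypothesis haar : haar_measure mu.
Local Notation C := (Cplx R).
Local Notation V := (permV R o).
Local Notation pi := (@perm_rep R X o).
Local Notation cc := (@cc R X o).
Local Notation Cc_cj := (@Cc_cj R X o).
Local Notation mark := (@mark R X o).
Local Notation kappa := (@hecke_kernel R X o mu).
Implicit Types (F : aut X -> V) (Phi : aut X -> V -> V) (v w : V).
Implicit Types (x y e : star o) (f : edge X -> C) (g h : aut X) (k : stab o).
Implicit Types (a b : edge X).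

Let conn := tree_conn tree.
Let locfin := tree_locfin tree.

Lemma pi_inv k v : pi k^-1%g (pi k v) = v.
Proof.
apply/funext => e; rewrite !perm_repE invgK; congr v; exact: star_actK.
Qed.

Lemma pi_invK k v : pi k (pi k^-1%g v) = v.
Proof. by have := pi_inv k^-1%g v; rewrite invgK. Qed.

Lemma Cc_cj_conj Phi k g v : Cc_cj Phi ->
  Phi (stab_val k * g * (stab_val k)^-1)%g v = pi k (Phi g (pi k^-1%g v)).
Proof. by move=> [_ _ _ ->]. Qed.

Lemma hecke_kernel_invariant Phi k e b : Cc_cj Phi ->
  kappa Phi (star_act k e) (eact (stab_val k) b) = kappa Phi e b.
Proof.
move=> PhiC; rewrite /hecke_kernel.
have ccI := Cc_cj_mark tree (eact (stab_val k) b) (star_act k e) PhiC.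
rewrite -(cintegral_conj tree haar (stab_val k) ccI); apply: eq_cintegral => h.
rewrite (Cc_cj_conj _ _ _ PhiC) pi_mark perm_repE star_actK; congr (Phi h (mark _) e).
by rewrite -!eactM; congr eact; rewrite -!mulgA mulVg mulg1 mulKg.
Qed.

Lemma Theta_at F g : sections F -> Theta e1 F (eact g (val e1)) = F g e1.
Proof. by move=> FS; rewrite {2}(sections_lift e1 tree FS). Qed.

Lemma hecke_op_at Phi f g : Cc_cj Phi ->
  hecke_op mu e1 Phi f (eact g (val e1)) = hecke_act mu (lift_edge f) Phi g e1.
Proof.
move=> PhiC; rewrite (hecke_opE _ tree) Theta_at//.
exact: (hecke_act_sections e1 tree haar (lift_sections e1 tree f)).
Qed.

Lemma hecke_op_ext (T T' : (edge X -> C) -> edge X -> C) :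
  (forall f g, T f (eact g (val e1)) = T' f (eact g (val e1))) -> T = T'.
Proof.
move=> TT; apply/funext => f; apply/funext => a.
by have [g <-] := edge_transitive tree (val e1) a.
Qed.

Lemma Cc_cjP Phi : Cc_cj Phi <->
  [/\ forall g, linear (Phi g), forall v e, continuous (fun g => Phi g v e : C),
      bounded_at o (supp Phi) &
      forall k g v, Phi (stab_val k * g * (stab_val k)^-1)%g v = pi k (Phi g (pi k^-1%g v))].
Proof.
split=> [PhiC|[lP cP bP jP]].
  have [lP cP _ _] := PhiC; split=> // [|k g v]; last exact: Cc_cj_conj.
  exact: (Cc_cj_bounded tree PhiC).
split=> //; first exact/(compact_closureE conn locfin o).
by move=> k g; apply/funext => v; rewrite jP.
Qed.

Lemma cc_continuous (u : aut X -> C) : cc u -> continuous u.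
Proof. by case. Qed.

Lemma Cc_cj_lin Phi1 Phi2 (c : C) : Cc_cj Phi1 -> Cc_cj Phi2 -> Cc_cj (c *: Phi1 + Phi2).
Proof.
move=> P1C P2C; have [/Cc_cjP[l1 c1 b1 j1] /Cc_cjP[l2 c2 b2 j2]] := (P1C, P2C).
apply/Cc_cjP; split=> [g s v w|v e||k g v].
- apply/funext => e.
  rewrite -[LHS]/(c * Phi1 g (s *: v + w) e + Phi2 g (s *: v + w) e) l1 l2.
  rewrite -[LHS]/(c * (s * Phi1 g v e + Phi1 g w e) + (s * Phi2 g v e + Phi2 g w e)).
  rewrite -[RHS]/(s * (c * Phi1 g v e + Phi2 g v e) + (c * Phi1 g w e + Phi2 g w e)).
  by rewrite !mulrDr mulrCA addrACA.
- have cc1 := Cc_cj_cc tree v e P1C; have cc2 := Cc_cj_cc tree v e P2C.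
  exact: (cc_continuous (ccD (ccZ c cc1) cc2)).
- apply: (@bounded_atS _ _ _ (supp Phi1 `|` supp Phi2)) => [g|].
    rewrite /supp /= => nP; apply/not_andP => -[E1 E2]; apply: nP.
    apply/funext => v; apply/funext => e.
    by rewrite -[LHS]/(c * Phi1 g v e + Phi2 g v e) E1 E2 /= mulr0 addr0.
  by rewrite /bounded_at image_setU finite_setU.
- apply/funext => e.
  rewrite -[LHS]/(c * Phi1 _ v e + Phi2 _ v e) j1 j2.
  by [].
Qed.

Lemma hecke_op_lin Phi1 Phi2 (c : C) : Cc_cj Phi1 -> Cc_cj Phi2 ->
  hecke_op mu e1 (c *: Phi1 + Phi2) = c *: hecke_op mu e1 Phi1 + hecke_op mu e1 Phi2.
Proof.
move=> P1C P2C; apply: hecke_op_ext => f g.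
rewrite (hecke_op_at _ _ (Cc_cj_lin c P1C P2C)).
rewrite -[RHS]/(c * hecke_op mu e1 Phi1 f (eact g (val e1)) +
                hecke_op mu e1 Phi2 f (eact g (val e1))).
rewrite (hecke_op_at _ _ P1C) (hecke_op_at _ _ P2C).
have i1 := cc_cintegrable tree haar (cc_hecke_integrand tree f g e1 P1C).
have i2 := cc_cintegrable tree haar (cc_hecke_integrand tree f g e1 P2C).
by rewrite /hecke_act -(cintegralZ c i1) -(cintegralD (cintegrableZ c i1) i2).
Qed.

Section Convolution.
Variables (Phi1 Phi2 : aut X -> V -> V).
Hypotheses (P1C : Cc_cj Phi1) (P2C : Cc_cj Phi2).

Let l1 : forall g, linear (Phi1 g). Proof. by case: P1C. Qed.
Let l2 : forall g, linear (Phi2 g). Proof. by case: P2C. Qed.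

Let coef2 e x h : C := Phi2 h (mark (val x)) e.
Let coef1 v x h : C := Phi1 h v x.

Lemma conv_integrandE g v e h : Phi2 h (Phi1 (g * h^-1)%g v) e =
  \sum_(x <- stars o) coef2 e x h * coef1 v x (g * h^-1)%g.
Proof.
rewrite {1}(mark_sum tree (Phi1 (g * h^-1)%g v)) linear_sum_at//.
by apply: eq_bigr => x _; rewrite mulrC.
Qed.

Let cc2 e x : cc (coef2 e x). Proof. exact: (Cc_cj_cc tree). Qed.
Let cc1 v x : cc (coef1 v x). Proof. exact: (Cc_cj_cc tree). Qed.

Lemma cc_conv_op g v e : cc (fun h => Phi2 h (Phi1 (g * h^-1)%g v) e).
Proof.
under eq_fun => h do rewrite conv_integrandE.
by apply: cc_sum => x; exact: (cc_conv_integrand g (cc2 e x) (cc1 v x)).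
Qed.

Lemma convolutionE g v e : convolution mu Phi1 Phi2 g v e =
  \sum_(x <- stars o) scalar_conv mu (coef2 e x) (coef1 v x) g.
Proof.
rewrite /convolution.
rewrite (@eq_cintegral _ _ mu _ _ (conv_integrandE g v e)).
rewrite cintegral_sum// => x; apply: (cc_cintegrable tree haar).
exact: (cc_conv_integrand g (cc2 e x) (cc1 v x)).
Qed.

Lemma convolution_Cc_cj : Cc_cj (convolution mu Phi1 Phi2).
Proof.
apply/Cc_cjP; split=> [g s v w|v e||k g v].
- apply/funext => e.
  rewrite -[RHS]/(s * convolution mu Phi1 Phi2 g v e + convolution mu Phi1 Phi2 g w e).
  have iv := cc_cintegrable tree haar (cc_conv_op g v e).
  have iw := cc_cintegrable tree haar (cc_conv_op g w e).
  rewrite /convolution -(cintegralZ s iv) -(cintegralD (cintegrableZ s iv) iw).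
  by apply: eq_cintegral => h; rewrite l1 l2.
- under eq_fun => g do rewrite convolutionE.
  apply: cc_continuous; apply: cc_sum => x.
  exact: (cc_scalar_conv tree haar (cc2 e x) (cc1 v x)).
- have := bounded_mul conn locfin (Cc_cj_bounded tree P1C) (Cc_cj_bounded tree P2C).
  apply: bounded_atS => g ng; apply: contrapT => nS; apply: ng.
  apply/funext => v; apply/funext => e; rewrite -[RHS](cintegral0 mu).
  apply: eq_cintegral => h.
  have [E2|n2] := pselect (Phi2 h = cst 0); first by rewrite E2.
  have [E1|n1] := pselect (Phi1 (g * h^-1)%g = cst 0).
    by rewrite E1 (linear0_at (l2 h)).
  by case: nS; exists (g * h^-1)%g => //; exists h; rewrite // mulgVK.
- apply/funext => e; rewrite perm_repE /convolution.
  rewrite -(cintegral_conj tree haar (stab_val k)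
    (cc_conv_op (stab_val k * g * (stab_val k)^-1)%g v e)).
  apply: eq_cintegral => h; rewrite (Cc_cj_conj _ _ _ P2C).
  have -> : (stab_val k * g * (stab_val k)^-1 * (stab_val k * h * (stab_val k)^-1)^-1 =
    stab_val k * (g * h^-1) * (stab_val k)^-1)%g.
    by rewrite !invgM invgK -!mulgA mulKg.
  by rewrite (Cc_cj_conj _ _ _ P1C) pi_inv perm_repE.
Qed.

(** Expanding in the basis of [V] reduces the claim to the scalar identity [conv_fubini], whose
    third function is the indicator of the elements that move [b] to a given edge of the star. *)
Lemma convolution_kernel e b : kappa (convolution mu Phi1 Phi2) e b =
  cintegral mu (fun k : aut X => \sum_(x <- stars o) coef2 e x k * kappa Phi1 x (eact k b)).
Proof.
have cind y : cc (fun h => (val y == eact h b)%:R) := cc_mark_indic R tree y b.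
have int1 x y (k : aut X) : cintegrable mu (fun h => coef1 (mark (val y)) x h * (val y == eact (h * k)%g b)%:R).
  apply: (cc_cintegrable tree haar); apply: ccM; first exact: cc1.
  exact: (@continuous_mulgr _ _ (fun h => (val y == eact h b)%:R) k (cc_continuous (cind y))).
have kE x (k : aut X) : kappa Phi1 x (eact k b) = \sum_(y <- stars o)
    cintegral mu (fun h => coef1 (mark (val y)) x h * (val y == eact (h * k)%g b)%:R).
  rewrite -cintegral_sum//; apply: eq_cintegral => h.
  rewrite {1}(mark_sum tree (mark (eact h (eact k b)))) linear_sum_at//.
  by apply: eq_bigr => y _; rewrite mulrC eactM.
have ccin x y : cc (fun k : aut X => coef2 e x k *
    cintegral mu (fun h => coef1 (mark (val y)) x h * (val y == eact (h * k)%g b)%:R)).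
  apply: ccM; first exact: cc2.
  (* The inner integral depends on [k] only through [eact k b]. *)
  apply: loc_const_continuous => g; exists [:: src b; tgt b] => h hg.
  apply: eq_cintegral => h'; congr (_ * (nat_of_bool (_ == _))%:R).
  rewrite !eactM; congr (eact _ _); apply: edge_inj.
    by rewrite !src_eact; apply: hg; rewrite mem_head.
  by rewrite !tgt_eact; apply: hg; rewrite !inE eqxx orbT.
have -> : (fun k : aut X => \sum_(x <- stars o) coef2 e x k * kappa Phi1 x (eact k b)) =
   (fun k : aut X => \sum_(x <- stars o) \sum_(y <- stars o) coef2 e x k *
    cintegral mu (fun h => coef1 (mark (val y)) x h * (val y == eact (h * k)%g b)%:R)).
  by apply/funext => k; apply: eq_bigr => x _; rewrite kE mulr_sumr.
rewrite cintegral_sum => [|x]; last first.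
  by apply: (cc_cintegrable tree haar); apply: cc_sum => y; exact: ccin.
have -> : kappa (convolution mu Phi1 Phi2) e b = cintegral mu (fun h =>
    \sum_(x <- stars o) \sum_(y <- stars o)
      scalar_conv mu (coef2 e x) (coef1 (mark (val y)) x) h * (val y == eact h b)%:R).
  apply: eq_cintegral => h; rewrite exchange_big /=.
  have [lc _ _ _] := convolution_Cc_cj.
  rewrite {1}(mark_sum tree (mark (eact h b))) linear_sum_at//.
  by apply: eq_bigr => y _; rewrite convolutionE mulr_sumr; apply: eq_bigr => x _; rewrite mulrC.
have ccs x y : cc (fun h =>
   scalar_conv mu (coef2 e x) (coef1 (mark (val y)) x) h * (val y == eact h b)%:R).
  apply: ccM; first exact: (cc_scalar_conv tree haar (cc2 e x) (cc1 _ x)).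
  exact: cc_continuous (cind y).
rewrite cintegral_sum => [|x]; last first.
  by apply: (cc_cintegrable tree haar); apply: cc_sum => y; exact: ccs.
apply: eq_bigr => x _.
rewrite !cintegral_sum => [|y|y]; last 2 first.
- by apply: (cc_cintegrable tree haar); exact: ccin.
- by apply: (cc_cintegrable tree haar); exact: ccs.
apply: eq_bigr => y _.
exact: (conv_fubini tree haar (cc2 e x) (cc1 (mark (val y)) x) (cind y)).
Qed.

(** By [convolution_kernel] this is an exchange of a finite sum with the integral, after reindexing
    the edges by [k]. The list [L] contains every edge that the support of [Phi2] can move into
    [L1], so that one finite sum works for all [k]. *)
Lemma hecke_act_convolution f g e :
  hecke_act mu (lift_edge f) (convolution mu Phi1 Phi2) g e =
  hecke_act mu (hecke_act mu (lift_edge f) Phi1) Phi2 g e.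
Proof.
have [L1 [_ L1P _]] := hecke_kernel_support tree haar P1C.
have fD : finite_set [set src b | b in [set` L1]] by exact: finite_image.
have [L uL LP] := edge_list (edges_in_finite tree fD (Cc_cj_bounded tree P2C)).
have coef20 x (k : aut X) : ~ supp Phi2 k -> coef2 e x k = 0 by move=> /contrapT E; rewrite /coef2 E.
have L0 b (k : aut X) x : b \notin L -> coef2 e x k * kappa Phi1 x (eact k b) = 0.
  move=> bL; have [sk|/(coef20 x)->] := pselect (supp Phi2 k); last by rewrite mul0r.
  rewrite L1P ?mulr0//; apply: contra bL => kb; apply: LP; exists k => //.
  by exists (eact k b).
rewrite (hecke_actE tree haar _ _ _ convolution_Cc_cj) (fsbig_list uL); last first.
  move=> b bL; rewrite convolution_kernel; apply/eqP; rewrite mulf_eq0; apply/orP; right.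
  apply/eqP; rewrite -[RHS](cintegral0 mu); apply: eq_cintegral => k.
  by rewrite big1// => x _; exact: L0.
have ccin b : cc (fun k : aut X => \sum_(x <- stars o) coef2 e x k * kappa Phi1 x (eact k b)).
  apply: cc_sum => x; apply: ccM; first exact: cc2.
  apply: loc_const_continuous => k; exists [:: src b; tgt b] => h hg.
  congr (kappa Phi1 x _); apply: edge_inj.
    by rewrite !src_eact; apply: hg; rewrite mem_head.
  by rewrite !tgt_eact; apply: hg; rewrite !inE eqxx orbT.
have int b := cc_cintegrable tree haar (ccin b).
transitivity (cintegral mu (fun k : aut X => \sum_(b <- L) f (eact g b) *
    (\sum_(x <- stars o) coef2 e x k * kappa Phi1 x (eact k b)))).
  rewrite cintegral_sum => [|b]; last exact: cintegrableZ.
  by apply: eq_bigr => b _; rewrite cintegralZ// convolution_kernel.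
apply: eq_cintegral => k.
rewrite {1}(mark_sum tree (hecke_act _ _ _ _)) linear_sum_at//.
under eq_bigr => b _ do rewrite mulr_sumr.
rewrite exchange_big; apply: eq_bigr => x _ /=.
rewrite (hecke_actE tree haar _ _ _ P1C).
rewrite (@reindex_fsbigT _ _ _ _ _ (eact k)); last first.
  by exists (eact k^-1%g) => b; [exact: eactK|exact: eactVK].
under eq_bigr => b _ do rewrite mulrCA.
have [sk|/coef20 nk] := pselect (supp Phi2 k); last first.
  by rewrite -/(coef2 e x k) nk mulr0 big1// => b _; rewrite mul0r.
rewrite (fsbig_list uL) => [|b bL].
  rewrite mulr_suml; apply: eq_bigr => b _; rewrite -/(coef2 e x k).
  by rewrite -eactM mulgVK mulrC.
by rewrite L1P ?mulr0//; apply: contra bL => kb; apply: LP; exists k => //; exists (eact k b).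
Qed.

Lemma hecke_op_convolution :
  hecke_op mu e1 (convolution mu Phi1 Phi2) = hecke_op mu e1 Phi2 \o hecke_op mu e1 Phi1.
Proof.
apply: hecke_op_ext => f g /=.
rewrite (hecke_op_at _ _ convolution_Cc_cj) (hecke_op_at _ _ P2C) hecke_act_convolution.
congr (hecke_act mu _ Phi2 g e1); rewrite (hecke_opE _ tree).
apply: (sections_lift e1 tree).
exact: (hecke_act_sections e1 tree haar (lift_sections e1 tree f)).
Qed.

End Convolution.

End HeckeAlgebra.

(** * The null ideal, and operators with a prescribed kernel *)

Section HeckeKernels.
Variables (R : realType) (X : sgraph) (q : nat) (o : X) (e1 : star o).
Hypothesis tree : regular_tree q.+1 X.
Variable mu : {measure set (borel (aut X)) -> \bar R}.
Hypothesis haar : haar_measure mu.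
Local Notation C := (Cplx R).
Local Notation V := (permV R o).
Local Notation pi := (@perm_rep R X o).
Local Notation cc := (@cc R X o).
Local Notation Cc_cj := (@Cc_cj R X o).
Local Notation mark := (@mark R X o).
Local Notation kappa := (@hecke_kernel R X o mu).
Implicit Types (F : aut X -> V) (Phi : aut X -> V -> V) (v w : V).
Implicit Types (x y e : star o) (f : edge X -> C) (g h : aut X) (k : stab o).
Implicit Types (a b : edge X).

Let conn := tree_conn tree.
Let locfin := tree_locfin tree.
Local Notation mass := ((haar_mass o mu)%:C%C : C).

Lemma mass_neq0 : mass != 0.
Proof.
have := haar_mass_gt0 o tree haar; rewrite lt_neqAle eq_sym => /andP[m0 _].
by apply: contra m0 => /eqP[->].
Qed.

(** The entry (e, b) is read off from the action on the indicator of [b], at the identity of the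
    group. *)
Lemma hecke_op_eq0 Phi : Cc_cj Phi ->
  hecke_op mu e1 Phi = cst 0 <-> forall e b, kappa Phi e b = 0.
Proof.
move=> PhiC; split=> [P0 e b|k0]; last first.
  apply: (hecke_op_ext (e1 := e1) tree) => f g.
  rewrite (hecke_op_at _ tree haar _ _ PhiC) (hecke_actE tree haar _ _ _ PhiC).
  by rewrite (fsbig_list (r := [::]))// ?big_nil// => b _; rewrite k0 mulr0.
pose f a : C := (a == b)%:R.
have FS := hecke_act_sections e1 tree haar (lift_sections e1 tree f) PhiC.
have : hecke_act mu (lift_edge f) Phi 1%g e = 0.
  by rewrite (sections_lift e1 tree FS) -(hecke_opE _ tree) P0.
rewrite (hecke_actE tree haar _ _ _ PhiC) (fsbig_list (r := [:: b]))//.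
  by rewrite big_seq1 /f eact1 eqxx mul1r.
by move=> a; rewrite inE /f eact1 => /negbTE ->; rewrite mul0r.
Qed.

Section Faithful.
Variable nu : {measure set (borel (stab o)) -> \bar R}.
Hypotheses (haarK : haar_measure nu) (nu1 : nu setT = 1%E).

Let mean Phi g v e : C := cintegral nu (fun k => pi k (Phi (g * stab_val k)%g v) e).

(** Equivariance gives pi(k) Phi(g k) = Phi(k g) pi(k). In terms of basis vectors the integrand
    extends to a function on the group that vanishes off the stabilizer of [o], because
    [mark (eact h x)] does. Then [cintegral_stab] and a right translation by [g] produce the kernel
    entries. *)
Lemma hecke_mean_kernel Phi g v e : Cc_cj Phi ->
  mass * mean Phi g v e = \sum_(x <- stars o) v x * kappa Phi e (eact g^-1%g (val x)).
Proof.
move=> PhiC; have [lP cP bP jP] := (Cc_cjP tree Phi).1 PhiC.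
pose r x h : C := Phi (h * g)%g (mark (eact h (val x))) e.
have ccr x : cc (r x).
  have -> : r x = fun h => Phi (h * g)%g (mark (eact (h * g)%g (eact g^-1%g (val x)))) e.
    by apply/funext => h; rewrite /r -eactM mulgK.
  exact: (cc_mulgr tree g (Cc_cj_mark tree (eact g^-1%g (val x)) e PhiC)).
pose r' h : C := \sum_(x <- stars o) v x * r x h.
have -> : mean Phi g v e = cintegral nu (fun k => r' (stab_val k)).
  apply: eq_cintegral => k.
  have -> : (g * stab_val k)%g =
      (stab_val k^-1 * (stab_val k * g) * (stab_val k^-1)^-1)%g.
    by rewrite -[stab_val k^-1%g]/((stab_val k)^-1)%g invgK mulKg.
  rewrite jP invgK pi_invK {1}(mark_sum tree v).
  have -> : pi k (\sum_(x <- stars o) v x *: mark (val x)) =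
     \sum_(x <- stars o) v x *: mark (eact (stab_val k) (val x)).
    apply/funext => z; rewrite perm_repE !fct_sumE; apply: eq_bigr => x _.
    by rewrite -pi_mark.
  by rewrite linear_sum_at.
have ccr' : cc r' by apply: cc_sum => x; apply: ccZ; exact: ccr.
have suppr h : r' h != 0 -> h o = o.
  move=> rh; apply: contrapT => ho; move/eqP: rh; apply.
  rewrite /r' big1// => x _; rewrite /r mark_eq0 ?src_eact ?src_star//.
  by rewrite (linear0_at (lP _)) mulr0.
rewrite -(cintegral_stab tree haar haarK nu1 (cc_continuous ccr') suppr).
rewrite cintegral_sum => [|x]; last first.
  by apply: cintegrableZ; exact: (cc_cintegrable tree haar (ccr x)).
apply: eq_bigr => x _; rewrite cintegralZ; last exact: (cc_cintegrable tree haar (ccr x)).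
congr (_ * _); rewrite /hecke_kernel.
rewrite -(cintegral_mulgr tree haar g (Cc_cj_mark tree (eact g^-1%g (val x)) e PhiC)).
by apply: eq_cintegral => h; rewrite /r -eactM mulgK.
Qed.

Lemma hecke_null_kernel Phi : Cc_cj Phi ->
  hecke_null nu Phi <-> forall e b, kappa Phi e b = 0.
Proof.
move=> PhiC; split=> [[_ P0] e b|k0]; last first.
  split=> // g v e; apply: (mulfI mass_neq0).
  rewrite [LHS](hecke_mean_kernel g v e PhiC) mulr0 big1// => x _.
  by rewrite k0 mulr0.
(* As h b = e1, the mean at [h] of the basis vector at [e1] involves the single entry (e, b). *)
have [h hb] := edge_transitive tree b (val e1).
have := hecke_mean_kernel h (mark (val e1)) e PhiC.
rewrite /mean P0 mulr0 (bigD1_seq e1 (mem_stars tree e1) (stars_uniq o)) /=.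
rewrite big1 => [|x xe]; last first.
  by rewrite /mark (inj_eq val_inj) (negbTE xe) mul0r.
by rewrite /mark eqxx mul1r addr0 -hb eactK.
Qed.

End Faithful.

Section Realization.
Variable c0 : edge X -> edge X -> C.
Hypothesis c0_inv : forall g a b, c0 (eact g a) (eact g b) = c0 a b.
Hypothesis c0_fin : forall a, finite_set [set b | c0 a b != 0].

(** The integrand of its kernel entry (e, b) is constant on the set of h that move the source of [b]
    to [o], and 0 elsewhere. This set has measure [mass], whence the factor [mass^-1]. *)
Let Phi0 : aut X -> V -> V := fun h v e =>
  \sum_(x <- stars o) mass^-1 * (c0 (val e) (eact h^-1%g (val x)) * v x).

Let supp0 : bounded_at o (supp Phi0).
Proof.
pose D := \bigcup_(e in [set: star o]) [set src b | b in [set b | c0 (val e) b != 0]].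
have fD : finite_set D.
  apply: bigcup_finite => [|e _]; first exact: (star_finite o tree).
  exact/finite_image/c0_fin.
have bD : bounded_at o [set h : aut X | D (h o)].
  by apply: sub_finite_set fD => _ [h Dh <-].
have := bounded_invset conn locfin bD.
apply: bounded_atS => h nh; exists h^-1%g; rewrite ?invgK//.
apply: contrapT => nD; apply: nh; apply/funext => v; apply/funext => e.
rewrite /Phi0 big1// => x _.
have [->|c1] := eqVneq (c0 (val e) (eact h^-1%g (val x))) 0; first by rewrite mul0r mulr0.
case: nD; exists e => //; exists (eact h^-1%g (val x)) => //.
by rewrite src_eact src_star.
Qed.

Let Phi0C : Cc_cj Phi0.
Proof.
apply/(Cc_cjP tree); split=> [h s v w|v e||k h v].
- apply/funext => e; rewrite -[RHS]/(s * Phi0 h v e + Phi0 h w e) /Phi0 mulr_sumr -big_split.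
  apply: eq_bigr => x _ /=; rewrite -[(s *: v + w) x]/(s * v x + w x).
  by rewrite !mulrDr; congr (_ + _); rewrite !mulrA; congr (_ * _); rewrite mulrC !mulrA.
- apply: (@continuous_invg _ _ (fun h =>
    \sum_(x <- stars o) mass^-1 * (c0 (val e) (eact h (val x)) * v x))).
  apply: loc_const_continuous => h.
  exists (o :: [seq tgt (val x) | x <- stars o]) => h' hh'.
  apply: eq_big_seq => x xs; congr (_ * (c0 _ _ * _)); apply: edge_inj.
    by rewrite !src_eact src_star hh'// mem_head.
  by rewrite !tgt_eact; apply: hh'; rewrite inE; apply/orP; right; apply/mapP; exists x.
- exact: supp0.
- apply/funext => e; rewrite perm_repE /Phi0.
  have st : perm_eq (stars o) [seq star_act k x | x <- stars o].
    apply: uniq_perm; [exact: stars_uniq| |move=> x].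
      by rewrite map_inj_uniq ?stars_uniq//; exact: can_inj (star_actK k).
    rewrite (mem_stars tree); apply/esym/mapP; exists (star_act k^-1%g x).
      exact: (mem_stars tree).
    by rewrite -{1}(invgK k) star_actK.
  rewrite [LHS](perm_big _ st) big_map; apply: eq_bigr => x _; rewrite perm_repE invgK; congr (_ * (_ * _)).
  rewrite !val_star_act -[RHS](c0_inv (stab_val k)) eactVK -!eactM; congr (c0 _ _).
  by rewrite !invgM invgK -!mulgA mulVg mulg1.
Qed.

Let Phi0_kernel e b : kappa Phi0 e b = c0 (val e) b.
Proof.
rewrite /hecke_kernel.
have -> : (fun h => Phi0 h (mark (eact h b)) e) =
    (fun h => mass^-1 * c0 (val e) b * (h (src b) == o)%:R).
  apply/funext => h; rewrite /Phi0.
  have [ho|ho] := eqVneq (h (src b)) o; last first.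
    rewrite mulr0 big1// => x _; rewrite mark_eq0 ?src_eact; last exact/eqP.
    by rewrite -[(0 : V) x]/(0 : C) !mulr0.
  have [y yb] := @star_of _ o (eact h b) ho.
  rewrite (bigD1_seq y (mem_stars tree y) (stars_uniq o)) /=.
  rewrite big1 => [|x xy]; last first.
    by rewrite /mark -yb (inj_eq val_inj) (negbTE xy) !mulr0.
  by rewrite /mark yb eqxx -[sval y]/(val y) yb eactK !mulr1 addr0.
have ccI : cc (fun h => (h (src b) == o)%:R).
  split.
    by apply: loc_const_continuous => g; exists [:: src b] => h ->; rewrite ?mem_head.
  apply: (@bounded_move _ conn locfin (src b)).
  apply: (@sub_finite_set _ _ [set o]) => // _ [h hx <-] /=.
  by apply/eqP; apply: contraT => ho; move: hx; rewrite /= (negbTE ho) eqxx.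
rewrite cintegralZ; last exact: (cc_cintegrable tree haar ccI).
rewrite (cintegral_cyl_indic o tree haar).
by rewrite mulrAC mulVf ?mul1r//; exact: mass_neq0.
Qed.

Lemma realize_kernel : exists2 Phi, Cc_cj Phi & forall f a,
  hecke_op mu e1 Phi f a = \sum_(b \in [set: edge X]) f b * c0 a b.
Proof.
exists Phi0; first exact: Phi0C.
move=> f a; have [g <-] := edge_transitive tree (val e1) a.
rewrite (hecke_op_at _ tree haar _ _ Phi0C) (hecke_actE tree haar _ _ _ Phi0C).
rewrite [RHS](@reindex_fsbigT _ _ _ _ _ (eact g)); last first.
  by exists (eact g^-1%g) => b; [exact: eactK|exact: eactVK].
by apply: eq_fsbigr => b _; rewrite Phi0_kernel c0_inv.
Qed.

End Realization.
End HeckeKernels.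

(** * Identification of the operator algebra *)

Section OperatorAlgebra.
Variables (R : realType) (X : sgraph) (q : nat) (o : X) (e1 : star o).
Hypothesis tree : regular_tree q.+1 X.
Variable mu : {measure set (borel (aut X)) -> \bar R}.
Hypothesis haar : haar_measure mu.
Local Notation C := (Cplx R).
Local Notation Cc_cj := (@Cc_cj R X o).
Local Notation image := (hecke_op mu e1 @` Cc_cj).

Lemma inversion_hecke : image (@edge_inversion R X).
Proof.
have [||Phi PhiC PhiE] :=
    @realize_kernel R X q o e1 tree mu haar (fun a b => (b == eop a)%:R).
- by move=> g a b; rewrite -eact_eop (inj_eq (@eact_inj X g)).
- move=> a; apply: (@sub_finite_set _ _ [set eop a]) => // b /=.
  by have [->//|_] := eqVneq b (eop a); rewrite eqxx.
exists Phi => //; apply/funext => f; apply/funext => a; rewrite PhiE.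
rewrite (fsbig_list (r := [:: eop a]))//; first by rewrite big_seq1 eqxx mulr1.
by move=> b; rewrite inE => /negbTE ->; rewrite mulr0.
Qed.

Lemma laplacian_hecke : image (@edge_laplacian R X).
Proof.
have [_ _ reg] := tree.
have [||Phi PhiC PhiE] :=
    @realize_kernel R X q o e1 tree mu haar (fun a b => (nxt a b)%:R).
- by move=> g a b; rewrite nxt_eact.
- move=> a; apply: (@sub_finite_set _ _ [set` succs a]) => [b /=|].
    by rewrite (mem_succs reg); case: (nxt a b) => //; rewrite eqxx.
  exact: finite_seq.
exists Phi => //; apply/funext => f; apply/funext => a.
rewrite PhiE (laplacianE tree) (fsbig_list (succs_uniq a)) => [|b].
  by apply: eq_big_seq => b; rewrite (mem_succs reg) => ->; rewrite mulr1.
by rewrite (mem_succs reg) => /negbTE ->; rewrite mulr0.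
Qed.

Lemma image_subalgebra : operator_subalgebra (image : set ((edge X -> C) -> edge X -> C)).
Proof.
have cmp S T : image S -> image T -> image (S \o T).
  move=> [P2 P2C <-] [P1 P1C <-]; exists (convolution mu P1 P2).
    exact: (convolution_Cc_cj tree haar P1C P2C).
  exact: (hecke_op_convolution e1 tree haar P1C P2C).
split=> // [|S T [P1 P1C <-] [P2 P2C <-]|c S [Phi PhiC <-]].
(* The identity is obtained as the square of the inversion. *)
- have <- : @edge_inversion R X \o @edge_inversion R X = id.
    by apply/funext => f; apply/funext => a; rewrite /= /edge_inversion eopK.
  exact: (cmp _ _ inversion_hecke inversion_hecke).
- exists (1 *: P1 + P2); first exact: (Cc_cj_lin tree 1 P1C P2C).
  by rewrite (hecke_op_lin e1 tree haar 1 P1C P2C) scale1r.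
(* Linearity is available for combinations c Phi1 + Phi2, so 0 is written as - Phi + Phi. *)
- have P0C := Cc_cj_lin tree (-1) PhiC PhiC.
  exists (c *: Phi + (-1 *: Phi + Phi)); first exact: (Cc_cj_lin tree c PhiC P0C).
  rewrite (hecke_op_lin e1 tree haar c PhiC P0C) (hecke_op_lin e1 tree haar (-1) PhiC PhiC).
  by rewrite scaleN1r addNr addr0.
Qed.

(** The constant part has to be the mean value over the star, which contains [e1] and so is
    non-empty. *)
Lemma constant_decomposition (v : permV R o) :
  exists! w : permV R o * permV R o, [/\ V0 w.1, V1 w.2 & v = w.1 + w.2].
Proof.
have sumE (u : permV R o) : \sum_(e \in [set: star o]) u e = \sum_(e <- stars o) u e.
  by rewrite (fsbig_list (stars_uniq o))// => e; rewrite (mem_stars tree).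
pose n : C := (size (stars o))%:R.
have n0 : n != 0.
  by rewrite pnatr_eq0 size_eq0; apply/eqP => s0; have := mem_stars tree e1; rewrite s0.
have sumc (c : C) : \sum_(e <- stars o) c = n * c.
  by rewrite big_const_seq count_predT iter_addr_0 mulr_natl.
pose m : C := n^-1 * \sum_(e <- stars o) v e.
exists (cst m, v - cst m); split.
  split; [by exists m| |by rewrite addrC subrK].
  rewrite /V1 /= sumE sumrB sumc /m mulrA divff// mul1r subrr.
  by [].
move=> [w1 w2] [[c /= ->] w20 vE].
have cm : c = m.
  apply: (mulfI n0); rewrite /m mulrA divff// mul1r vE.
  rewrite -[\sum_(e <- stars o) _]/(\sum_(e <- stars o) (c + w2 e)) big_split/= sumc.
  by move: w20; rewrite /V1 /= sumE => ->; rewrite addr0.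
by rewrite vE cm addrC addKr.
Qed.

End OperatorAlgebra.

Theorem propositionE (R : realType) (q : nat) (X : sgraph) (o : X)
    (e1 : star o)
    (mu : {measure set (borel (aut X)) -> \bar R})
    (nu : {measure set (borel (stab o)) -> \bar R}) :
  (0 < q)%N -> regular_tree q.+1 X ->
  haar_measure mu -> haar_measure nu -> nu setT = 1%E ->
  [/\ (* V = V0 (+) V1 *)
      forall v : permV R o, exists! w : permV R o * permV R o,
        [/\ V0 w.1, V1 w.2 & v = w.1 + w.2],
      (* the identification of C(G x_K V) with Maps(E, C) *)
      (forall F (g : aut X), @sections R X o F ->
         Theta e1 F (eact g (val e1)) = F g e1) /\
      set_bij (@sections R X o) setT (Theta e1),
      (* the algebra structure and the action, a right action *)
      (forall F Phi, @sections R X o F -> Cc_cj Phi ->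
         sections (hecke_act mu F Phi)) /\
      forall Phi1 Phi2 : aut X -> permV R o -> permV R o,
        Cc_cj Phi1 -> Cc_cj Phi2 ->
        [/\ forall c : Cplx R, Cc_cj (c *: Phi1 + Phi2),
            forall c : Cplx R, hecke_op mu e1 (c *: Phi1 + Phi2) =
              c *: hecke_op mu e1 Phi1 + hecke_op mu e1 Phi2,
            Cc_cj (convolution mu Phi1 Phi2) &
            hecke_op mu e1 (convolution mu Phi1 Phi2) =
              hecke_op mu e1 Phi2 \o hecke_op mu e1 Phi1],
      (* faithfulness of the action of the quotient by U *)
      forall Phi : aut X -> permV R o -> permV R o, Cc_cj Phi ->
        (hecke_op mu e1 Phi = cst 0 <-> hecke_null nu Phi) &
      (* generators and relations *)
      hecke_op mu e1 @` (@Cc_cj R X o) =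
        operator_algebra_gen
          [set @edge_laplacian R X; @edge_inversion R X] /\
      exists rho : edge_presented (Cplx R) q ->
          (edge X -> Cplx R) -> edge X -> Cplx R,
        [/\ algebra_action rho, injective rho,
            rho (edge_gen _ q true) = @edge_laplacian R X,
            rho (edge_gen _ q false) = @edge_inversion R X &
            range rho = hecke_op mu e1 @` (@Cc_cj R X o)]].
Proof.
move=> q0 tree haar haarK nu1.
have [rho [act inj rhoD rhoX [rangeE rangeP]]] := edge_presentation R (val e1) tree q0.
have imE : hecke_op mu e1 @` (@Cc_cj R X o) =
    operator_algebra_gen [set @edge_laplacian R X; @edge_inversion R X].
  apply/seteqP; split=> [_ [Phi PhiC <-]|]; last first.
    apply: smallest_sub; first exact: (image_subalgebra e1 tree haar).
    move=> _ [->|->]; first exact: (laplacian_hecke e1 tree haar).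
    exact: (inversion_hecke e1 tree haar).
  have [L [uL L0 LE]] := hecke_kernel_support tree haar PhiC.
  rewrite -rangeE; apply: (rangeP _ (hecke_kernel mu Phi e1) L uL).
  - by move=> b; exact: L0.
  (* An automorphism fixing [e1] fixes its source [o], so that [hecke_kernel_invariant] applies to
     it. *)
  - move=> g b ge; have go : g o == o by rewrite -(src_star e1) -src_eact ge.
    have kE : star_act (Stab go) e1 = e1 by exact/val_inj.
    by rewrite -{1}kE (hecke_kernel_invariant tree haar (Stab go) e1 b PhiC).
  - move=> g f; rewrite (hecke_op_at e1 tree haar f g PhiC) LE.
    by apply: eq_bigr => b _; rewrite mulrC.
split.
- exact: (constant_decomposition e1 tree).
- split; last exact: (Theta_bij R e1 tree).
  by move=> F g FS; exact: (Theta_at e1 tree).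
- split=> [F Phi FS PhiC|Phi1 Phi2 P1C P2C].
    exact: (hecke_act_sections e1 tree haar FS PhiC).
  split=> [c|c||].
  + exact: (Cc_cj_lin tree c P1C P2C).
  + exact: (hecke_op_lin e1 tree haar).
  + exact: (convolution_Cc_cj tree haar P1C P2C).
  + exact: (hecke_op_convolution e1 tree haar P1C P2C).
- move=> Phi PhiC; rewrite (hecke_op_eq0 e1 tree haar PhiC).
  by rewrite (hecke_null_kernel e1 tree haar haarK nu1 PhiC).
- split=> //; exists rho; split=> //; first by rewrite imE.
Qed.
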